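(* Let $T_0:[0,1]\to[0,1]$ be a nonsingular Borel map, let $\rho_\xi\in BV$, $\xi\in[0,\overline\xi)$, be probability densities with support in $[0,1]$, and for a nonsingular Borel map $T$ let $L_{\xi,T}f=\rho_\xi\,\hat\ast\,L_Tf$. Suppose that $L_{0,T_0}$ is mixing: for each $g\in BV$ with $\int g\,dm=0$, $\lim_{n\to\infty}\|L_{0,T_0}^ng\|_1=0$. Let $f_0$ be the fixed probability measure of $L_{0,T_0}$. (a) (perturbing the map) For $\delta\in[0,\overline\delta)$ let $D_\delta=\mathrm{Id}+\delta S:[0,1]\to[0,1]$ be a bilipschitz homeomorphism, where $S$ is $1$-Lipschitz with $S(0)=S(1)=0$, the support $\chi_S$ of $S$ is a finite union of intervals, and there is $K\ge0$ with $\|1_{\chi_S}\cdot L_{T_0}f\|_{BV}\le K\|f\|_{BV}$ for each $f\in BV$. Let $T_\delta=D_\delta\circ T_0$ and let $f_\delta$ be fixed probability measures of $L_{0,T_\delta}$. Then $R(1,L_{0,T_0}):V\to V$ is a continuous operator and $$\lim_{\delta\to0}\left\|\frac{f_\delta-f_0}{\delta}-R(1,L_{0,T_0})\big[\rho_0\,\hat\ast\,(-L_{T_0}(f_0)S)'\big]\right\|_1=0 .$$ (b) (perturbing the noise) Suppose $T_0$ is Lipschitz, $\|\rho_\xi-\rho_0\|_1\le C\xi$ for all $\xi$, and there exists $\dot\rho\in BS$ such that $\lim_{\xi\to0}\left\|\frac{\rho_\xi-\rho_0}{\xi}-\dot\rho\right\|_W=0$. Let $f_\xi$ be fixed probability measures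 of $L_{\xi,T_0}$. Then $R(1,L_{0,T_0}):V_W\to V_W$ is a continuous operator and $$\lim_{\xi\to0}\left\|\frac{f_\xi-f_0}{\xi}-R(1,L_{0,T_0})\big[\dot\rho\,\hat\ast\,L_{T_0}(f_0)\big]\right\|_W=0 .$$
   Context: $BS$ is the space of finite signed Borel measures on $[0,1]$; $m$ is Lebesgue measure; $L^1=L^1[0,1]$ is identified with the absolutely continuous elements of $BS$ (measures identified with densities); $BV=BV[0,1]$ is the space of $\mu\in L^1$ with density of bounded variation, with $\|\mu\|_{BV}=\|\mu\|_1+\mathrm{Var}_{[0,1]}(d\mu/dm)$. The Wasserstein–Kantorovich norm on $BS$ is $\|\mu\|_W=\sup\{\int_0^1 g\,d\mu:\|g\|_\infty\le1,\ \mathrm{Lip}(g)\le1\}$. $V=\{f\in L^1:f([0,1])=0\}$ with norm $\|\cdot\|_1$; $V_W=\{\mu\in BS:\mu([0,1])=0\}$ with norm $\|\cdot\|_W$. For a Borel map $T$, $L_T$ is the pushforward $L_T\mu(A)=\mu(T^{-1}A)$; $T$ nonsingular means that $L_T$ preserves absolutely continuous measures. Let $\pi:\mathbb R\to[0,1]$, $\pi(x)=\min_{i\in\mathbb Z}|x-2i|$. For $\mu,\nu\in BS$, $\mu\,\hat\ast\,\nu=\pi_*(\hat\mu\ast\hat\nu)\in BS$, where $\hat\mu,\hat\nu$ are the extensions by zero to $\mathbb R$, $\ast$ is the usual convolution on $\mathbb R$, and $\pi_*$ is the pushforward. $(L_{T_0}(f_0)S)'\in BS$ is the distributional derivative of the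 $BV$ function $L_{T_0}(f_0)S$. $R(1,L)=\sum_{n\ge0}L^n=(\mathrm{Id}-L)^{-1}$. *)

(* Defs.v *)
From HB Require Import structures.
From mathcomp Require Import all_boot all_order all_algebra.
From mathcomp Require Import all_classical all_reals all_analysis.
From mathcomp Require Import measurable_realfun lra.
Set Implicit Arguments.
Unset Strict Implicit.
Unset Printing Implicit Defensive.
Import Order.TTheory GRing.Theory Num.Theory.
Import numFieldNormedType.Exports.
Local Open Scope classical_set_scope.
Local Open Scope ring_scope.
Local Open Scope charge_scope.

Notation I01 := [set` `[0%R, 1%R]].

Section charges.
Context d (T : measurableType d) (R : realType).
Variable mu : {charge set T -> \bar R}.

Fact hahn_ex : exists PN : set T * set T, hahn_decomposition mu PN.1 PN.2.
Proof. by have [P [N h]] := Hahn_decomposition mu; exists (P, N). Qed.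

(* The Jordan parts do not depend, on measurable sets, on the Hahn
   decomposition which is chosen. *)
Definition pos_part : {finite_measure set T -> \bar R} :=
  jordan_pos (projT2 (cid hahn_ex)).

Definition neg_part : {finite_measure set T -> \bar R} :=
  jordan_neg (projT2 (cid hahn_ex)).

End charges.

Definition cpush d1 d2 (T1 : measurableType d1) (T2 : measurableType d2)
    (R : realType) (mu : {charge set T1 -> \bar R}) (f : T1 -> T2)
    (mf : measurable_fun setT f) : {charge set T2 -> \bar R} :=
  measure_function_pushforward__canonical__charge_Charge mu mf.

Section product.
Context d1 d2 (T1 : measurableType d1) (T2 : measurableType d2) (R : realType).

Section finite_measures.
Variables (m1 : {finite_measure set T1 -> \bar R})
          (m2 : {finite_measure set T2 -> \bar R}).

Definition fprod : set (T1 * T2) -> \bar R := (m1 \x m2)%E.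

HB.instance Definition _ := Measure.on fprod.

Fact fprod_fin : fin_num_fun fprod.
Proof.
apply: lty_fin_num_fun.
have h : fprod setT = (m1 setT * m2 setT)%E.
  by rewrite -product_measure1E// setXTT.
rewrite -[X in (X < _)%E]/(fprod setT) h.
by rewrite ltey_eq fin_numM// fin_num_measure.
Qed.

HB.instance Definition _ := Measure_isFinite.Build _ _ _ fprod fprod_fin.

End finite_measures.

Definition cprod (mu : {charge set T1 -> \bar R})
    (nu : {charge set T2 -> \bar R}) : {charge set (T1 * T2)%type -> \bar R} :=
  cadd (cadd (fprod (pos_part mu) (pos_part nu))
             (fprod (neg_part mu) (neg_part nu)))
       (copp (cadd (fprod (pos_part mu) (neg_part nu))
                   (fprod (neg_part mu) (pos_part nu)))).

End product.

(* A finite signed Borel measure on [0, 1] is represented by its extension by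
   zero to the real line. *)
Record bs (R : realType) := Bs {
  bs_charge :> {charge set (measurableTypeR R) -> \bar R} ;
  bs_supp : forall A : set (measurableTypeR R), measurable A ->
    bs_charge A = bs_charge (A `&` I01) }.

(* Charges take arbitrary values on non-measurable sets, so equality of signed
   measures is equality on Borel sets. *)
Definition bs_eq (R : realType) (mu nu : bs R) : Prop :=
  forall A : set (measurableTypeR R), measurable A -> mu A = nu A.

Section bs_operations.
Context {R : realType}.
Local Notation RM := (measurableTypeR R).
Implicit Types (mu nu : bs R) (A : set RM).

Fact bs_zero_supp A : measurable A ->
  @czero _ RM R A = czero (A `&` I01).
Proof. by []. Qed.

Definition bs_zero : bs R := @Bs R czero bs_zero_supp.

Fact bs_add_supp mu nu A : measurable A ->
  cadd mu nu A = cadd mu nu (A `&` I01).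
Proof. by move=> mA; rewrite /cadd /= (bs_supp mu mA) (bs_supp nu mA). Qed.

Definition bs_add mu nu : bs R := Bs (bs_add_supp mu nu).

Fact bs_scale_supp (a : R) mu A : measurable A ->
  cscale a mu A = cscale a mu (A `&` I01).
Proof. by move=> mA; rewrite /cscale /= (bs_supp mu mA). Qed.

Definition bs_scale (a : R) mu : bs R := Bs (bs_scale_supp a mu).

Definition bs_sub mu nu : bs R := bs_add mu (bs_scale (-1) nu).

Fixpoint bs_sum (F : nat -> bs R) (n : nat) : bs R :=
  if n is k.+1 then bs_add (bs_sum F k) (F k) else bs_zero.

Definition is_probability mu : Prop :=
  (forall A, measurable A -> (0 <= mu A)%E) /\ mu I01 = 1%E.

Definition bs_integral mu (g : R -> R) : \bar R :=
  (\int[pos_part mu]_(x in I01) (g x)%:E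
   - \int[neg_part mu]_(x in I01) (g x)%:E)%E.

End bs_operations.

Section norms.
Context {R : realType}.
Implicit Types (mu : bs R) (h : R -> R).

Definition wnorm mu : \bar R :=
  ereal_sup [set bs_integral mu g | g in
    [set g : R -> R | (forall x, x \in `[0, 1] -> `|g x| <= 1) /\
                      1.-lipschitz_I01 g]].

Definition is_L1 mu : Prop := mu `<< @lebesgue_measure R.

(* Meaningful only when [is_L1 mu]. *)
Definition density mu : R -> R :=
  fun x => fine (('d mu '/d @lebesgue_measure R) x).

Definition norm1_fun h : \bar R :=
  (\int[@lebesgue_measure R]_(x in I01) `|(h x)%:E|)%E.

(* Variation on [0, 1] of the class of h modulo a.e. equality. *)
Definition var01 h : \bar R :=
  ereal_inf [set total_variation 0 1 g | g in
    [set g : R -> R | ae_eq (@lebesgue_measure R) I01 g h]].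

Definition bvnorm_fun h : \bar R := (norm1_fun h + var01 h)%E.

(* Both norms are +oo on the measures which are not absolutely continuous. *)
Definition norm1 mu : \bar R :=
  if `[< is_L1 mu >] then norm1_fun (density mu) else +oo%E.

Definition bvnorm mu : \bar R :=
  if `[< is_L1 mu >] then bvnorm_fun (density mu) else +oo%E.

Definition is_BV mu : Prop := (bvnorm mu < +oo)%E.

Definition V_space : set (bs R) := [set mu | is_L1 mu /\ mu I01 = 0%E].

Definition VW_space : set (bs R) := [set mu | mu I01 = 0%E].

End norms.

(* A Borel map [0, 1] -> [0, 1]; the values outside [0, 1] play no role. *)
Record borel_selfmap (R : realType) := BorelSelfmap {
  selfmap_fun :> R -> R ;
  selfmap_meas : measurable_fun (I01 : set (measurableTypeR R))
    (selfmap_fun : measurableTypeR R -> measurableTypeR R) ;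
  selfmap_in : forall x, x \in `[0, 1] -> selfmap_fun x \in `[0, 1] }.

Section pushforward.
Context {R : realType}.
Implicit Types (T D : borel_selfmap R) (mu : bs R).
Local Notation RM := (measurableTypeR R).

Fact selfmap_comp_meas D T : measurable_fun (I01 : set RM) (D \o T : RM -> RM).
Proof.
apply: (@measurable_comp _ _ _ RM RM RM I01).
- exact: measurable_itv.
- by move=> _ [x xI <-]; exact: selfmap_in.
- exact: selfmap_meas.
- exact: selfmap_meas.
Qed.

Fact selfmap_comp_in D T x : x \in `[0, 1] -> (D \o T) x \in `[0, 1].
Proof. by move=> xI; exact/selfmap_in/selfmap_in. Qed.

Definition selfmap_comp D T : borel_selfmap R :=
  BorelSelfmap (selfmap_comp_meas D T) (@selfmap_comp_in D T).

Definition selfmap_ext T : RM -> RM := (T : RM -> RM) \_ I01.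

Fact selfmap_ext_meas T : measurable_fun setT (selfmap_ext T).
Proof.
apply/(measurable_restrictT _ _).1; first exact: measurable_itv.
exact: selfmap_meas.
Qed.

Fact push_supp T mu (A : set RM) : measurable A ->
  cpush mu (selfmap_ext_meas T) A = cpush mu (selfmap_ext_meas T) (A `&` I01).
Proof.
have mI : measurable (I01 : set RM) by exact: measurable_itv.
have m B : measurable B -> measurable (selfmap_ext T @^-1` B).
  by move=> mB; rewrite -[X in measurable X]setTI; exact: selfmap_ext_meas.
move=> mA; rewrite /= /pushforward (bs_supp mu (m _ mA)).
rewrite (bs_supp mu (m _ (measurableI _ _ mA mI))); congr (bs_charge mu _).
apply/seteqP; split => x /= [+ xI]; rewrite /selfmap_ext /patch mem_set//.
  by move=> TA; split => //; split => //; exact: selfmap_in.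
by case.
Qed.

Definition push T mu : bs R := Bs (push_supp T mu).

Definition nonsingular T : Prop := forall mu, is_L1 mu -> is_L1 (push T mu).

Definition bilipschitz_homeo (f : R -> R) : Prop :=
  set_bij I01 I01 f /\
  exists2 k : R, 0 < k & forall x y, x \in `[0, 1] -> y \in `[0, 1] ->
    k^-1 * `|x - y| <= `|f x - f y| <= k * `|x - y|.

End pushforward.

Section fold.
Context {R : realType}.
Local Notation RM := (measurableTypeR R).

(* The infimum is a minimum, see [fold01_min]. *)
Definition fold01 (x : R) : R := inf [set `|x - 2 * i%:~R| | i in [set: int]].

Lemma fold01_lb (x : R) : lbound [set `|x - 2 * i%:~R| | i in [set: int]] 0.
Proof. by move=> _ [i _ <-]. Qed.

Lemma fold01_le (x : R) (i : int) : fold01 x <= `|x - 2 * i%:~R|.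
Proof. by apply: ge_inf; [exists 0; exact: fold01_lb|exists i]. Qed.

Lemma fold01_in (x : R) : fold01 x \in `[0, 1].
Proof.
rewrite in_itv/=; apply/andP; split.
  by apply: lb_le_inf; [exists `|x - 2 * 0%:~R|; exists 0|exact: fold01_lb].
set i := Num.floor ((x + 1) / 2).
apply: le_trans (fold01_le x i) _.
have /andP[h1 h2] := floor_itv ((x + 1) / 2).
move: h1 h2; rewrite -/i intrD ler_pdivlMr// ltr_pdivrMr// => h1 h2.
by rewrite ler_norml; apply/andP; split; lra.
Qed.

Lemma fold01_min (x : R) : exists i : int, fold01 x = `|x - 2 * i%:~R|.
Proof.
set i := Num.floor ((x + 1) / 2); exists i.
apply/eqP; rewrite eq_le fold01_le/=.
apply: lb_le_inf; first by exists `|x - 2 * 0%:~R|; exists 0.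
move=> _ [j _ <-].
have /andP[h1 h2] := floor_itv ((x + 1) / 2).
move: h1 h2; rewrite -/i intrD ler_pdivlMr// ltr_pdivrMr// => h1 h2.
have xi1 : `|x - 2 * i%:~R| <= 1 by rewrite ler_norml; apply/andP; split; lra.
have [ij|ji|->//] := ltgtP i j.
  have : i%:~R + 1 <= j%:~R :> R by rewrite -[1]/(1%:~R) -intrD ler_int lezD1.
  by move=> ?; apply: le_trans xi1 _; rewrite ler_normr; apply/orP; right; lra.
have : j%:~R + 1 <= i%:~R :> R by rewrite -[1]/(1%:~R) -intrD ler_int lezD1.
by move=> ?; apply: le_trans xi1 _; rewrite ler_normr; apply/orP; left; lra.
Qed.

Lemma fold01_lip (x y : R) : `|fold01 x - fold01 y| <= `|x - y|.
Proof.
have h a b : fold01 a - fold01 b <= `|a - b|.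
  rewrite lerBlDr -lerBlDl; apply: lb_le_inf.
    by exists `|b - 2 * 0%:~R|; exists 0.
  move=> _ [i _ <-]; rewrite lerBlDl.
  apply: le_trans (fold01_le a i) _.
  by rewrite -[X in `|X - _|](subrK b) -addrA; exact: ler_normD.
by rewrite ler_norml h lerNl opprB distrC h.
Qed.

Lemma fold01_add_meas :
  measurable_fun setT (fun z : RM * RM => fold01 (z.1 + z.2) : RM).
Proof.
have cf : continuous fold01.
  move=> x; apply/cvgrPdist_le => e e0; near=> y.
  apply: le_trans (fold01_lip x y) _.
  by near: y; apply: cvgr_dist_le.
have mf : measurable_fun [set: RM] (fold01 : RM -> RM).
  exact: continuous_measurable_fun.
apply: (measurableT_comp mf).
exact: (@measurable_funD _ (RM * RM)%type R setT fst snd).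
Unshelve. all: by end_near. Qed.

Fact hconv_supp (mu nu : bs R) (A : set RM) : measurable A ->
  cpush (cprod mu nu) fold01_add_meas A =
  cpush (cprod mu nu) fold01_add_meas (A `&` I01).
Proof.
move=> mA; rewrite /= /pushforward; congr (_ _).
by apply/seteqP; split => z /=; [move=> ?; split => //; exact: fold01_in|case].
Qed.

(* The pushforward under fold01 of mu * nu, which is itself the pushforward of
   the product measure under addition. *)
Definition hconv (mu nu : bs R) : bs R := Bs (hconv_supp mu nu).

Definition transfer (rho : bs R) (T : borel_selfmap R) (f : bs R) : bs R :=
  hconv rho (push T f).

End fold.

Section distributions.
Context {R : realType}.
Implicit Types (phi h S : R -> R) (D : bs R).

Definition test_function phi : Prop :=
  (forall (n : nat) (x : R), derivable (derive1n n phi) x 1) /\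
  compact (closure [set x | phi x != 0]).

(* D is the distributional derivative on the real line of the function equal to
   h on [0, 1] and to 0 elsewhere. *)
Definition is_distr_derivative h D : Prop :=
  forall phi, test_function phi ->
    bs_integral D phi =
    (- \int[@lebesgue_measure R]_(x in I01) (derive1 phi x * h x)%:E)%E.

(* The topological support of S restricted to [0, 1]. *)
Definition support01 S : set R := closure [set x | x \in `[0, 1] /\ S x != 0].

Definition finite_union_of_intervals (A : set R) : Prop :=
  exists s : seq (interval R), A = \bigcup_(i in [set` s]) [set` i].

End distributions.

Section resolvent.
Context {R : realType}.
Implicit Types (V : set (bs R)) (N : bs R -> \bar R) (L A : bs R -> bs R).

Definition op_norm V N A : \bar R :=
  ereal_sup [set N (A mu) | mu in [set mu | V mu /\ (N mu <= 1)%E]].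

Definition is_linear_on V A : Prop :=
  forall (a : R) mu nu, V mu -> V nu ->
    bs_eq (A (bs_add (bs_scale a mu) nu)) (bs_add (bs_scale a (A mu)) (A nu)).

(* A is the continuous linear operator sum_n L^n = (Id - L)^-1 on the subspace
   V with norm N, the series converging in operator norm. *)
Definition is_resolvent V N L A : Prop :=
  [/\ (forall mu, V mu -> V (A mu)),
      is_linear_on V A,
      (op_norm V N A < +oo)%E,
      op_norm V N (fun mu => bs_sub (A mu) (bs_sum (fun k => iter k L mu) n))
        @[n --> \oo] --> 0%E &
      forall mu, V mu -> bs_eq (bs_sub (A mu) (L (A mu))) mu /\
                         bs_eq (A (bs_sub mu (L mu))) mu].

End resolvent.

(* Main.v *)
(* With L the unperturbed operator and L_t the perturbed one,
   f_t - f_0 = L (f_t - f_0) + (L_t - L) f_t, so that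
   (f_t - f_0) / t = (Id - L)^-1 [(L_t - L) f_t / t].
   Since rho_0 has bounded variation, the dual of the convolution with rho_0
   maps bounded functions to Lipschitz ones; hence this convolution is
   continuous from the Wasserstein norm to the L^1 norm. A charge of mass zero
   is, up to a small Wasserstein error, a combination of finitely many point
   masses, whose convolutions with rho_0 are in BV; hence mixing on BV is
   uniform on the unit ball, some power of L halves the total variation of the
   charges of mass zero, and the Neumann series converges geometrically in both
   norms.
   For (a) it then suffices that (D_delta# - Id) p / delta tends to -(p S)' in
   the Wasserstein norm, where p = L_T0 f_0. Against a C^1 function phi, Fubini
   turns the difference into the integral of phi' times the difference between
   p S (y) and 1 / delta times the integral of p from D_delta^-1 y to y, which
   is O(delta) in L^1 because p has bounded variation where S is not zero. *)
From HB Require Import structures.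
From mathcomp Require Import all_boot all_order all_algebra.
From mathcomp Require Import all_classical all_reals all_analysis.
From mathcomp Require Import measurable_realfun ring lra.
(* Required last, so that fprod is the product measure and not that of finfun. *)
Require Import Defs.
Set Implicit Arguments.
Unset Strict Implicit.
Unset Printing Implicit Defensive.
Import Order.TTheory GRing.Theory Num.Theory.
Import numFieldNormedType.Exports.
Local Open Scope classical_set_scope.
Local Open Scope ring_scope.
Local Open Scope charge_scope.

(** * Bounded measurable functions *)

(** A charge is arbitrary off the Borel sets, so measures are handled through their integrals
    [cint mu g] against bounded measurable [g], operators through their adjoints on such [g]
    ([dual]), and [tv] as a dual norm; on absolutely continuous measures [tv] is the L^1 norm.
    Applied to mu = L mu + eta with mu = f_t - f_0, the bounded resolvent first gives tv mu = O(t).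
    This a priori bound, and not a continuity argument, is what allows f_t to be replaced by f_0 in
    the forcing term. In (a), -(p S)' has to be built as a measure although p has controlled
    variation only on the support of S. Where S vanishes, D_delta is the identity, so p may be
    truncated there. Since S + id is nondecreasing, the truncated p S is a difference of
    nondecreasing functions, and each of them gives a measure: the image of Lebesgue measure under
    its quantile function. Wasserstein test functions are only Lipschitz; they are replaced by
    moving averages, whose window shrinks to 0 while delta stays fixed. *)

HB.lock Definition fi d (T : measurableType d) (R : realType)
  (m : {finite_measure set T -> \bar R}) (g : T -> R) : R := \int[m]_x g x.

Section bmeas.
Context d (T : measurableType d) (R : realType).
Implicit Types (g h : T -> R) (m : {finite_measure set T -> \bar R}).

(** Such functions are integrable for every finite measure and stable under all the operations
    below, so no integrability condition has to follow the measures. *)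
Definition bmeas g := measurable_fun setT g /\ exists K, forall x, `|g x| <= K.

Lemma bmeas_cst (c : R) : bmeas (fun=> c).
Proof. by split => //; exists `|c|. Qed.

Lemma bmeasD g h : bmeas g -> bmeas h -> bmeas (fun x => g x + h x).
Proof.
move=> [mg [K gK]] [mh [L hL]]; split; first exact: measurable_funD.
by exists (K + L) => x; rewrite (le_trans (ler_normD _ _))// lerD.
Qed.

Lemma bmeasN g : bmeas g -> bmeas (fun x => - g x).
Proof.
move=> [mg [K gK]]; split; first exact: measurableT_comp.
by exists K => x; rewrite normrN.
Qed.

Lemma bmeasB g h : bmeas g -> bmeas h -> bmeas (fun x => g x - h x).
Proof. by move=> bg bh; apply: bmeasD => //; exact: bmeasN. Qed.

Lemma bmeasM g h : bmeas g -> bmeas h -> bmeas (fun x => g x * h x).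
Proof.
move=> [mg [K gK]] [mh [L hL]]; split; first exact: measurable_funM.
by exists (K * L) => x; rewrite normrM ler_pM.
Qed.

Lemma bmeasZ (a : R) g : bmeas g -> bmeas (fun x => a * g x).
Proof. by apply: bmeasM; exact: bmeas_cst. Qed.

Lemma bmeas_norm g : bmeas g -> bmeas (fun x => `|g x|).
Proof.
move=> [mg [K gK]]; split; first exact: measurableT_comp.
by exists K => x; rewrite normr_id.
Qed.

Lemma bmeas_indic (A : set T) : measurable A -> bmeas (\1_A : T -> R).
Proof.
move=> mA; split; first exact: measurable_indic.
by exists 1 => x; rewrite indicE; case: (_ \in _); rewrite ?normr1// normr0.
Qed.

Lemma bmeas_sum n (F : nat -> T -> R) :
  (forall k, bmeas (F k)) -> bmeas (fun x => \sum_(k < n) F k x).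
Proof.
move=> bF; elim: n => [|n ih].
  by under eq_fun do rewrite big_ord0; exact: bmeas_cst.
by under eq_fun do rewrite big_ord_recr/=; exact: bmeasD.
Qed.

Lemma bmeas_integrable m g : bmeas g -> m.-integrable setT (EFin \o g).
Proof.
move=> [mg [K gK]]; apply: measurable_bounded_integrable => //.
  exact: fin_num_fun_lty.
exists K; split; first by rewrite num_real.
by move=> M KM x _ /=; rewrite (le_trans (gK x))// ltW.
Qed.

Lemma fiE m g : fi m g = \int[m]_x g x.
Proof. by rewrite fi.unlock. Qed.

Lemma fi_cst m (c : R) : fi m (fun=> c) = c * fine (m setT).
Proof. by rewrite !fiE Rintegral_cst. Qed.

Lemma fiD m g h : bmeas g -> bmeas h ->
  fi m (fun x => g x + h x) = fi m g + fi m h.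
Proof. by move=> bg bh; rewrite !fiE RintegralD//; exact: bmeas_integrable. Qed.

Lemma fiB m g h : bmeas g -> bmeas h ->
  fi m (fun x => g x - h x) = fi m g - fi m h.
Proof. by move=> bg bh; rewrite !fiE RintegralB//; exact: bmeas_integrable. Qed.

Lemma fiZ m a g : bmeas g -> fi m (fun x => a * g x) = a * fi m g.
Proof. by move=> bg; rewrite !fiE RintegralZl//; exact: bmeas_integrable. Qed.

Lemma le_fi m g h : bmeas g -> bmeas h -> (forall x, g x <= h x) ->
  fi m g <= fi m h.
Proof.
by move=> bg bh gh; rewrite !fiE; apply: le_Rintegral => //; exact: bmeas_integrable.
Qed.

Lemma fi_indic m A : measurable A -> fi m (\1_A) = fine (m A).
Proof. by move=> mA; rewrite !fiE /Rintegral integral_indic// setIT. Qed.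

Lemma fi_normr m g : bmeas g -> `|fi m g| <= fi m (fun x => `|g x|).
Proof.
by move=> bg; rewrite !fiE; apply: le_normr_Rintegral => //; exact: bmeas_integrable.
Qed.

Lemma fi_le m g K : bmeas g -> (forall x, `|g x| <= K) ->
  `|fi m g| <= K * fine (m setT).
Proof.
move=> bg gK; rewrite (le_trans (fi_normr _ bg))// -fi_cst.
by apply: le_fi => //; [exact: bmeas_norm|exact: bmeas_cst].
Qed.

(** The sum counts the positive integers up to [t], so it is the integer part; the bound [t < n.+1]
    ensures that none is missed. *)
Lemma count_le_floor n (t : R) : 0 <= t < n.+1%:R ->
  t - 1 <= \sum_(k < n) (k.+1%:R <= t)%R%:R <= t.
Proof.
elim: n => [|n ih]; first by rewrite big_ord0; lra.
have H (j : nat) : j%:R <= t -> \sum_(k < j) (k.+1%:R <= t)%R%:R = j%:R :> R.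
  elim: j => [|j ihj] jt; first by rewrite big_ord0.
  rewrite big_ord_recr/= jt ihj ?natr1//.
  by rewrite (le_trans _ jt)// ler_nat.
move=> /andP[t0 tn]; have [nt|nt] := leP n.+1%:R t.
  by rewrite H// nt andbT; move: tn; rewrite -(natr1 n.+1); lra.
rewrite big_ord_recr/= (leNgt n.+1%:R) nt/= addr0; apply: ih.
by rewrite t0.
Qed.

(* Approximate uniformly by step functions. *)
Lemma bounded_functional0 (Phi : (T -> R) -> R) (C : R) :
  (forall g h, bmeas g -> bmeas h ->
     Phi (fun x => g x + h x) = Phi g + Phi h) ->
  (forall a g, bmeas g -> Phi (fun x => a * g x) = a * Phi g) ->
  (forall g K, bmeas g -> (forall x, `|g x| <= K) -> `|Phi g| <= C * K) ->
  (forall A, measurable A -> Phi (\1_A) = 0) ->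
  forall g, bmeas g -> Phi g = 0.
Proof.
move=> PD PZ PC P1 g bg; have [mg [K0 gK0]] := bg.
pose K := `|K0| + 1.
have K_gt0 : 0 < K by rewrite /K ltr_wpDl.
have gK x : `|g x| <= K.
  by rewrite (le_trans (gK0 x))// (le_trans (ler_norm _))// /K lerDl.
have PB f h : bmeas f -> bmeas h -> Phi (fun x => f x - h x) = Phi f - Phi h.
  move=> bf bh.
  have -> : (fun x => f x - h x) = (fun x => f x + (-1) * h x).
    by apply/funext => x; rewrite mulN1r.
  rewrite PD// ?PZ ?mulN1r//; exact: bmeasZ.
have C0 : 0 <= C.
  have := PC _ 1 (bmeas_cst 0); rewrite normr0 mulr1 => h.
  by rewrite (le_trans (normr_ge0 (Phi (fun=> 0))))// h.
(* [g + K] takes values in [0, 2K], which is cut into [2 * N.+1] layers of height [K / N.+1]. [S]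
   counts the layers below the graph, so [h] is within one layer of [g]. *)
have key N : `|Phi g| <= C * (K / N.+1%:R).
  pose A k := [set x | k.+1%:R <= (g x + K) * N.+1%:R / K].
  have mA k : measurable (A k).
    have [mt _] : bmeas (fun x => (g x + K) * N.+1%:R / K).
      by do 2 (apply: bmeasM; last exact: bmeas_cst); apply: bmeasD => //;
        exact: bmeas_cst.
    have := mt measurableT _ (measurable_itv `[k.+1%:R, +oo[).
    rewrite setTI; congr (measurable _); apply/seteqP.
    by split=> x; rewrite /A /= in_itv/= andbT.
  pose n := (N.+1).*2.
  pose S x : R := \sum_(k < n) \1_(A k) x.
  have bS : bmeas S by apply: (@bmeas_sum _ (fun k => \1_(A k))) => k; exact: bmeas_indic.
  have PS : Phi S = 0.
    rewrite /S; elim: n {S bS} => [|n ih].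
      under eq_fun do rewrite big_ord0.
      have -> : (fun=> 0 : R) = \1_(set0 : set T) :> (T -> R) by rewrite indic0.
      exact: P1.
    under eq_fun do rewrite big_ord_recr/=.
    rewrite PD ?ih ?P1 ?addr0//; last exact: bmeas_indic.
    by apply: (@bmeas_sum _ (fun k => \1_(A k))) => k; exact: bmeas_indic.
  have P1T : Phi (fun=> 1) = 0.
    have -> : (fun=> 1 : R) = \1_(setT : set T) :> (T -> R) by rewrite indicT.
    exact: P1.
  pose h x := (K / N.+1%:R) * S x + (- K) * 1.
  have bh : bmeas h.
    by apply: bmeasD; apply: bmeasZ => //; exact: bmeas_cst.
  have Ph : Phi h = 0.
    rewrite /h PD; [|exact: bmeasZ|exact/bmeasZ/bmeas_cst].
    by rewrite !PZ ?PS ?P1T ?mulr0 ?addr0//; exact: bmeas_cst.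
  have -> : Phi g = Phi (fun x => g x - h x) by rewrite PB// Ph subr0.
  apply: PC; first exact: bmeasB.
  move=> x; rewrite /h /S.
  have N0 : 0 < N.+1%:R :> R by rewrite ltr0n.
  set t := (g x + K) * N.+1%:R / K.
  have tE : g x = (K / N.+1%:R) * t - K.
    by rewrite /t; field; rewrite gt_eqF//= addrC natr1 gt_eqF.
  have /andP[t1 t2] : t - 1 <= \sum_(k < n) \1_(A k) x <= t.
    rewrite (eq_bigr (fun k : 'I_n => (k.+1%:R <= t)%R%:R : R)); last first.
      move=> k _; rewrite indicE; congr (_%:R); congr (nat_of_bool _).
      by apply/idP/idP => [/[!inE]|H]; rewrite ?inE.
    apply: count_le_floor; have /andP[] : - K <= g x <= K by rewrite -ler_norml.
    move=> g1 g2; have gK0' : 0 <= g x + K by lra.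
    rewrite /t; apply/andP; split.
      by rewrite divr_ge0 ?(ltW K_gt0)// mulr_ge0.
    apply: (@le_lt_trans _ _ n%:R); last by rewrite ltr_nat.
    rewrite ler_pdivrMr// /n -addnn natrD.
    rewrite -subr_ge0; set a := N.+1%:R in N0 *.
    have -> : (a + a) * K - (g x + K) * a = (K - g x) * a by ring.
    by rewrite mulr_ge0 ?subr_ge0// ltW.
  rewrite tE; set s := \sum_(k < n) _ in t1 t2 *.
  have -> : K / N.+1%:R * t - K - (K / N.+1%:R * s + - K * 1)
            = K / N.+1%:R * (t - s) by ring.
  rewrite normrM ger0_norm; last by rewrite divr_ge0// ltW.
  rewrite -[leRHS]mulr1 ler_wpM2l//; first by rewrite divr_ge0// ltW.
  by rewrite ler_norml; apply/andP; split; lra.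
apply/eqP; rewrite -normr_le0; apply/ler_addgt0Pr => e e0; rewrite add0r.
have [N hN] : exists N : nat, C * K / e <= N.+1%:R.
  exists (Num.truncn (C * K / e)); exact/ltW/truncnS_gt.
apply: (le_trans (key N)); rewrite mulrA ler_pdivrMr// (mulrC e).
by rewrite -ler_pdivrMr.
Qed.

End bmeas.
Arguments bmeas_cst {d T R}.

(** * Integration against charges *)

(** Locked, so that conversion does not unfold it to Lebesgue integrals against the Jordan parts. *)
HB.lock Definition cint d (T : measurableType d) (R : realType)
  (mu : {charge set T -> \bar R}) (g : T -> R) : R :=
  fi (pos_part mu) g - fi (neg_part mu) g.

Section cint.
Context d (T : measurableType d) (R : realType).
Implicit Types (g h : T -> R) (mu nu : {charge set T -> \bar R}).

Definition tv mu : R := fine (pos_part mu setT) + fine (neg_part mu setT).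

Lemma cintE mu g : cint mu g = fi (pos_part mu) g - fi (neg_part mu) g.
Proof. by rewrite cint.unlock. Qed.

Lemma charge_parts mu A : measurable A ->
  mu A = (pos_part mu A - neg_part mu A)%E.
Proof.
move=> mA; rewrite {1}(jordan_decomp (projT2 (cid (hahn_ex mu))) mA).
by rewrite /cadd/= cscaleN1.
Qed.

Lemma cintD mu g h : bmeas g -> bmeas h ->
  cint mu (fun x => g x + h x) = cint mu g + cint mu h.
Proof. by move=> bg bh; rewrite !cintE !fiD//; ring. Qed.

Lemma cintB mu g h : bmeas g -> bmeas h ->
  cint mu (fun x => g x - h x) = cint mu g - cint mu h.
Proof. by move=> bg bh; rewrite !cintE !fiB//; ring. Qed.

Lemma cintZ mu a g : bmeas g -> cint mu (fun x => a * g x) = a * cint mu g.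
Proof. by move=> bg; rewrite !cintE !fiZ//; ring. Qed.

Lemma tv_ge0 mu : 0 <= tv mu.
Proof. by rewrite /tv addr_ge0// fine_ge0. Qed.

Lemma cint_le mu g K : bmeas g -> (forall x, `|g x| <= K) ->
  `|cint mu g| <= K * tv mu.
Proof.
move=> bg gK; rewrite cintE /tv mulrDr (le_trans (ler_normB _ _))//.
by rewrite lerD// fi_le.
Qed.

Lemma cint_indic mu A : measurable A -> (cint mu (\1_A))%:E = mu A.
Proof.
move=> mA; rewrite !cintE !fi_indic// EFinB !fineK ?fin_num_measure//.
by rewrite -charge_parts.
Qed.

(** The difference of the two functionals vanishes on indicators, so [bounded_functional0] applies.
    The integration formulas for sums, pushforwards, products and densities are thereby checked on
    indicators only. *)
Lemma cint_functional mu (Phi : (T -> R) -> R) (C : R) :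
  (forall g h, bmeas g -> bmeas h ->
     Phi (fun x => g x + h x) = Phi g + Phi h) ->
  (forall a g, bmeas g -> Phi (fun x => a * g x) = a * Phi g) ->
  (forall g K, bmeas g -> (forall x, `|g x| <= K) -> `|Phi g| <= C * K) ->
  (forall A, measurable A -> mu A = (Phi (\1_A))%:E) ->
  forall g, bmeas g -> cint mu g = Phi g.
Proof.
move=> PD PZ PC P1 g bg; apply/eqP; rewrite -subr_eq0; apply/eqP.
apply: (@bounded_functional0 _ T R (fun g => cint mu g - Phi g) (tv mu + C)) => //.
- by move=> g1 g2 b1 b2; rewrite cintD// PD//; ring.
- by move=> a g1 b1; rewrite cintZ// PZ//; ring.
- move=> g1 K b1 gK; rewrite (le_trans (ler_normB _ _))// mulrDl lerD ?PC//.
  by rewrite mulrC cint_le.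
- move=> A mA; apply/eqP; rewrite subr_eq0 -(inj_eq (@EFin_inj _)).
  by rewrite cint_indic// P1.
Qed.

(** The integral is thus independent of the Hahn decomposition that was chosen, and [cint_ext]
    follows. *)
Lemma cint_finite_measures mu (m1 m2 : {finite_measure set T -> \bar R}) :
  (forall A, measurable A -> mu A = (m1 A - m2 A)%E) ->
  forall g, bmeas g -> cint mu g = fi m1 g - fi m2 g.
Proof.
move=> muE; apply: (cint_functional
  (C := fine (m1 setT) + fine (m2 setT))).
- by move=> g h bg bh; rewrite !fiD//; ring.
- by move=> a g bg; rewrite !fiZ//; ring.
- move=> g K bg gK; rewrite (le_trans (ler_normB _ _))// mulrC mulrDr.
  by rewrite lerD// fi_le.
- move=> A mA; rewrite muE// !fi_indic//.
  by rewrite EFinB !fineK ?fin_num_measure.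
Qed.

Lemma cint_ext mu nu g : (forall A, measurable A -> mu A = nu A) -> bmeas g ->
  cint mu g = cint nu g.
Proof.
move=> h bg; rewrite [RHS]cintE.
apply: (@cint_finite_measures _ (pos_part nu) (neg_part nu)) => // A mA.
by rewrite h// -charge_parts.
Qed.

(** Evaluating the Jordan parts on the Hahn sets turns the total variation into an integral, which
    opens the way to duality. *)
Lemma tv_hahn mu : exists P N : set T,
  [/\ measurable P, measurable N, P `|` N = setT, P `&` N = set0 &
      tv mu = cint mu (\1_P) - cint mu (\1_N)].
Proof.
pose P := (projT1 (cid (hahn_ex mu))).1; pose N := (projT1 (cid (hahn_ex mu))).2.
have hd : hahn_decomposition mu P N := projT2 (cid (hahn_ex mu)).
have [[mP _] [mN _] PNT PN0] := hd.
have posE A : measurable A -> pos_part mu A = mu (A `&` P).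
  move=> mA; rewrite (_ : pos_part mu A = crestr0 mu mP A); last first.
    exact: (@jordan_posE _ _ _ mu P N hd).
  by rewrite /crestr0 mem_set.
have negE A : measurable A -> neg_part mu A = (- mu (A `&` N))%E.
  move=> mA; rewrite (_ : neg_part mu A = (- crestr0 mu mN A)%E); last first.
    by rewrite -(cjordan_negE hd); exact: (@jordan_negE _ _ _ mu P N hd).
  by rewrite /crestr0 mem_set.
exists P, N; split=> //.
rewrite !cintE !fi_indic// /tv !posE// !negE// setTI setTI setIid setIid.
by rewrite (setIC N P) PN0 charge0/= oppr0 !subr0 sub0r opprK.
Qed.

Lemma tv_attained mu : exists s : T -> R,
  [/\ bmeas s, (forall x, `|s x| <= 1) & cint mu s = tv mu].
Proof.
have [P [N [mP mN _ _ tvE]]] := tv_hahn mu.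
exists (fun x => \1_P x - \1_N x); split.
- by apply: bmeasB; exact: bmeas_indic.
- move=> x; rewrite !indicE ler_norml.
  by case: (x \in P); case: (x \in N) => /=; lra.
- by rewrite cintB// ; exact: bmeas_indic.
Qed.

(** With [cint_le], this makes [tv] the dual norm of the bounded measurable functions; later bounds
    on [tv] are obtained by testing. *)
Lemma tv_le mu C : (forall s, bmeas s -> (forall x, `|s x| <= 1) ->
  cint mu s <= C) -> tv mu <= C.
Proof. by have [s [bs s1 <-]] := tv_attained mu; apply. Qed.

Lemma tv_ext mu nu : (forall A, measurable A -> mu A = nu A) -> tv mu = tv nu.
Proof.
move=> h; apply/eqP; rewrite eq_le; apply/andP; split; apply: tv_le => s bs s1.
  by rewrite (cint_ext h bs) (le_trans (ler_norm _))// -[leRHS]mul1r cint_le.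
rewrite -(cint_ext h bs) (le_trans (ler_norm _))// -[leRHS]mul1r.
by rewrite cint_le.
Qed.

Lemma cint_eq mu nu : (forall g, bmeas g -> cint mu g = cint nu g) ->
  forall A, measurable A -> mu A = nu A.
Proof.
by move=> h A mA; rewrite -!cint_indic// h//; exact: bmeas_indic.
Qed.

Lemma cint0 (g : T -> R) : bmeas g -> cint czero g = 0.
Proof.
move=> bg; apply: (@cint_functional _ (fun=> 0) 0) => //.
- by move=> *; rewrite addr0.
- by move=> *; rewrite mulr0.
- by move=> *; rewrite normr0 mul0r.
Qed.

Lemma cint_cadd mu nu g : bmeas g -> cint (cadd mu nu) g = cint mu g + cint nu g.
Proof.
apply: (@cint_functional _ (fun g => cint mu g + cint nu g) (tv mu + tv nu)).
- by move=> g1 g2 b1 b2; rewrite !cintD//; ring.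
- by move=> a g1 b1; rewrite !cintZ//; ring.
- move=> g1 K b1 gK; rewrite (le_trans (ler_normD _ _))// mulrDl.
  by rewrite !(mulrC _ K) lerD// cint_le.
- by move=> A mA; rewrite /cadd/= EFinD !cint_indic.
Qed.

Lemma cint_cscale a mu g : bmeas g -> cint (cscale a mu) g = a * cint mu g.
Proof.
apply: (@cint_functional _ (fun g => a * cint mu g) (`|a| * tv mu)).
- by move=> g1 g2 b1 b2; rewrite !cintD//; ring.
- by move=> b g1 b1; rewrite !cintZ//; ring.
- move=> g1 K b1 gK; rewrite normrM -mulrA ler_wpM2l// mulrC.
  exact: cint_le.
- by move=> A mA; rewrite /cscale/= EFinM cint_indic.
Qed.

End cint.

Section cint_push.
Context d1 d2 (T1 : measurableType d1) (T2 : measurableType d2) (R : realType).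

Lemma bmeas_comp (f : T1 -> T2) (g : T2 -> R) :
  measurable_fun setT f -> bmeas g -> bmeas (fun x => g (f x)).
Proof.
move=> mf [mg [K gK]]; split; last by exists K.
exact: (measurableT_comp mg mf).
Qed.

Lemma cint_cpush (mu : {charge set T1 -> \bar R}) (f : T1 -> T2)
    (mf : measurable_fun setT f) (g : T2 -> R) : bmeas g ->
  cint (cpush mu mf) g = cint mu (fun x => g (f x)).
Proof.
apply: (@cint_functional _ _ _ _ (fun g => cint mu (fun x => g (f x))) (tv mu)).
- by move=> g1 g2 b1 b2; rewrite cintD//; exact: bmeas_comp.
- by move=> b g1 b1; rewrite !cintZ//; exact: bmeas_comp.
- move=> g1 K b1 gK; rewrite mulrC cint_le//; exact: bmeas_comp.
- move=> A mA; rewrite /= /pushforward -cint_indic//.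
  rewrite -[X in measurable X]setTI; exact: mf.
Qed.

End cint_push.

(** * Fubini for finite measures and for charges *)

Section cint_prod.
Context d1 d2 (T1 : measurableType d1) (T2 : measurableType d2) (R : realType).
Implicit Types (g : T1 * T2 -> R).
Variables (m1 : {finite_measure set T1 -> \bar R})
          (m2 : {finite_measure set T2 -> \bar R}).

Lemma bmeas_pair1 g x : bmeas g -> bmeas (fun y => g (x, y)).
Proof. by apply: bmeas_comp; exact: measurable_pair1. Qed.

Lemma bmeas_pair2 g y : bmeas g -> bmeas (fun x => g (x, y)).
Proof. by apply: bmeas_comp; exact: measurable_pair2. Qed.

Let fubini_integrable g : bmeas g -> (m1 \x m2)%E.-integrable setT (EFin \o g).
Proof. by move=> bg; exact: (bmeas_integrable (fprod m1 m2) bg). Qed.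

Lemma bmeas_fi2 g : bmeas g -> bmeas (fun x => fi m2 (fun y => g (x, y))).
Proof.
move=> bg; split.
  under eq_fun do rewrite fiE.
  have := measurable_fubini_F (fubini_integrable bg).
  move/(measurableT_comp (fine_measurable measurableT)) => /=.
  exact.
have [_ [K gK]] := bg; exists (K * fine (m2 setT)) => x.
by apply: fi_le; [exact: bmeas_pair1|].
Qed.

Lemma bmeas_fi1 g : bmeas g -> bmeas (fun y => fi m1 (fun x => g (x, y))).
Proof.
move=> bg; split.
  under eq_fun do rewrite fiE.
  have := measurable_fubini_G (fubini_integrable bg).
  move/(measurableT_comp (fine_measurable measurableT)) => /=.
  exact.
have [_ [K gK]] := bg; exists (K * fine (m1 setT)) => x.
by apply: fi_le; [exact: bmeas_pair2|].
Qed.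

Lemma fi_prod12 g : bmeas g ->
  fi (fprod m1 m2) g = fi m1 (fun x => fi m2 (fun y => g (x, y))).
Proof.
move=> bg; rewrite !fiE /Rintegral; congr fine.
rewrite -(integral12_prod_meas1 (fubini_integrable bg)).
apply: eq_integral => x _; rewrite fiE /fubini_F /= fineK//.
apply: integrable_fin_num => //.
exact: (bmeas_integrable m2 (bmeas_pair1 x bg)).
Qed.

Lemma fi_prod21 g : bmeas g ->
  fi (fprod m1 m2) g = fi m2 (fun y => fi m1 (fun x => g (x, y))).
Proof.
move=> bg; rewrite !fiE /Rintegral; congr fine.
rewrite -(integral21_prod_meas1 (fubini_integrable bg)).
apply: eq_integral => x _; rewrite fiE /fubini_G /= fineK//.
apply: integrable_fin_num => //.
exact: (bmeas_integrable m1 (bmeas_pair2 x bg)).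
Qed.

Lemma fi_swap g : bmeas g -> fi m1 (fun x => fi m2 (fun y => g (x, y))) =
  fi m2 (fun y => fi m1 (fun x => g (x, y))).
Proof. by move=> bg; rewrite -fi_prod12// fi_prod21. Qed.

End cint_prod.

Section cint_cprod.
Context d1 d2 (T1 : measurableType d1) (T2 : measurableType d2) (R : realType).
Implicit Types (g : T1 * T2 -> R).
Variables (mu : {charge set T1 -> \bar R}) (nu : {charge set T2 -> \bar R}).

Lemma bmeas_cint1 g : bmeas g -> bmeas (fun y => cint mu (fun x => g (x, y))).
Proof. by move=> bg; under eq_fun do rewrite cintE; apply: bmeasB;
  exact: (bmeas_fi1 _ (pos_part nu)). Qed.

Lemma bmeas_cint2 g : bmeas g -> bmeas (fun x => cint nu (fun y => g (x, y))).
Proof. by move=> bg; under eq_fun do rewrite cintE; apply: bmeasB;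
  exact: (bmeas_fi2 (pos_part mu)). Qed.

Let Phi g := fi (fprod (pos_part mu) (pos_part nu)) g
  + fi (fprod (neg_part mu) (neg_part nu)) g
  - (fi (fprod (pos_part mu) (neg_part nu)) g
     + fi (fprod (neg_part mu) (pos_part nu)) g).

Let cint_Phi g : bmeas g -> cint (cprod mu nu) g = Phi g.
Proof.
pose C := fine (fprod (pos_part mu) (pos_part nu) setT)
  + fine (fprod (neg_part mu) (neg_part nu) setT)
  + (fine (fprod (pos_part mu) (neg_part nu) setT)
     + fine (fprod (neg_part mu) (pos_part nu) setT)).
apply: (@cint_functional _ _ _ _ Phi C).
- by move=> g1 g2 b1 b2; rewrite /Phi !fiD//; ring.
- by move=> b g1 b1; rewrite /Phi !fiZ//; ring.
- move=> g1 K b1 gK; rewrite /Phi /C mulrC (le_trans (ler_normB _ _))// mulrDr.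
  by apply: lerD; rewrite (le_trans (ler_normD _ _))// mulrDr lerD// fi_le.
- move=> A mA; rewrite /cprod /cadd /copp/= /Phi !fi_indic//.
  rewrite EFinB !EFinD !fineK//; exact: fin_num_measure.
Qed.

Lemma cint_cprod21 g : bmeas g ->
  cint (cprod mu nu) g = cint nu (fun y => cint mu (fun x => g (x, y))).
Proof.
move=> bg; rewrite cint_Phi// /Phi !fi_prod21// cintE.
under [X in fi _ X - _]eq_fun do rewrite cintE.
under [X in _ - fi _ X]eq_fun do rewrite cintE.
rewrite !fiB;
  try exact: (bmeas_fi1 _ (pos_part nu)).
by ring.
Qed.

Lemma cint_cprod12 g : bmeas g ->
  cint (cprod mu nu) g = cint mu (fun x => cint nu (fun y => g (x, y))).
Proof.
move=> bg; rewrite cint_Phi// /Phi !fi_prod12// cintE.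
under [X in fi _ X - _]eq_fun do rewrite cintE.
under [X in _ - fi _ X]eq_fun do rewrite cintE.
rewrite !fiB;
  try exact: (bmeas_fi2 (pos_part mu)).
by ring.
Qed.

End cint_cprod.

(** * Signed measures on [0, 1] *)

Lemma measurable_I01 (R : realType) : measurable (I01 : set (measurableTypeR R)).
Proof. exact: measurable_itv. Qed.
#[global] Hint Resolve measurable_I01 : core.

Section bs_cint.
Context {R : realType}.
Local Notation RM := (measurableTypeR R).
Local Notation leb := (@lebesgue_measure R).
Implicit Types (mu nu rho : bs R) (g h : RM -> R) (T : borel_selfmap R).


Lemma bs_eqP mu nu :
  bs_eq mu nu <-> forall g, bmeas g -> cint mu g = cint nu g.
Proof.
split=> [h g|h]; first by apply: cint_ext => A mA; exact: h.
by move=> A mA; exact: cint_eq.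
Qed.

Lemma bs_eq_sym mu nu : bs_eq mu nu -> bs_eq nu mu.
Proof. by move=> h A mA; rewrite h. Qed.

Lemma bs_eq_trans mu nu rho : bs_eq mu nu -> bs_eq nu rho -> bs_eq mu rho.
Proof. by move=> h k A mA; rewrite h// k. Qed.

(** On indicators this is the field [bs_supp]. It allows test functions to be compared on [0, 1]
    only. *)
Lemma cint_I01E mu g : bmeas g -> cint mu g = cint mu (fun x => g x * \1_I01 x).
Proof.
have b1 h : bmeas h -> bmeas (fun x : RM => h x * (\1_I01 x : R)).
  by move=> bh; apply: bmeasM => //; exact: bmeas_indic.
apply: (@cint_functional _ _ _ _ (fun g => cint mu (fun x => g x * \1_I01 x)) (tv mu)).
- move=> g1 g2 bg1 bg2; rewrite -cintD; [|exact: b1..].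
  by congr (cint mu _); apply/funext => x; rewrite mulrDl.
- move=> a g1 bg1; rewrite -cintZ; [|exact: b1..].
  by congr (cint mu _); apply/funext => x; rewrite mulrA.
- move=> g1 K bg1 g1K; rewrite mulrC cint_le//; first exact: b1.
  move=> x; rewrite normrM -[leRHS]mulr1 ler_pM// indicE.
  by case: (_ \in _); rewrite ?normr1// normr0.
- move=> A mA; rewrite (bs_supp mu mA) -cint_indic; last exact: measurableI.
  by congr (_%:E); congr (cint mu _); rewrite indicI.
Qed.

Lemma cint_eq_I01 mu g h : bmeas g -> bmeas h ->
  (forall x, x \in `[0, 1] -> g x = h x) -> cint mu g = cint mu h.
Proof.
move=> bg bh gh; rewrite cint_I01E// [RHS]cint_I01E//; congr (cint mu _).
apply/funext => x; rewrite !indicE.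
by have [/[1!inE] xI|_] := boolP (x \in _); [rewrite gh|rewrite !mulr0].
Qed.

Lemma cint_le_I01 mu g K : bmeas g -> 0 <= K ->
  (forall x, x \in `[0, 1] -> `|g x| <= K) -> `|cint mu g| <= K * tv mu.
Proof.
move=> bg K0 gK; rewrite cint_I01E// cint_le//.
  by apply: bmeasM => //; exact: bmeas_indic.
move=> x; rewrite indicE.
have [/[1!inE] xI|_] := boolP (x \in _); first by rewrite mulr1 gK.
by rewrite mulr0 normr0.
Qed.

Lemma cint_mass mu : (cint mu (fun=> 1))%:E = mu I01.
Proof.
rewrite -cint_indic//; congr (_%:E); apply: cint_eq_I01.
- exact: bmeas_cst.
- exact: bmeas_indic.
- by move=> x xI; rewrite indicE mem_set.
Qed.

Lemma mass0P mu : mu I01 = 0%E <-> cint mu (fun=> 1) = 0.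
Proof. by rewrite -cint_mass; split => [[]|->]. Qed.

Lemma cint_bs_zero g : bmeas g -> cint (@bs_zero R) g = 0.
Proof. exact: cint0. Qed.

Lemma cint_bs_add mu nu g : bmeas g ->
  cint (bs_add mu nu) g = cint mu g + cint nu g.
Proof. exact: cint_cadd. Qed.

Lemma cint_bs_scale a mu g : bmeas g -> cint (bs_scale a mu) g = a * cint mu g.
Proof. exact: cint_cscale. Qed.

Lemma cint_bs_sub mu nu g : bmeas g ->
  cint (bs_sub mu nu) g = cint mu g - cint nu g.
Proof. by move=> bg; rewrite cint_bs_add// cint_bs_scale// mulN1r. Qed.

Lemma cint_bs_sum (F : nat -> bs R) n g : bmeas g ->
  cint (bs_sum F n) g = \sum_(k < n) cint (F k) g.
Proof.
move=> bg; elim: n => [|n ih]; first by rewrite big_ord0 cint_bs_zero.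
by rewrite big_ord_recr/= cint_bs_add// ih.
Qed.

Lemma bmeas_push T g : bmeas g -> bmeas (fun x => g (selfmap_ext T x)).
Proof. by apply: bmeas_comp; exact: selfmap_ext_meas. Qed.

Lemma cint_push T mu g : bmeas g ->
  cint (push T mu) g = cint mu (fun x => g (selfmap_ext T x)).
Proof. exact: cint_cpush. Qed.

Lemma selfmap_extE T x : x \in `[0, 1] -> selfmap_ext T x = T x.
Proof. by move=> xI; rewrite /selfmap_ext /patch mem_set. Qed.

Lemma bmeas_fold g : bmeas g ->
  bmeas (fun z : RM * RM => g (fold01 (z.1 + z.2))).
Proof. by apply: bmeas_comp; exact: fold01_add_meas. Qed.

(** Integrating the noise first exhibits the adjoint of [hconv rho], see [dual_hconv]. *)
Lemma cint_hconv21 rho mu g : bmeas g -> cint (hconv rho mu) g =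
  cint mu (fun y : R => cint rho (fun x : R => g (fold01 (x + y)))).
Proof.
move=> bg; rewrite [LHS]cint_cpush//.
exact: (cint_cprod21 _ _ (bmeas_fold bg)).
Qed.

(** Integrating the noise last makes linearity in [rho] visible, which is what a perturbation of the
    noise requires. *)
Lemma cint_hconv12 rho mu g : bmeas g -> cint (hconv rho mu) g =
  cint rho (fun x : R => cint mu (fun y : R => g (fold01 (x + y)))).
Proof.
move=> bg; rewrite [LHS]cint_cpush//.
exact: (cint_cprod12 _ _ (bmeas_fold bg)).
Qed.

Lemma bmeas_hconv1 rho g : bmeas g ->
  bmeas (fun y : R => cint rho (fun x : R => g (fold01 (x + y)))).
Proof. by move=> bg; exact: (@bmeas_cint1 _ _ _ _ _ rho rho _ (bmeas_fold bg)). Qed.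

Lemma bmeas_hconv2 mu g : bmeas g ->
  bmeas (fun x : R => cint mu (fun y : R => g (fold01 (x + y)))).
Proof. by move=> bg; exact: (@bmeas_cint2 _ _ _ _ _ mu mu _ (bmeas_fold bg)). Qed.

Lemma bmeas_fold_r (y : R) g : bmeas g -> bmeas (fun x : R => g (fold01 (x + y))).
Proof. by move=> bg; exact: (bmeas_pair2 y (bmeas_fold bg)). Qed.

Lemma tv_hconv rho mu : tv (hconv rho mu) <= tv rho * tv mu.
Proof.
apply: tv_le => s bs s1; rewrite cint_hconv21//.
rewrite (le_trans (ler_norm _))// cint_le//; first exact: bmeas_hconv1.
by move=> y; rewrite -[leRHS]mul1r cint_le//; exact: bmeas_fold_r.
Qed.

Lemma tv_push T mu : tv (push T mu) <= tv mu.
Proof.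
apply: tv_le => s bs s1; rewrite cint_push// (le_trans (ler_norm _))//.
by rewrite -[leRHS]mul1r cint_le//; exact: bmeas_push.
Qed.

Lemma tv_bs_eq mu nu : bs_eq mu nu -> tv mu = tv nu.
Proof. by move=> h; apply: tv_ext => A mA; exact: h. Qed.

Lemma is_probabilityP mu : is_probability mu -> tv mu = 1.
Proof.
move=> [mu0 mu1]; have mu1' : cint mu (fun=> 1) = 1.
  by apply: EFin_inj; rewrite cint_mass.
apply/eqP; rewrite eq_le; apply/andP; split; last first.
  rewrite -mu1' (le_trans (ler_norm _))// -[leRHS]mul1r cint_le//.
    exact: bmeas_cst.
  by move=> x; rewrite normr1.
have ng A : measurable A -> 0 <= cint mu (\1_A).
  by move=> mA; rewrite -lee_fin cint_indic//; exact: mu0.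
have [P [N [mP mN PNT PN0 ->]]] := tv_hahn mu.
rewrite (@le_trans _ _ (cint mu (\1_P) + cint mu (\1_N)))//.
  by rewrite lerD2l ge0_cp// ng.
rewrite -mu1' -cintD; [|exact: bmeas_indic..].
rewrite le_eqVlt; apply/orP; left; apply/eqP; congr (cint mu _).
apply/funext => x; rewrite !indicE.
have [xP|xP] := boolP (x \in P); have [xN|xN] := boolP (x \in N) => //=;
  rewrite ?addr0 ?add0r//.
  by exfalso; move: xP xN; rewrite !inE => xP xN; have : (P `&` N) x by []; rewrite PN0.
have : (P `|` N) x by rewrite PNT.
by case=> /mem_set h; [rewrite h in xP|rewrite h in xN].
Qed.

End bs_cint.

(** * Total variation and Wasserstein norms *)

Section norms_cint.
Context {R : realType}.
Local Notation RM := (measurableTypeR R).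
Local Notation leb := (@lebesgue_measure R).
Implicit Types (mu nu rho : bs R) (g h : RM -> R) (T : borel_selfmap R).

(** The monotone 1-Lipschitz retraction of the line onto [0, 1]: composing with it extends a
    function from [0, 1] without losing bounds, monotonicity or the Lipschitz constant. *)
Definition clamp01 (x : R) : R := Num.max 0 (Num.min x 1).

Lemma clamp01_in x : clamp01 x \in `[0, 1].
Proof.
rewrite in_itv/= /clamp01; apply/andP; split; first by rewrite le_max lexx.
by rewrite ge_max ler01/= ge_min lexx orbT.
Qed.

Lemma clamp01_id x : x \in `[0, 1] -> clamp01 x = x.
Proof.
by rewrite in_itv/= => /andP[x0 x1]; rewrite /clamp01 (min_idPl x1) (max_idPr x0).
Qed.

Lemma clamp01_mono : {homo clamp01 : x y / x <= y}.
Proof.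
move=> x y xy; rewrite /clamp01 ge_max le_max lexx/= le_max; apply/orP; right.
by rewrite le_min !ge_min xy lexx orbT.
Qed.

Lemma clamp01_lip x y : `|clamp01 x - clamp01 y| <= `|x - y|.
Proof.
have H (a b : R) : a <= b -> clamp01 b - clamp01 a <= b - a.
  rewrite /clamp01 => ab.
  by case: (leP b 1) => ?; case: (leP a 1) => ?; rewrite ?(max_idPr ler01)//;
    case: (leP 0 a) => ?; case: (leP 0 b) => ?; lra.
have [xy|/ltW yx] := leP x y; last by rewrite !ger0_norm ?subr_ge0 ?clamp01_mono// H.
by rewrite distrC [leRHS]distrC !ger0_norm ?subr_ge0 ?clamp01_mono// H.
Qed.

Lemma lip_continuous (g : R -> R) (k : R) :
  (forall x y, `|g x - g y| <= k * `|x - y|) -> continuous g.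
Proof.
move=> gk x; apply/cvgrPdist_le => e e0.
have k1 : 0 < `|k| + 1 by rewrite ltr_wpDl.
near=> y.
apply: le_trans (gk x y) _; rewrite (@le_trans _ _ ((`|k| + 1) * `|x - y|))//.
  by rewrite ler_wpM2r// (le_trans (ler_norm _))// lerDl.
rewrite -ler_pdivlMl// mulrC.
near: y; apply: cvgr_dist_le; first exact: cvg_id.
by rewrite divr_gt0.
Unshelve. all: by end_near. Qed.

Lemma lip_bmeas (g : R -> R) (K k : R) : (forall x, `|g x| <= K) ->
  (forall x y, `|g x - g y| <= k * `|x - y|) -> bmeas (g : RM -> R).
Proof.
move=> gK gk; split; last by exists K.
by apply: continuous_measurable_fun; exact: lip_continuous gk.
Qed.

Lemma bs_integralE mu g : bmeas g -> bs_integral mu g = (cint mu g)%:E.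
Proof.
move=> bg; rewrite cint_I01E// /bs_integral cintE EFinB.
have b1 : bmeas (fun x => g x * (\1_I01 x : R)).
  by apply: bmeasM => //; exact: bmeas_indic.
have H (m : {finite_measure set RM -> \bar R}) :
    (\int[m]_(x in I01) (g x)%:E)%E = (fi m (fun x => g x * \1_I01 x))%:E.
  rewrite fiE /Rintegral fineK; last first.
    by apply: integrable_fin_num => //; exact: (bmeas_integrable m b1).
  rewrite [LHS]integral_mkcond; apply: eq_integral => x _.
  by rewrite /patch indicE; case: (x \in _); rewrite ?mulr1// mulr0.
by rewrite !H.
Qed.

Lemma bs_integral_ext mu (g h : R -> R) :
  (forall x, x \in `[0, 1] -> g x = h x) -> bs_integral mu g = bs_integral mu h.
Proof.
by move=> gh; rewrite /bs_integral; congr (_ - _)%E; apply: eq_integral => x;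
  rewrite inE => xI; rewrite gh.
Qed.

(** Test functions are taken on the whole line; [wnorm_le] and [wnorm_ge] show that the supremum
    defining [wnorm] does not change. *)
Definition lip1 (g : R -> R) :=
  (forall x, `|g x| <= 1) /\ forall x y, `|g x - g y| <= `|x - y|.

Lemma lip1_bmeas g : lip1 g -> bmeas g.
Proof.
by move=> [g1 gl]; apply: (lip_bmeas g1 (k := 1)) => x y; rewrite mul1r.
Qed.

Lemma klip_I01P (k : R) (g : R -> R) : k.-lipschitz_I01 g <->
  forall x y, x \in `[0, 1] -> y \in `[0, 1] -> `|g x - g y| <= k * `|x - y|.
Proof.
by split=> [h x y xI yI|h [x y] [xI yI]]; [exact: (h (x, y))|exact: h].
Qed.

Lemma wnorm_le mu (C : R) : (forall g, lip1 g -> cint mu g <= C) ->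
  (wnorm mu <= C%:E)%E.
Proof.
move=> h; apply: ub_ereal_sup => _ [g [g1 /klip_I01P gl] <-].
have lg : lip1 (g \o clamp01).
  split=> [x|x y] /=; first exact/g1/clamp01_in.
  by rewrite (le_trans (gl _ _ (clamp01_in _) (clamp01_in _)))// mul1r clamp01_lip.
rewrite (@bs_integral_ext _ _ (g \o clamp01)); last first.
  by move=> x xI /=; rewrite clamp01_id.
by rewrite bs_integralE ?lee_fin ?h//; exact: lip1_bmeas.
Qed.

Lemma wnorm_ge mu g : lip1 g -> ((cint mu g)%:E <= wnorm mu)%E.
Proof.
move=> lg; apply: ereal_sup_ubound; exists g; last first.
  by rewrite bs_integralE//; exact: lip1_bmeas.
split=> [x _|]; first exact: lg.1.
by apply/klip_I01P => x y _ _; rewrite mul1r; exact: lg.2.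
Qed.

Definition wn mu : R := fine (wnorm mu).

Lemma lip1_0 : lip1 (fun=> 0).
Proof. by split=> [x|x y]; rewrite ?subrr normr0. Qed.

Lemma lip1N g : lip1 g -> lip1 (fun x => - g x).
Proof. by move=> [g1 g2]; split=> [x|x y]; rewrite -?opprD normrN. Qed.

Lemma wnorm_le_tv mu : (wnorm mu <= (tv mu)%:E)%E.
Proof.
apply: wnorm_le => g lg; rewrite (le_trans (ler_norm _))// -[leRHS]mul1r.
by apply: cint_le; [exact: lip1_bmeas|exact: lg.1].
Qed.

Lemma wnorm_ge0 mu : (0 <= wnorm mu)%E.
Proof.
apply: le_trans (wnorm_ge mu lip1_0); rewrite lee_fin.
by rewrite cintE !fi_cst !mul0r subrr.
Qed.

Lemma wnormE mu : wnorm mu = (wn mu)%:E.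
Proof.
rewrite /wn fineK// ge0_fin_numE ?wnorm_ge0//.
by rewrite (le_lt_trans (wnorm_le_tv mu))// ltry.
Qed.

Lemma wn_ge0 mu : 0 <= wn mu.
Proof. by rewrite -lee_fin -wnormE wnorm_ge0. Qed.

Lemma wn_le mu (C : R) : (forall g, lip1 g -> cint mu g <= C) -> wn mu <= C.
Proof. by move=> h; rewrite -lee_fin -wnormE wnorm_le. Qed.

Lemma wn_le_tv mu : wn mu <= tv mu.
Proof. by rewrite -lee_fin -wnormE wnorm_le_tv. Qed.

Lemma cint_lip1 mu g : lip1 g -> `|cint mu g| <= wn mu.
Proof.
move=> lg; rewrite ler_norml; apply/andP; split; last first.
  by rewrite -lee_fin -wnormE wnorm_ge.
rewrite lerNl -mulN1r -cintZ; last exact: lip1_bmeas.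
under [X in cint mu X]eq_fun do rewrite mulN1r.
by rewrite -lee_fin -wnormE wnorm_ge//; exact: lip1N.
Qed.

(** Dividing by [K] and composing with [clamp01] gives a Wasserstein test function. The case [K = 0]
    is apart: [g] then vanishes on [0, 1]. *)
Lemma cint_wn mu g (K : R) : bmeas g -> 0 <= K ->
  (forall x, x \in `[0, 1] -> `|g x| <= K) ->
  (forall x y, x \in `[0, 1] -> y \in `[0, 1] -> `|g x - g y| <= K * `|x - y|) ->
  `|cint mu g| <= K * wn mu.
Proof.
move=> bg; rewrite le_eqVlt => /predU1P[<-|K0] gK gl.
  by rewrite mul0r -(mul0r (tv mu)); exact: cint_le_I01.
pose h x := K^-1 * g (clamp01 x).
have lh : lip1 h.
  split=> [x|x y]; rewrite /h -?mulrBr normrM gtr0_norm ?invr_gt0//.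
    by rewrite ler_pdivrMl// mulr1; exact/gK/clamp01_in.
  rewrite ler_pdivrMl//.
  rewrite (le_trans (gl _ _ (clamp01_in _) (clamp01_in _)))//.
  by rewrite ler_wpM2l ?(ltW K0)// clamp01_lip.
have -> : cint mu g = K * cint mu h.
  rewrite -cintZ; last exact: lip1_bmeas.
  apply: cint_eq_I01 => //; first exact/bmeasZ/lip1_bmeas.
  by move=> x xI; rewrite /h mulrA mulfV ?gt_eqF// mul1r clamp01_id.
by rewrite normrM gtr0_norm// ler_wpM2l ?(ltW K0)//; exact: cint_lip1.
Qed.

Lemma wn_bs_eq mu nu : bs_eq mu nu -> wn mu = wn nu.
Proof.
move=> /bs_eqP h; apply/eqP; rewrite eq_le.
apply/andP; split; apply: wn_le => g lg; have hg := h g (lip1_bmeas lg).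
  by rewrite hg (le_trans (ler_norm _))// cint_lip1.
by rewrite -hg (le_trans (ler_norm _))// cint_lip1.
Qed.

Lemma wn_bs_add mu nu : wn (bs_add mu nu) <= wn mu + wn nu.
Proof.
apply: wn_le => g lg; rewrite cint_bs_add; last exact: lip1_bmeas.
by rewrite lerD// (le_trans (ler_norm _))// cint_lip1.
Qed.

(** Since [fold01] is 1-Lipschitz, [x] mapped to [g (fold01 (x + y))] is a test function again for
    each [y]; only the other factor has to be measured in total variation. *)
Lemma wn_hconv mu nu : wn (hconv mu nu) <= wn mu * tv nu.
Proof.
apply: wn_le => g lg; have bg := lip1_bmeas lg.
rewrite cint_hconv21// (le_trans (ler_norm _))// cint_le//.
  exact: bmeas_hconv1.
move=> y; apply: cint_lip1; split=> [x|x z]; first exact: lg.1.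
rewrite (le_trans (lg.2 _ _))// (le_trans (fold01_lip _ _))//.
by rewrite opprD addrACA subrr addr0.
Qed.

(** Composition with [T] multiplies the Lipschitz constant by [k] but leaves the sup bound at 1;
    [cint_wn] has one constant for both, hence [1 <= k]. *)
Lemma wn_push T (k : R) mu : 1 <= k -> k.-lipschitz_I01 T ->
  wn (push T mu) <= k * wn mu.
Proof.
move=> k1 /klip_I01P Tk; apply: wn_le => g lg; have bg := lip1_bmeas lg.
rewrite cint_push// (le_trans (ler_norm _))//.
apply: cint_wn; rewrite ?(le_trans ler01)//; first exact: bmeas_push.
  by move=> x _; rewrite (le_trans (lg.1 _)).
move=> x y xI yI; rewrite !selfmap_extE// (le_trans (lg.2 _ _))//.
exact: Tk.
Qed.

Lemma is_L1P mu : is_L1 mu <->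
  forall A : set RM, measurable A -> leb A = 0%E -> mu A = 0%E.
Proof. exact: null_content_dominatesP. Qed.

Lemma is_L1_ext mu nu : bs_eq mu nu -> is_L1 mu -> is_L1 nu.
Proof. by move=> h /is_L1P L; apply/is_L1P => A mA A0; rewrite -h// L. Qed.

Lemma is_L1_zero : is_L1 (@bs_zero R).
Proof. by apply/is_L1P. Qed.

Lemma is_L1_add mu nu : is_L1 mu -> is_L1 nu -> is_L1 (bs_add mu nu).
Proof.
move=> /is_L1P L1 /is_L1P L2; apply/is_L1P => A mA A0.
by rewrite /= /cadd/= L1// L2// adde0.
Qed.

Lemma is_L1_scale a mu : is_L1 mu -> is_L1 (bs_scale a mu).
Proof.
by move=> /is_L1P L1; apply/is_L1P => A mA A0; rewrite /= /cscale/= L1// mule0.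
Qed.

Lemma is_L1_sub mu nu : is_L1 mu -> is_L1 nu -> is_L1 (bs_sub mu nu).
Proof. by move=> L1 L2; apply: is_L1_add => //; exact: is_L1_scale. Qed.

Lemma is_L1_sum (F : nat -> bs R) n :
  (forall k, is_L1 (F k)) -> is_L1 (bs_sum F n).
Proof.
by move=> L; elim: n => [|n ih]; [exact: is_L1_zero|exact: is_L1_add].
Qed.

Lemma density_integrable mu : is_L1 mu ->
  leb.-integrable setT (EFin \o (density mu : RM -> R)).
Proof.
move=> L; have := Radon_Nikodym_integrable L; congr (leb.-integrable _ _).
by apply/funext => x; rewrite /= /density fineK// Radon_Nikodym_fin_num.
Qed.

Lemma density_bmeasM mu g : is_L1 mu -> bmeas g ->
  leb.-integrable I01 (EFin \o (fun x => g x * density mu x)).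
Proof.
move=> L [mg [K gK]].
have : leb.-integrable I01 ((EFin \o g) \* (EFin \o (density mu : RM -> R)))%E.
  apply: integrableMr => //; first exact: measurable_funTS.
    exists K; split; first by rewrite num_real.
    by move=> M KM x _ /=; rewrite (le_trans (gK x))// ltW.
  exact: integrableS (density_integrable L).
by congr (leb.-integrable _ _); apply/funext => x; rewrite /= EFinM.
Qed.

Lemma cint_density mu g : is_L1 mu -> bmeas g ->
  cint mu g = \int[leb]_(x in I01) (g x * density mu x).
Proof.
move=> L; pose C := \int[leb]_(x in I01) `|density mu x|.
have intD := density_integrable L.
have intD1 := integrableS measurableT (@measurable_I01 R) (@subsetT _ _) intD.
apply: (@cint_functional _ _ _ _
  (fun g => \int[leb]_(x in I01) (g x * density mu x)) C).
- move=> g1 g2 b1 b2; rewrite -RintegralD//; [|exact: density_bmeasM..].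
  by apply: eq_Rintegral => x _; rewrite mulrDl.
- move=> a g1 b1; rewrite -RintegralZl//; last exact: density_bmeasM.
  by apply: eq_Rintegral => x _; rewrite mulrA.
- move=> g1 K b1 g1K; rewrite (le_trans (le_normr_Rintegral _ _))//.
    exact: density_bmeasM.
  rewrite /C mulrC -RintegralZl//; last exact: integrable_norm.
  apply: le_Rintegral => //.
  + by apply: integrable_norm => //; exact: density_bmeasM.
  + have := integrableZl (@measurable_I01 R) K (integrable_norm intD1).
    by congr (leb.-integrable _ _); apply/funext => x; rewrite /= EFinM.
  + by move=> x _; rewrite normrM ler_wpM2r.
- move=> A mA; rewrite (bs_supp mu mA) (Radon_Nikodym_integral L); last first.
    exact: measurableI.
  rewrite setIC integral_mkcondr.
  have -> : \int[leb]_(x in I01) (\1_A x * density mu x) =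
            \int[leb]_(x in I01) ((density mu \_ A) x).
    apply: eq_Rintegral => x _; rewrite indicE /patch.
    by case: (x \in A); rewrite ?mul1r// mul0r.
  rewrite /Rintegral fineK; last first.
    apply: integrable_fin_num => //.
    have := density_bmeasM L (bmeas_indic R mA).
    congr (leb.-integrable _ _); apply/funext => x /=; rewrite indicE /patch.
    by case: (x \in A); rewrite ?mul1r// mul0r.
  apply: eq_integral => x _; rewrite /patch; case: (x \in A) => //.
  by rewrite /density fineK// Radon_Nikodym_fin_num.
Qed.

(** The sign of the density is a bounded test function that attains the integral of its modulus. L^1
    estimates become estimates of [tv], free of almost-everywhere arguments. *)
Lemma norm1E mu : is_L1 mu -> norm1 mu = (tv mu)%:E.
Proof.
move=> L; have intD := density_integrable L.
have intD1 := integrableS measurableT (@measurable_I01 R) (@subsetT _ _) intD.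
have -> : norm1 mu = (\int[leb]_(x in I01) `|density mu x|)%:E.
  rewrite /norm1 asboolT// /norm1_fun /Rintegral fineK//.
  by apply: integrable_fin_num => //; exact: integrable_norm.
congr (_%:E); apply/eqP; rewrite eq_le; apply/andP; split; last first.
  apply: tv_le => s bs s1; rewrite (cint_density L bs).
  rewrite (le_trans (ler_norm _))// (le_trans (le_normr_Rintegral _ _))//.
    exact: density_bmeasM.
  apply: le_Rintegral => //.
  + by apply: integrable_norm => //; exact: density_bmeasM.
  + exact: integrable_norm.
  + by move=> x _; rewrite normrM ler_piMl.
have bs : bmeas (fun x : RM => Num.sg (density mu x)).
  split.
    have -> : (fun x : RM => Num.sg (density mu x)) =
        (fun x => \1_(density mu @^-1` `]0, +oo[) x - \1_(density mu @^-1` `]-oo, 0[) x).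
      apply/funext => x; rewrite !indicE.
      have [d0|d0|d0] := sgrP (density mu x).
      - by rewrite !memNset ?subrr//= in_itv/= d0 ltxx.
      - rewrite mem_set ?memNset ?subr0//= in_itv/= ?andbT//.
        by rewrite ltNge ltW.
      - rewrite memNset ?mem_set ?sub0r//= in_itv/= ?andbT//.
        by apply/negP; rewrite -leNgt ltW.
    have mD : measurable_fun setT (density mu : RM -> R).
      by apply/measurable_EFinP; exact: measurable_int (density_integrable L).
    apply: measurable_funB; apply: measurable_indic; rewrite -[X in measurable X]setTI;
      exact: (mD measurableT _ (measurable_itv _)).
  by exists 1 => x; rewrite normr_sg; case: (_ == 0).
rewrite -[leRHS]mul1r.
have -> : \int[leb]_(x in I01) `|density mu x| =
          cint mu (fun x : RM => Num.sg (density mu x)).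
  by rewrite cint_density//; apply: eq_Rintegral => x _; rewrite normrEsg.
rewrite (le_trans (ler_norm _))// cint_le//.
by move=> x; rewrite normr_sg; case: (_ == 0).
Qed.

End norms_cint.

(** * Lebesgue integrals over intervals *)

Section fi_functional.
Context d (T : measurableType d) (R : realType).

Lemma fi_functional (m : {finite_measure set T -> \bar R})
    (Phi : (T -> R) -> R) (C : R) :
  (forall g h, bmeas g -> bmeas h ->
     Phi (fun x => g x + h x) = Phi g + Phi h) ->
  (forall a g, bmeas g -> Phi (fun x => a * g x) = a * Phi g) ->
  (forall g K, bmeas g -> (forall x, `|g x| <= K) -> `|Phi g| <= C * K) ->
  (forall A, measurable A -> m A = (Phi (\1_A))%:E) ->
  forall g, bmeas g -> fi m g = Phi g.
Proof.
move=> PD PZ PC P1 g bg; apply/eqP; rewrite -subr_eq0; apply/eqP.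
apply: (@bounded_functional0 _ T R (fun g => fi m g - Phi g) (fine (m setT) + C)) => //.
- by move=> g1 g2 b1 b2; rewrite fiD// PD//; ring.
- by move=> a g1 b1; rewrite fiZ// PZ//; ring.
- move=> g1 K b1 gK; rewrite (le_trans (ler_normB _ _))// mulrDl lerD ?PC//.
  by rewrite mulrC fi_le.
- by move=> A mA; rewrite fi_indic// P1// subrr.
Qed.

End fi_functional.

Section interval_integral.
Context {R : realType}.
Local Notation RM := (measurableTypeR R).
Local Notation leb := (@lebesgue_measure R).
Implicit Types (g h : RM -> R) (c d t : R).

Fact lebI_fin c d : (leb (`[c, d]%classic : set RM) < +oo)%E.
Proof. by rewrite lebesgue_measure_itv/=; case: ifPn => // _; rewrite ltry. Qed.

(** Lebesgue measure on the line is infinite; cut to a compact interval it is a finite measure, and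
    all results on [fi], Fubini included, apply to [ib]. *)
Definition lebI c d : {finite_measure set RM -> \bar R} :=
  @mfrestr _ RM R `[c, d]%classic leb (measurable_itv `[c, d]) (lebI_fin c d).

Definition ib c d g : R := fi (lebI c d) g.

Lemma lebIE c d A : lebI c d A = leb (A `&` `[c, d]%classic).
Proof. by []. Qed.

Lemma lebI_mass c d : c <= d -> fine (lebI c d setT) = d - c.
Proof.
move=> cd; rewrite lebIE setTI lebesgue_measure_itv/= lte_fin.
case: ltP => [//|dc] /=; apply/eqP; rewrite eq_sym subr_eq0; apply/eqP.
by apply/eqP; rewrite eq_le cd dc.
Qed.

Lemma bmeas_leb_integrable c d g : bmeas g ->
  leb.-integrable `[c, d] (EFin \o g).
Proof.
move=> [mg [K gK]]; apply: measurable_bounded_integrable => //.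
- exact: lebI_fin.
- exact: measurable_funTS.
- exists K; split; first by rewrite num_real.
  by move=> M KM x _ /=; rewrite (le_trans (gK x))// ltW.
Qed.

Lemma ib_RintegralE c d g : bmeas g ->
  ib c d g = \int[leb]_(x in `[c, d]) g x.
Proof.
apply: (@fi_functional _ _ _ (lebI c d)
  (fun g => \int[leb]_(x in `[c, d]) g x) (fine (lebI c d setT))).
- by move=> g1 g2 b1 b2; rewrite RintegralD//; exact: bmeas_leb_integrable.
- by move=> a g1 b1; rewrite RintegralZl//; exact: bmeas_leb_integrable.
- move=> g1 K b1 g1K; rewrite lebIE setTI.
  rewrite (le_trans (le_normr_Rintegral _ _))//.
    exact: bmeas_leb_integrable.
  rewrite mulrC -Rintegral_cst//; apply: le_Rintegral => //.
  + by apply: integrable_norm => //; exact: bmeas_leb_integrable.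
  + by apply: bmeas_leb_integrable; exact: bmeas_cst.
- move=> A mA; rewrite lebIE /Rintegral integral_indic// fineK// ge0_fin_numE//.
  by rewrite (le_lt_trans _ (lebI_fin c d))// le_measure ?inE//; exact: measurableI.
Qed.

Lemma ib_eq c d g h : bmeas g -> bmeas h ->
  (forall x, c <= x <= d -> g x = h x) -> ib c d g = ib c d h.
Proof.
move=> bg bh gh; rewrite !ib_RintegralE//; apply: eq_Rintegral => x.
by rewrite inE/= in_itv/= => /gh.
Qed.

Lemma ib_cst c d (k : R) : c <= d -> ib c d (fun=> k) = k * (d - c).
Proof. by move=> cd; rewrite /ib fi_cst lebI_mass. Qed.

Lemma le_ib c d g h : bmeas g -> bmeas h ->
  (forall x, c <= x <= d -> g x <= h x) -> ib c d g <= ib c d h.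
Proof.
move=> bg bh gh; rewrite !ib_RintegralE//.
by apply: le_Rintegral => //; exact: bmeas_leb_integrable.
Qed.

Lemma ib_le c d g K : bmeas g -> c <= d ->
  (forall x, c <= x <= d -> `|g x| <= K) -> `|ib c d g| <= K * (d - c).
Proof.
move=> bg cd gK; rewrite (le_trans (fi_normr _ bg))// -(ib_cst K cd).
by apply: le_ib => //; [exact: bmeas_norm|exact: bmeas_cst].
Qed.

Lemma ib_split c e d g : bmeas g -> c <= e -> e <= d ->
  ib c d g = ib c e g + ib e d g.
Proof.
move=> bg ce ed; rewrite !ib_RintegralE//.
have := @Rintegral_itvB R g (BLeft c) (BRight d) e (bmeas_leb_integrable c d bg).
rewrite !bnd_simp => /(_ ce ed) H.
rewrite -(Rintegral_itv_obnd_cbnd (r := e)); last first.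
  apply: integrableS (bmeas_leb_integrable e d bg) => //.
  by apply: subset_itvr; rewrite bnd_simp.
by rewrite -H addrC subrK.
Qed.

(** Only translations and reflections are needed below, so measure-preserving maps suffice and no
    Jacobian appears. *)
Lemma ib_change c d c' d' (phi : RM -> RM) g : measurable_fun setT phi ->
  (forall A, measurable A -> leb (phi @^-1` A) = leb A) ->
  phi @^-1` `[c', d']%classic = `[c, d]%classic -> bmeas g ->
  ib c d (fun x => g (phi x)) = ib c' d' g.
Proof.
move=> mphi lphi phiI bg; apply/esym; move: g bg.
apply: (@fi_functional _ _ _ (lebI c' d')
  (fun g => ib c d (fun x => g (phi x))) (fine (lebI c d setT))).
- by move=> g1 g2 b1 b2; rewrite /ib -fiD//; exact: bmeas_comp.
- by move=> a g1 b1; rewrite /ib -fiZ//; exact: bmeas_comp.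
- by move=> g1 K b1 g1K; rewrite mulrC; apply: fi_le => //; exact: bmeas_comp.
- move=> A mA; have mA' : measurable (phi @^-1` A).
    by rewrite -[X in measurable X]setTI; exact: mphi.
  rewrite /ib (_ : (fun x => _) = \1_(phi @^-1` A))//.
  rewrite fi_indic// fineK ?fin_num_measure//.
  rewrite !lebIE -phiI -preimage_setI lphi//; exact: measurableI.
Qed.

(** The translated measure agrees with Lebesgue measure on half-open intervals, which determine
    it. *)
Lemma lebesgue_shift t (A : set RM) : measurable A ->
  leb ((fun x : RM => x + t : RM) @^-1` A) = leb A.
Proof.
have mt : measurable_fun setT (fun x : RM => x + t : RM).
  exact: measurable_funD.
move=> mA; rewrite -[LHS]/(pushforward leb (fun x : RM => x + t : RM) A).
apply/esym.
apply: (@lebesgue_measure_unique R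
  (pushforward leb (fun x : RM => x + t : RM))) => // _ [[a b]] _ <-.
rewrite /pushforward.
transitivity (leb `]a - t, b - t]%classic); last first.
  congr (leb _); apply/seteqP; split => x /=; rewrite !in_itv/= => /andP[h1 h2];
    apply/andP; split; lra.
rewrite !lebesgue_measure_itv/= !lte_fin ltrD2r; case: ifP => //.
by move=> _; rewrite -!EFinB; congr (_%:E); lra.
Qed.

Lemma ib_shift c d t g : bmeas g ->
  ib c d (fun x : R => g (x + t)) = ib (c + t) (d + t) g.
Proof.
apply: (@ib_change _ _ _ _ (fun x : RM => x + t)).
- exact: measurable_funD.
- exact: lebesgue_shift.
- by apply/seteqP; split => x /=; rewrite !in_itv/= !lerD2r.
Qed.

Lemma ib_refl c d t g : bmeas g ->
  ib c d (fun x : R => g (t - x)) = ib (t - d) (t - c) g.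
Proof.
apply: (@ib_change _ _ _ _ (fun x : RM => t - x)).
- exact: measurable_funB.
- move=> A mA.
  have -> : (fun x : RM => t - x : RM) @^-1` A =
     (-%R : RM -> RM) @^-1` ((fun x : RM => x + t : RM) @^-1` A).
    by apply/seteqP; split => x /=; rewrite addrC.
  rewrite [LHS](lebesgue_measureN (_ : measurable (_ @^-1` _))) ?lebesgue_shift//.
  rewrite -[X in measurable X]setTI.
  by apply: (_ : measurable_fun setT (fun x : RM => x + t : RM)) => //; exact: measurable_funD.
- by apply/seteqP; split => x /=; rewrite !in_itv/= => /andP[h1 h2]; apply/andP; split; lra.
Qed.

Section monotone.
Variables (A : R -> R) (M : R).
Hypotheses (A_nd : {homo A : x y / x <= y}) (A_bd : forall x, 0 <= A x <= M).

Lemma nd_bmeas : bmeas (A : RM -> R).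
Proof.
split; first exact: nondecreasing_measurable.
by exists M => x; rewrite ger0_norm; have /andP[] := A_bd x.
Qed.

Lemma bmeas_shift t g : bmeas g -> bmeas (fun x : R => g (x + t) : R).
Proof. by apply: (@bmeas_comp _ _ _ _ _ (fun x : RM => x + t : RM)); exact: measurable_funD. Qed.

(** The two integrals cancel except near the ends: what remains is the integral of [A] over
    [d + s, d + t] minus that over [c + s, c + t]. This is the L^1 modulus of continuity of a
    monotone function, independent of the length of [c, d]. *)
Lemma ib_nd_shift c d s t : c <= d -> s <= t ->
  ib c d (fun x : R => A (x + t) - A (x + s)) <= M * (t - s).
Proof.
move=> cd st; have bA := nd_bmeas; rewrite /ib fiB; [|exact: bmeas_shift..].
rewrite -!/(ib _ _ _) !ib_shift//.
have e1 := @ib_split (c + s) (c + t) (d + t) A bA.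
have e2 := @ib_split (c + s) (d + s) (d + t) A bA.
have h1 : 0 <= ib (c + s) (c + t) A.
  rewrite -(mul0r (c + t - (c + s))) -(@ib_cst (c + s)) ?lerD2l//.
  by apply: le_ib => //; [exact: bmeas_cst|move=> x _; have /andP[] := A_bd x].
have h2 : ib (d + s) (d + t) A <= M * (t - s).
  have -> : t - s = d + t - (d + s) by ring.
  rewrite -(@ib_cst (d + s)) ?lerD2l//.
  by apply: le_ib => //; [exact: bmeas_cst|move=> x _; have /andP[] := A_bd x].
have := e1; rewrite e2; [|lra..] => e3.
have {}e3 := e3 _ _; rewrite !(lerD2l, lerD2r) in e3.
by have := e3 st cd; lra.
Qed.

End monotone.

End interval_integral.

(** * Convolution with a density of bounded variation *)

Section bv.
Context {R : realType}.
Local Notation RM := (measurableTypeR R).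
Local Notation leb := (@lebesgue_measure R).

Definition nd_bounded (A : R -> R) (M : R) :=
  {homo A : x y / x <= y} /\ forall x, 0 <= A x <= M.

Lemma nd_bounded_bmeas A M : nd_bounded A M -> bmeas (A : RM -> R).
Proof. by move=> [And Abd]; exact: nd_bmeas And Abd. Qed.

Lemma var01_decomp (h : R -> R) : (var01 h < +oo)%E -> exists a b M,
  [/\ nd_bounded a M, nd_bounded b M &
      ae_eq leb I01 (fun x => a x - b x) h].
Proof.
move=> /ereal_inf_lt[_ [g gh <-] TVg].
have bv : bounded_variation 0 1 g.
  apply/bounded_variationP => //; rewrite ge0_fin_numE//.
  exact: total_variation_ge0.
pose p := fine \o pos_tv 0 g; pose n := fine \o neg_tv 0 g.
have gE : {in `[0, 1], g =1 p \- n} := bounded_variation_pos_neg_tvE bv.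
have nn : {in `[0, 1] &, nondecreasing_fun n} := fine_neg_tv_nondecreasing bv.
have pn : {in `[0, 1] &, nondecreasing_fun p}.
  exact: (fine_neg_tv_nondecreasing (bounded_variationN bv)).
have i0 : (0 : R) \in `[0, 1] by rewrite in_itv/= lexx ler01.
have i1 : (1 : R) \in `[0, 1] by rewrite in_itv/= lexx ler01.
(* A nondecreasing function on [0, 1] lies between its values at the ends, so adding [K] makes both
   parts nonnegative and [M] bounds both. *)
pose K := `|p 0| + `|n 0|; pose M := K + `|p 1| + `|n 1|.
have cl f : {in `[0, 1] &, nondecreasing_fun f} -> `|f 0| <= K ->
    `|f 1| <= `|p 1| + `|n 1| -> nd_bounded (fun x => f (clamp01 x) + K) M.
  move=> fn f0 f1; split=> [x y xy|x].
    by rewrite lerD2r fn ?clamp01_in// clamp01_mono.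
  have /andP[c0 c1] : 0 <= clamp01 x <= 1 by have := clamp01_in x; rewrite in_itv.
  have h0 := fn _ _ i0 (clamp01_in x) c0; have h1 := fn _ _ (clamp01_in x) i1 c1.
  have := ler_norm (f 1); have := ler_norm (- f 0); rewrite normrN /M.
  by move=> h2 h3; apply/andP; split; lra.
exists (fun x => p (clamp01 x) + K), (fun x => n (clamp01 x) + K), M; split.
- by apply: cl => //; rewrite /K ?lerDl.
- by apply: cl => //; rewrite /K ?lerDr.
- apply: filterS gh => x /= gx xI; rewrite -gx// gE//=.
  by rewrite clamp01_id//; ring.
Qed.

Lemma ib_eq_null c d (N : set RM) (g h : RM -> R) :
  measurable N -> leb N = 0%E -> bmeas g -> bmeas h ->
  (forall x, c <= x <= d -> ~ N x -> g x = h x) -> ib c d g = ib c d h.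
Proof.
move=> mN N0 bg bh gh; apply/eqP; rewrite -subr_eq0 /ib -fiB//.
have bf := bmeasB bg bh; have [_ [K fK]] := bf.
rewrite -normr_le0 (le_trans (fi_normr _ bf))//.
have b1 := bmeas_indic R mN.
have -> : 0 = fi (lebI c d) (fun x => K * \1_N x).
  rewrite fiZ// fi_indic// lebIE.
  suff -> : leb (N `&` `[c, d]%classic) = 0%E by rewrite mulr0.
  apply/eqP; rewrite eq_le measure_ge0 andbT -N0 le_measure ?inE//.
  exact: measurableI.
apply: le_ib; [exact: bmeas_norm|exact: bmeasZ|move=> x xcd].
rewrite indicE; have [/[1!inE] xN|/negP xN] := boolP (x \in N).
  by rewrite mulr1.
by rewrite gh// ?subrr ?normr0 ?mulr0// => xN'; apply: xN; rewrite inE.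
Qed.

Lemma lebesgue_set2 (c d : R) : leb [set c; d] = 0%E.
Proof.
apply/eqP; rewrite eq_le measure_ge0 andbT.
have s1 (x : R) : leb [set x] = 0%E by exact: lebesgue_measure_set1.
by rewrite (le_trans (measureU2 _ _ _))// [X in (X + _)%E]s1 [X in (_ + X)%E]s1 adde0.
Qed.

Lemma ib_eq_oo c d (g h : RM -> R) : bmeas g -> bmeas h ->
  (forall x, c < x < d -> g x = h x) -> ib c d g = ib c d h.
Proof.
move=> bg bh gh; apply: (@ib_eq_null _ _ [set c; d]) => //.
  by apply: measurableU.
  exact: lebesgue_set2.
move=> x /andP[cx xd] /not_orP[xc xd']; apply: gh.
by rewrite !lt_neqAle cx xd !andbT; apply/andP; split; apply/eqP => // e; apply: xc.
Qed.

Lemma fold01_id (x : R) : 0 <= x <= 1 -> fold01 x = x.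
Proof.
move=> /andP[x0 x1]; apply/eqP; rewrite eq_le; apply/andP; split.
  by have := fold01_le x 0; rewrite mulr0 subr0 ger0_norm.
have [i ->] := fold01_min x; rewrite ler_normr.
have [i0|i1] := lerP i 0.
  by apply/orP; left; have : i%:~R <= 0 :> R; [rewrite lerz0|lra].
by apply/orP; right; have : 1 <= i%:~R :> R; [rewrite ler1z|lra].
Qed.

(** A sum of two points of [0, 1] lies in [0, 2], so the branches of [fold01_id] and of this lemma
    are all that the convolution meets. *)
Lemma fold01_refl (x : R) : 1 <= x <= 2 -> fold01 x = 2 - x.
Proof.
move=> /andP[x1 x2]; apply/eqP; rewrite eq_le; apply/andP; split.
  have := fold01_le x 1; rewrite mulr1 distrC ger0_norm//; lra.
have [i ->] := fold01_min x; rewrite ler_normr.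
have [i0|i1] := lerP i 0.
  by apply/orP; left; have : i%:~R <= 0 :> R; [rewrite lerz0|lra].
by apply/orP; right; have : 1 <= i%:~R :> R; [rewrite ler1z|lra].
Qed.

Lemma cint_bv (mu : bs R) : is_BV mu -> exists a b M,
  [/\ nd_bounded a M, nd_bounded b M &
   forall g : RM -> R, bmeas g -> cint mu g = ib 0 1 (fun x => g x * (a x - b x))].
Proof.
move=> BV; have L : is_L1 mu.
  by move: BV; rewrite /is_BV /bvnorm; case: asboolP.
have v : (var01 (density mu) < +oo)%E.
  move: BV; rewrite /is_BV /bvnorm asboolT// /bvnorm_fun; apply: le_lt_trans.
  by rewrite leeDr// integral_ge0.
have [a [b [M [nda ndb abE]]]] := var01_decomp v.
exists a, b, M; split=> // g bg.
have br : bmeas (fun x => g x * (a x - b x) : R).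
  by apply: bmeasM => //; apply: bmeasB; [exact: nd_bounded_bmeas nda|exact: nd_bounded_bmeas ndb].
rewrite ib_RintegralE// cint_density// /Rintegral; congr fine.
apply: ae_eq_integral => //.
- have := measurable_int _ (density_bmeasM L bg); exact.
- by apply/measurable_EFinP/measurable_funTS; exact: br.1.
- by apply: filterS abE => x /= h xI; rewrite -h.
Qed.

(* The density of [rho], extended by zero, is written [A - B] on the whole line
   with [A] and [B] bounded and nondecreasing. *)
Definition ext01 (M : R) (a : R -> R) (x : R) : R :=
  if x < 0 then 0 else if x <= 1 then a x else M.

Lemma ext01_nd M a : nd_bounded a M -> nd_bounded (ext01 M a) M.
Proof.
move=> [and0 abd]; have M0 : 0 <= M by have /andP[h1 h2] := abd 0; rewrite (le_trans h1).
split=> [x y xy|x].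
  rewrite /ext01; have /andP[? ?] := abd x; have /andP[? ?] := abd y.
  case: (ltP x 0) => x0; first by case: (ltP y 0) => // y0; case: (leP y 1).
  rewrite (ltNge y 0) (le_trans x0 xy)/=; case: (leP x 1) => x1; case: (leP y 1) => y1 //.
  - exact: and0.
  - by move: (le_lt_trans xy (le_lt_trans y1 x1)); rewrite ltxx.
rewrite /ext01; case: (ltP x 0) => _; first by rewrite lexx.
by case: (leP x 1) => _; rewrite ?abd// M0 lexx.
Qed.

(** The density at [x] of the noise started at [y] and folded: [x] is reached when the sum is [x] or
    its mirror image [2 - x]. *)
Definition kern (A B : R -> R) (x y : R) : R :=
  (A (x - y) - B (x - y)) + (A (2 - x - y) - B (2 - x - y)).

Lemma bmeas_nd_pair A M (f : RM * RM -> RM) : nd_bounded A M ->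
  measurable_fun setT f -> bmeas (fun z => A (f z) : R).
Proof. by move=> ndA mf; apply: (bmeas_comp mf); exact: nd_bounded_bmeas ndA. Qed.

Lemma measurable_sub2 : measurable_fun setT (fun z : RM * RM => (z.1 : R) - z.2 : RM).
Proof. exact: measurable_funB. Qed.

Lemma measurable_sub3 : measurable_fun setT (fun z : RM * RM => 2 - (z.1 : R) - z.2 : RM).
Proof. by apply: measurable_funB => //; exact: measurable_funB. Qed.

Lemma bmeas_kern A B M : nd_bounded A M -> nd_bounded B M ->
  bmeas (fun z : RM * RM => kern A B z.1 z.2).
Proof.
move=> ndA ndB; rewrite /kern; apply: bmeasD; apply: bmeasB.
- exact: (bmeas_nd_pair ndA measurable_sub2).
- exact: (bmeas_nd_pair ndB measurable_sub2).
- exact: (bmeas_nd_pair ndA measurable_sub3).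
- exact: (bmeas_nd_pair ndB measurable_sub3).
Qed.

End bv.

Section noise.
Context {R : realType}.
Local Notation RM := (measurableTypeR R).
Local Notation leb := (@lebesgue_measure R).
Implicit Types (g : RM -> R).
Variables (rho : bs R) (a b : R -> R) (M : R).
Hypotheses (nda : nd_bounded a M) (ndb : nd_bounded b M).
Hypothesis rhoE : forall g : RM -> R, bmeas g ->
  cint rho g = ib 0 1 (fun x => g x * (a x - b x)).

Let A := ext01 M a.
Let B := ext01 M b.
Let ndA : nd_bounded A M := ext01_nd nda.
Let ndB : nd_bounded B M := ext01_nd ndb.
Let kap := kern A B.
Let bkap : bmeas (fun z : RM * RM => kap z.1 z.2) := bmeas_kern ndA ndB.

(** The translation by [y] leads to an integral over [0, 2]; its upper half is reflected onto [0, 1]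
    and produces the second term of the kernel. *)
Lemma fold_kernE y g : 0 <= y <= 1 -> bmeas g ->
  cint rho (fun x : R => g (fold01 (x + y))) = ib 0 1 (fun x => g x * kap x y).
Proof.
move=> /andP[y0 y1] bg; rewrite rhoE; last exact: bmeas_fold_r.
pose r x := A x - B x.
have br : bmeas (r : RM -> R).
  by apply: bmeasB; [exact: nd_bounded_bmeas ndA|exact: nd_bounded_bmeas ndB].
have bgf : bmeas (fun x : R => g (fold01 x) : R).
  apply: (@bmeas_comp _ _ _ _ _ (fun x : RM => fold01 x : RM)) => //.
  apply: continuous_measurable_fun; apply: (@lip_continuous _ _ 1) => x z.
  by rewrite mul1r fold01_lip.
pose h (z : R) : R := g (fold01 z) * r (z - y).
have bh : bmeas (h : RM -> R) by apply: bmeasM => //; exact: (bmeas_shift (- y) br).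
have bhy : bmeas (fun x : R => h (x + y) : R) by exact: bmeas_shift.
have -> : ib 0 1 (fun x : R => g (fold01 (x + y)) * (a x - b x)) =
          ib 0 1 (fun x : R => h (x + y)).
  apply: ib_eq => //.
    apply: bmeasM; first exact: bmeas_fold_r.
    by apply: bmeasB; [exact: nd_bounded_bmeas nda|exact: nd_bounded_bmeas ndb].
  move=> x /andP[x0 x1]; rewrite /h addrK /r /A /B /ext01.
  by rewrite ltNge x0/= x1.
(* Outside [0, 1] the extensions [A] and [B] coincide, both 0 on the left and both [M] on the right,
   so the range may be enlarged to [-y, 2 - y]. *)
have z0 c d : c <= d -> (d <= 0) || (1 <= c) -> ib c d (fun x : R => h (x + y)) = 0.
  move=> cd dc; rewrite -(mul0r (d - c)) -(@ib_cst _ c)//.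
  apply: ib_eq_oo => //; first exact: bmeas_cst.
  move=> x /andP[cx xd]; rewrite /h addrK /r /A /B /ext01.
  case/orP: dc => [d0|c1]; first by rewrite (lt_le_trans xd d0) subrr mulr0.
  rewrite !ltNge (le_trans ler01 (le_trans c1 (ltW cx)))/=.
  by rewrite leNgt (le_lt_trans c1 cx)/= subrr mulr0.
have -> : ib 0 1 (fun x : R => h (x + y)) = ib (- y) (2 - y) (fun x : R => h (x + y)).
  rewrite (@ib_split _ (- y) 0 (2 - y))//; [|lra..].
  rewrite (@ib_split _ 0 1 (2 - y))//; [|lra..].
  by rewrite (z0 (- y) 0) ?(z0 1 (2 - y)) ?add0r ?addr0 ?lexx ?orbT//; lra.
rewrite ib_shift// addNr subrK (@ib_split _ 0 1 2)//; [|lra..].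
have -> : ib 1 2 h = ib 0 1 (fun x : R => h (2 - x)).
  rewrite (ib_refl 0 1 2 bh) subr0 (_ : 2 - 1 = 1)//; lra.
have bh2 : bmeas (fun x : R => h (2 - x) : R).
  apply: (@bmeas_comp _ _ _ _ _ (fun x : RM => 2 - x : RM)) => //.
  exact: measurable_funB.
rewrite /ib -fiD//; apply: ib_eq.
- exact: bmeasD.
- by apply: bmeasM => //; exact: (bmeas_pair2 y bkap).
- move=> x /andP[x0 x1]; rewrite /h /kap /kern /r fold01_id ?x0// fold01_refl; last lra.
  by rewrite subKr; ring.
Qed.

(** The kernels at [y] and [z] differ by increments of [A] and [B], direct and reflected. Each of
    these four monotone increments has integral at most [M * |y - z|] by [ib_nd_shift]. *)
Lemma fold_kern_lip y z g : 0 <= y <= 1 -> 0 <= z <= 1 -> bmeas g ->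
  (forall x, `|g x| <= 1) ->
  `|cint rho (fun x : R => g (fold01 (x + y))) -
    cint rho (fun x : R => g (fold01 (x + z)))| <= 4 * M * `|y - z|.
Proof.
wlog yz : y z / z <= y => [H|] y01 z01 bg g1.
  have [zy|/ltW yz] := leP z y; first exact: H.
  by rewrite distrC (distrC y); exact: H.
rewrite (fold_kernE y01 bg) (fold_kernE z01 bg).
have bk t : bmeas (fun x : RM => kap x t : R) by exact: (bmeas_pair2 t bkap).
have bgk t : bmeas (fun x : RM => g x * kap x t) by apply: bmeasM.
rewrite /ib -(fiB _ (bgk y) (bgk z)) (le_trans (fi_normr _ (bmeasB (bgk y) (bgk z))))//.
pose D (C : R -> R) (x : R) := C (x - z) - C (x - y).
have bC C t : nd_bounded C M -> bmeas (fun x : RM => C ((x : R) - t) : R).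
  by move=> /nd_bounded_bmeas bC; exact: (bmeas_shift (- t) bC).
have bD C : nd_bounded C M -> bmeas (fun x : RM => D C x : R).
  by move=> nC; apply: bmeasB; exact: bC.
have bD2 C : nd_bounded C M -> bmeas (fun x : RM => D C (2 - (x : R)) : R).
  move=> nC; apply: (@bmeas_comp _ _ _ _ _ (fun x : RM => 2 - x : RM)) => //.
    exact: measurable_funB.
  exact: bD.
have D0 C x : nd_bounded C M -> 0 <= D C x.
  by move=> [Cnd _]; rewrite /D subr_ge0 Cnd// lerB.
have Dle C c d : nd_bounded C M -> c <= d -> ib c d (D C) <= M * (y - z).
  move=> [Cnd Cbd] cd; rewrite /D (_ : y - z = - z - - y); last ring.
  by apply: (ib_nd_shift Cnd Cbd); rewrite ?lerN2.
rewrite (@le_trans _ _ (fi (lebI 0 1) (fun x : RM =>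
   (D A x + D B x) + (D A (2 - (x : R)) + D B (2 - (x : R))))))//.
  apply: le_fi.
  - by apply: bmeas_norm; apply: bmeasB.
  - by apply: bmeasD; apply: bmeasD; [exact: bD|exact: bD|exact: bD2|exact: bD2].
  move=> x; rewrite -mulrBr normrM (@le_trans _ _ (`|kap x y - kap x z|))//.
    by rewrite ler_piMl.
  have := D0 A x ndA; have := D0 B x ndB.
  have := D0 A (2 - x) ndA; have := D0 B (2 - x) ndB.
  rewrite /kap /kern /D => *; rewrite ler_norml; apply/andP; split; lra.
rewrite (fiD _ (bmeasD (bD _ ndA) (bD _ ndB)) (bmeasD (bD2 _ ndA) (bD2 _ ndB))).
rewrite (fiD _ (bD _ ndA) (bD _ ndB)) (fiD _ (bD2 _ ndA) (bD2 _ ndB)).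
have r2 C : nd_bounded C M -> fi (lebI 0 1) (fun x : RM => D C (2 - (x : R))) <= M * (y - z).
  move=> nC; rewrite -/(ib 0 1 _) (ib_refl 0 1 2 (bD _ nC)); apply: Dle => //; lra.
have r1 C : nd_bounded C M -> fi (lebI 0 1) (fun x : RM => D C x) <= M * (y - z).
  by move=> nC; apply: (Dle _ 0 1).
have := r1 A ndA; have := r1 B ndB; have := r2 A ndA; have := r2 B ndB.
by rewrite (ger0_norm (_ : 0 <= y - z)) ?subr_ge0//; lra.
Qed.

(** The maximum meets both demands of [cint_wn]: [tv rho] bounds the smoothed test function, [4 * M]
    its Lipschitz constant. *)
Lemma tv_hconv_wn mu :
  tv (hconv rho mu) <= Num.max (tv rho) (4 * M) * wn mu.
Proof.
apply: tv_le => s bs s1; rewrite cint_hconv21// (le_trans (ler_norm _))//.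
apply: cint_wn.
- exact: bmeas_hconv1.
- by rewrite le_max tv_ge0.
- move=> y _; rewrite le_max; apply/orP; left.
  by rewrite -[leRHS]mul1r; apply: cint_le => //; exact: bmeas_fold_r.
- move=> y z; rewrite !in_itv/= => y01 z01.
  rewrite (le_trans (fold_kern_lip y01 z01 bs s1))// ler_wpM2r//.
  by rewrite le_max lexx orbT.
Qed.

Definition noise_density (mu : bs R) (x : R) : R := cint mu (fun y : R => kap x y).

Lemma bmeas_noise_density mu : bmeas (noise_density mu : RM -> R).
Proof. exact: (@bmeas_cint2 _ _ _ _ _ mu mu _ bkap). Qed.

Lemma cint_noise (mu : bs R) g : bmeas g ->
  cint (hconv rho mu) g = ib 0 1 (fun x => g x * noise_density mu x).
Proof.
move=> bg; rewrite cint_hconv21//.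
have bgk : bmeas (fun z : RM * RM => g z.1 * kap z.1 z.2).
  apply: bmeasM => //; exact: (bmeas_comp (measurable_fst) bg).
transitivity (cint mu (fun y : R => ib 0 1 (fun x => g x * kap x y))).
  apply: cint_eq_I01.
  - exact: bmeas_hconv1.
  - exact: (bmeas_fi1 (lebI 0 1) (pos_part mu) bgk).
  - by move=> y; rewrite in_itv/= => y01; rewrite fold_kernE.
rewrite !cintE /ib -!(fi_swap _ _ bgk) -fiB; last 2 first.
- exact: (bmeas_fi2 (lebI 0 1) (pos_part mu) bgk).
- exact: (bmeas_fi2 (lebI 0 1) (neg_part mu) bgk).
congr (fi _ _); apply/funext => x.
have bk : bmeas (fun y : RM => kap x y) by exact: (bmeas_pair1 x bkap).
by rewrite /noise_density cintE /= !(fiZ _ _ bk) mulrBr.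
Qed.

Lemma is_L1_noise mu : is_L1 (hconv rho mu).
Proof.
apply/is_L1P => N mN N0; rewrite -cint_indic//.
rewrite cint_noise; last exact: bmeas_indic.
have bd := bmeas_noise_density mu.
rewrite (@ib_eq_null _ 0 1 N _ (fun=> 0))//.
- by rewrite ib_cst// mul0r.
- by apply: bmeasM => //; exact: bmeas_indic.
- exact: bmeas_cst.
- by move=> x _ xN; rewrite indicE memNset// mul0r.
Qed.

(** The reflection reverses monotonicity, so [A] is paired with the reflected [B] and conversely:
    the kernel is [al - be] with both nondecreasing in [x]. Integrating against the Jordan parts of
    [mu] keeps this form. *)
Lemma bounded_variation_noise_density mu :
  bounded_variation 0 1 (noise_density mu).
Proof.
pose al x (y : R) : R := A (x - y) - B (2 - x - y).
pose be x (y : R) : R := B (x - y) - A (2 - x - y).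
have bal : bmeas (fun z : RM * RM => al z.1 z.2).
  by apply: bmeasB; [exact: (bmeas_nd_pair ndA measurable_sub2)|
    exact: (bmeas_nd_pair ndB measurable_sub3)].
have bbe : bmeas (fun z : RM * RM => be z.1 z.2).
  by apply: bmeasB; [exact: (bmeas_nd_pair ndB measurable_sub2)|
    exact: (bmeas_nd_pair ndA measurable_sub3)].
have b1 x : bmeas (fun y : RM => al x y) by exact: (bmeas_pair1 x bal).
have b2 x : bmeas (fun y : RM => be x y) by exact: (bmeas_pair1 x bbe).
have al_nd x x' y : x <= x' -> al x y <= al x' y.
  by move=> xx; rewrite /al lerB//; [apply: ndA.1|apply: ndB.1]; lra.
have be_nd x x' y : x <= x' -> be x y <= be x' y.
  by move=> xx; rewrite /be lerB//; [apply: ndB.1|apply: ndA.1]; lra.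
pose U x : R := fi (pos_part mu) (al x) + fi (neg_part mu) (be x).
pose W x : R := fi (pos_part mu) (be x) + fi (neg_part mu) (al x).
have -> : noise_density mu = U \+ (\- W).
  apply/funext => x; rewrite /noise_density cintE /U /W/=.
  have -> : (fun y => kap x y) = (fun y => al x y - be x y).
    by apply/funext => y; rewrite /kap /kern /al /be; ring.
  by rewrite !(fiB _ (b1 x) (b2 x)); ring.
apply: bounded_variationD => //.
  by apply: nondecreasing_bounded_variation => x y _ _ xy; rewrite /U lerD//;
    apply: le_fi => // z; [exact: al_nd|exact: be_nd].
apply/bounded_variationN.
by apply: nondecreasing_bounded_variation => x y _ _ xy; rewrite /W lerD//;
  apply: le_fi => // z; [exact: be_nd|exact: al_nd].
Qed.

(** [var01] is an infimum over representatives, so it is enough that [noise_density mu] is one of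
    them. *)
Lemma is_BV_noise mu : is_BV (hconv rho mu).
Proof.
have L := is_L1_noise mu.
have n1 : norm1_fun (density (hconv rho mu)) = (tv (hconv rho mu))%:E.
  by rewrite -norm1E// /norm1 asboolT.
rewrite /is_BV /bvnorm asboolT// /bvnorm_fun n1.
apply: lte_add_pinfty; first exact: ltry.
apply: (@le_lt_trans _ _ (total_variation 0 1 (noise_density mu))); last first.
  have /bounded_variationP := bounded_variation_noise_density mu.
  by move=> /(_ ler01); rewrite ge0_fin_numE// total_variation_ge0.
apply: ereal_inf_lbound; exists (noise_density mu) => //=.
have bd := bmeas_noise_density mu.
suff : ae_eq leb I01 (EFin \o noise_density mu)
     ('d (hconv rho mu) '/d leb).
  by apply: filterS => x /= h xI; rewrite /density -h.
apply: integral_ae_eq => //.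
- exact: bmeas_leb_integrable.
- apply: measurable_funTS; exact: measurable_int (Radon_Nikodym_integrable L).
- move=> E EI mE; rewrite -Radon_Nikodym_integral// -cint_indic//.
  have bE := bmeas_indic R mE.
  rewrite cint_noise// ib_RintegralE; last exact: bmeasM.
  rewrite /Rintegral fineK; last first.
    apply: integrable_fin_num => //; apply: bmeas_leb_integrable; exact: bmeasM.
  rewrite -{1}(setIidr EI) integral_mkcondr; apply: eq_integral => x _.
  by rewrite /patch indicE; case: (x \in E); rewrite ?mul1r// mul0r.
Qed.

End noise.

(** * Uniform mixing *)

Section dual.
Context {R : realType}.
Local Notation RM := (measurableTypeR R).
Implicit Types (L : bs R -> bs R) (Lt : (RM -> R) -> RM -> R) (mu nu rho : bs R).
Implicit Types (g : RM -> R) (T : borel_selfmap R).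

(** An adjoint on bounded measurable functions provides linearity and compatibility with [bs_eq] at
    once. *)
Definition dual L Lt := forall g, bmeas g ->
  bmeas (Lt g) /\ forall mu, cint (L mu) g = cint mu (Lt g).

Lemma dual_comp L1 Lt1 L2 Lt2 : dual L1 Lt1 -> dual L2 Lt2 ->
  dual (L1 \o L2) (Lt2 \o Lt1).
Proof.
move=> h1 h2 g bg; have [b1 e1] := h1 g bg; have [b2 e2] := h2 _ b1.
by split=> // mu /=; rewrite e1 e2.
Qed.

Lemma dual_id : dual id id.
Proof. by move=> g bg. Qed.

Lemma dual_iter L Lt n : dual L Lt -> dual (iter n L) (iter n Lt).
Proof.
move=> h; elim: n => [|n ih]; first exact: dual_id.
move=> g bg; have [b1 e1] := h g bg; have [b2 e2] := ih _ b1.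
by rewrite iterSr; split=> // mu; rewrite /= e1 e2.
Qed.

Section properties.
Variables (L : bs R -> bs R) (Lt : (RM -> R) -> RM -> R).
Hypothesis LLt : dual L Lt.

Lemma dual_eq mu nu : bs_eq mu nu -> bs_eq (L mu) (L nu).
Proof.
move=> /bs_eqP h; apply/bs_eqP => g bg; have [b1 e1] := LLt bg.
by rewrite !e1; exact: h.
Qed.

Lemma dual_cintD mu nu g : bmeas g ->
  cint (L (bs_add mu nu)) g = cint (L mu) g + cint (L nu) g.
Proof. by move=> bg; have [b1 e1] := LLt bg; rewrite !e1 cint_bs_add. Qed.

Lemma dual_cintZ a mu g : bmeas g ->
  cint (L (bs_scale a mu)) g = a * cint (L mu) g.
Proof. by move=> bg; have [b1 e1] := LLt bg; rewrite !e1 cint_bs_scale. Qed.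

Lemma dual_cintB mu nu g : bmeas g ->
  cint (L (bs_sub mu nu)) g = cint (L mu) g - cint (L nu) g.
Proof. by move=> bg; have [b1 e1] := LLt bg; rewrite !e1 cint_bs_sub. Qed.

End properties.

Lemma dual_hconv rho : dual (hconv rho)
  (fun g (y : R) => cint rho (fun x : R => g (fold01 (x + y)))).
Proof.
by move=> g bg; split; [exact: bmeas_hconv1|move=> mu; exact: cint_hconv21].
Qed.

Lemma dual_push T : dual (push T) (fun g x => g (selfmap_ext T x)).
Proof. by move=> g bg; split; [exact: bmeas_push|move=> mu; exact: cint_push]. Qed.

Lemma dual_transfer rho T : exists Lt, dual (transfer rho T) Lt.
Proof. by eexists; exact: (dual_comp (dual_hconv rho) (dual_push T)). Qed.

Lemma tv_transfer rho T mu : is_probability rho -> tv (transfer rho T mu) <= tv mu.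
Proof.
move=> /is_probabilityP rho1; rewrite /transfer (le_trans (tv_hconv _ _))//.
by rewrite rho1 mul1r tv_push.
Qed.

Lemma tv_iter L mu n : (forall nu, tv (L nu) <= tv nu) ->
  tv (iter n L mu) <= tv mu.
Proof. by move=> h; elim: n => //= n ih; rewrite (le_trans (h _)). Qed.

Lemma push_mass T mu : cint (push T mu) (fun=> 1) = cint mu (fun=> 1).
Proof. by rewrite cint_push//; exact: bmeas_cst. Qed.

Lemma hconv_mass rho mu :
  cint (hconv rho mu) (fun=> 1) = cint rho (fun=> 1) * cint mu (fun=> 1).
Proof.
rewrite cint_hconv21; last exact: bmeas_cst.
by rewrite -cintZ ?mulr1//; exact: bmeas_cst.
Qed.

Lemma probability_mass rho : is_probability rho -> cint rho (fun=> 1) = 1.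
Proof. by move=> [_ r1]; apply: EFin_inj; rewrite cint_mass. Qed.

Lemma transfer_mass rho T mu : is_probability rho ->
  cint (transfer rho T mu) (fun=> 1) = cint mu (fun=> 1).
Proof.
by move=> /probability_mass r1; rewrite /transfer hconv_mass r1 mul1r push_mass.
Qed.

Lemma iter_mass L mu n : (forall nu, cint (L nu) (fun=> 1) = cint nu (fun=> 1)) ->
  cint (iter n L mu) (fun=> 1) = cint mu (fun=> 1).
Proof. by move=> h; elim: n => //= n ih; rewrite h. Qed.

End dual.

Section mixing.
Context {R : realType}.
Local Notation RM := (measurableTypeR R).
Implicit Types (g : RM -> R).

Program Definition const_map (c : R) : borel_selfmap R :=
  @BorelSelfmap R (fun=> clamp01 c) _ _.
Next Obligation. by move=> c; exact: measurable_cst. Qed.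
Next Obligation. by move=> c x _; exact: clamp01_in. Qed.

(* [x] rounded down to a multiple of [1 / N.+1]. *)
Definition step (N : nat) (x : R) : R :=
  \sum_(k < N.+1)
    \1_(`[k.+1%:R / N.+1%:R, +oo[%classic : set R) x / N.+1%:R.

Lemma stepE N x : x \in `[0, 1] ->
  step N x = (\sum_(k < N.+1) (k.+1%:R <= x * N.+1%:R)%R%:R) / N.+1%:R.
Proof.
move=> _; rewrite /step mulr_suml; apply: eq_bigr => k _; congr (_ / _).
rewrite indicE; congr (_%:R); congr nat_of_bool.
by apply/idP/idP; rewrite inE/= in_itv/= andbT ler_pdivrMr.
Qed.

Lemma step_close N x : x \in `[0, 1] -> `|step N x - x| <= N.+1%:R^-1.
Proof.
move=> xI; rewrite stepE//; move: xI; rewrite in_itv/= => /andP[x0 x1].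
have N0 : 0 < N.+1%:R :> R by rewrite ltr0n.
set s := \sum_(k < _) _.
have H : 0 <= x * N.+1%:R < N.+2%:R -> x * N.+1%:R - 1 <= s <= x * N.+1%:R.
  exact: count_le_floor.
have /H /andP[s1 s2] : 0 <= x * N.+1%:R < N.+2%:R.
  rewrite mulr_ge0//= (@le_lt_trans _ _ (1 * N.+1%:R))//; first exact: ler_wpM2r.
  by rewrite mul1r ltr_nat.
have -> : s / N.+1%:R - x = (s - x * N.+1%:R) / N.+1%:R by field; rewrite gt_eqF// addrC natr1.
rewrite normrM normfV (gtr0_norm N0) ler_pdivrMr// mulVf ?gt_eqF//.
by rewrite ler_norml; apply/andP; split; lra.
Qed.

(** A count over [N.+1] thresholds takes [N.+2] values, the grid points from 0 to 1 included. *)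
Lemma step_val N x : exists i : 'I_N.+2, step N x = i%:R / N.+1%:R.
Proof.
rewrite /step -mulr_suml.
suff H n : exists i : 'I_n.+1, \sum_(k < n)
    \1_(`[k.+1%:R / N.+1%:R, +oo[%classic : set R) x = i%:R :> R.
  by have [i ->] := H N.+1; exists i.
elim: n => [|n [i ih]]; first by exists ord0; rewrite big_ord0.
rewrite big_ord_recr/= ih indicE; case: (_ \in _).
  by exists (lift ord0 i); rewrite lift0 -natrD addn1.
by exists (widen_ord (leqnSn _) i); rewrite addr0.
Qed.

Lemma step_meas N : measurable_fun setT (step N : RM -> RM).
Proof.
have : bmeas (step N : RM -> R).
  apply: (@bmeas_sum _ RM R N.+1 (fun k x =>
    \1_(`[k.+1%:R / N.+1%:R, +oo[%classic : set RM) x / N.+1%:R)) => k.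
  by apply: bmeasM; [apply: bmeas_indic; exact: measurable_itv|exact: bmeas_cst].
by case.
Qed.

Program Definition step_map (N : nat) : borel_selfmap R :=
  @BorelSelfmap R (step N) _ _.
Next Obligation. by move=> N; apply: measurable_funTS; exact: step_meas. Qed.
Next Obligation.
move=> N x xI /=; have [i ->] := step_val N x; rewrite in_itv/= divr_ge0//=.
by rewrite ler_pdivrMr// mul1r ler_nat -ltnS.
Qed.

Lemma wn_step N nu : wn (bs_sub nu (push (step_map N) nu)) <= N.+1%:R^-1 * tv nu.
Proof.
apply: wn_le => g lg; have bg := lip1_bmeas lg.
rewrite cint_bs_sub// cint_push// -cintB//; last exact: bmeas_push.
rewrite (le_trans (ler_norm _))//; apply: cint_le_I01.
- by apply: bmeasB => //; exact: bmeas_push.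
- by rewrite invr_ge0.
- move=> x xI; rewrite selfmap_extE//= (le_trans (lg.2 _ _))// distrC.
  exact: step_close.
Qed.

Section uniform_mixing.
Variables (rho : bs R) (T : borel_selfmap R).
Hypotheses (rho_BV : is_BV rho) (rho1 : is_probability rho).
Hypothesis mix : forall g : bs R, is_BV g -> g I01 = 0%E ->
  norm1 (iter n (transfer rho T) g) @[n --> \oo] --> 0%E.
Let L := transfer rho T.

(** Hides the monotone functions behind the density: below, only the smoothing from [wn] to [tv] and
    the regularity of the output are used. *)
Lemma noise_props : exists2 C : R, 0 <= C &
  forall mu, [/\ tv (hconv rho mu) <= C * wn mu,
              is_L1 (hconv rho mu) & is_BV (hconv rho mu)].
Proof.
have [a [b [M [nda ndb abE]]]] := cint_bv rho_BV.
exists (Num.max (tv rho) (4 * M)); first by rewrite le_max tv_ge0.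
move=> mu; split.
- exact: (tv_hconv_wn nda ndb abE).
- exact: (is_L1_noise nda ndb abE).
- exact: (is_BV_noise nda ndb abE).
Qed.

Lemma is_L1_iter mu n : is_L1 mu -> is_L1 (iter n L mu).
Proof.
have [C C0 HC] := noise_props.
by case: n => // n _ /=; have [] := HC (push T (iter n L mu)).
Qed.

(** A constant map pushes a probability to a point mass, so for [c] in [0, 1] this is the unit mass
    at [c] minus the unit mass at 0. *)
Let dir (c : R) : bs R := bs_sub (push (const_map c) rho) (push (const_map 0) rho).

Let cint_dir c g : c \in `[0, 1] -> bmeas g -> cint (dir c) g = g c - g 0.
Proof.
move=> cI bg; have H d : d \in `[0, 1] -> cint (push (const_map d) rho) g = g d.
  move=> dI; rewrite cint_push// -[RHS]mulr1 -(probability_mass rho1).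
  rewrite -cintZ; last exact: bmeas_cst.
  apply: cint_eq_I01; first exact: bmeas_push.
    exact: bmeas_cst.
  by move=> x xI; rewrite selfmap_extE//= clamp01_id// mulr1.
by rewrite cint_bs_sub// !H// in_itv/= lexx ler01.
Qed.

Let mix_dir c : c \in `[0, 1] ->
  tv (iter n L (hconv rho (dir c))) @[n --> \oo] --> (0 : R).
Proof.
move=> cI; have [C C0 HC] := noise_props.
have [_ L1 BVd] := HC (dir c).
have m0 : hconv rho (dir c) I01 = 0%E.
  apply/mass0P; rewrite hconv_mass cint_dir// ?subrr ?mulr0//.
  exact: bmeas_cst.
have := mix BVd m0.
rewrite (_ : (fun n => norm1 _) = (fun n => (tv (iter n L (hconv rho (dir c))))%:E)).
  by move/fine_cvg.
by apply/funext => n; rewrite norm1E//; exact: is_L1_iter.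
Qed.

Lemma uniform_mixing : exists n0 : nat, forall mu : bs R, mu I01 = 0%E ->
  tv (iter n0.+1 L mu) <= 2^-1 * tv mu.
Proof.
have [C C0 HC] := noise_props.
have [Lt LLt] := dual_transfer rho T.
(* The factor [2^-1] is shared equally: one quarter for replacing the measure by its discretization,
   one for mixing on the grid. *)
have [N hN] : exists N : nat, C * N.+1%:R^-1 <= 4^-1.
  exists (Num.truncn (4 * C)).
  by rewrite ler_pdivrMr//; have := ltW (truncnS_gt (4 * C)); lra.
have sum0 : (\sum_(i < N.+2) tv (iter n L (hconv rho (dir (i%:R / N.+1%:R)))))
     @[n --> \oo] --> (0 : R).
  rewrite -[X in _ --> X](_ : \sum_(i < N.+2) 0 = _); last by rewrite big1.
  apply: cvg_big => [|i _]; first exact: add_continuous.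
  apply: mix_dir.
  by rewrite in_itv/= divr_ge0//= ler_pdivrMr// mul1r ler_nat -ltnS.
have [n0 hn0] : exists n0 : nat,
    \sum_(i < N.+2) tv (iter n0 L (hconv rho (dir (i%:R / N.+1%:R)))) <= 4^-1.
  have q0 : 0 < 4^-1 :> R by rewrite invr_gt0.
  have /cvgrPdist_le/(_ _ q0)[n0 _ /(_ n0 (leqnn _))] := sum0.
  rewrite /= sub0r normrN => h; exists n0; exact: le_trans (ler_norm _) h.
(* The additional iterate provides the smoothing: the measure to estimate is
   [iter n0 L (hconv rho nu)] with [nu = push T mu]. *)
exists n0 => mu mu0; rewrite iterSr.
set nu := push T mu; have tvnu : tv nu <= tv mu by exact: tv_push.
have nu0 : cint nu (fun=> 1) = 0 by rewrite push_mass; exact/mass0P.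
rewrite /L /transfer -/nu -/(transfer rho T) -/L.
pose s := push (step_map N) nu.
pose w (i : nat) := cint nu (\1_(step N @^-1` [set i%:R / N.+1%:R] : set RM)).
have bw (i : nat) : bmeas (\1_(step N @^-1` [set i%:R / N.+1%:R] : set RM) : RM -> R).
  apply: bmeas_indic.
  have m1 : measurable ([set i%:R / N.+1%:R] : set RM) by exact: measurable_set1.
  by have := @step_meas N measurableT [set i%:R / N.+1%:R] m1; rewrite setTI.
have w1 i : `|w i| <= tv nu.
  rewrite -[leRHS]mul1r; apply: cint_le => // x.
  by rewrite indicE; case: (_ \in _); rewrite ?normr1// normr0.
have injN (i j : nat) : i%:R / N.+1%:R = j%:R / N.+1%:R :> R -> i = j.
  move/(congr1 ( *%R^~ N.+1%:R)); rewrite !divfK ?pnatr_eq0//.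
  by move/eqP; rewrite eqr_nat => /eqP.
have sE g : bmeas g -> cint s g = \sum_(i < N.+2) w i * g (i%:R / N.+1%:R).
  move=> bg; rewrite /s cint_push//.
  transitivity (cint nu (fun x => \sum_(i < N.+2)
      g (i%:R / N.+1%:R) * \1_(step N @^-1` [set i%:R / N.+1%:R] : set RM) x)).
    apply: cint_eq_I01; first exact: bmeas_push.
      apply: (@bmeas_sum _ RM R N.+2 (fun i x => g (i%:R / N.+1%:R) *
         \1_(step N @^-1` [set i%:R / N.+1%:R] : set RM) x)) => i.
      exact: bmeasZ.
    move=> x xI; rewrite selfmap_extE//=; have [i xi] := step_val N x.
    rewrite (bigD1 i)//= indicE mem_set// mulr1 -xi big1 ?addr0// => j ji.
    rewrite indicE memNset ?mulr0//= xi => /injN ij.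
    by move/eqP: ji; apply; apply/val_inj.
  elim: N.+2 => [|n ih].
    under eq_fun do rewrite big_ord0.
    by rewrite big_ord0 cintE !fi_cst !mul0r subrr.
  under eq_fun do rewrite big_ord_recr/=.
  rewrite big_ord_recr/= -ih cintD; last 2 first.
  - apply: (@bmeas_sum _ RM R n (fun i x => g (i%:R / N.+1%:R) *
         \1_(step N @^-1` [set i%:R / N.+1%:R] : set RM) x)) => i.
    exact: bmeasZ.
  - exact: bmeasZ.
  by rewrite cintZ// mulrC.
(* Since the weights sum to zero, a point mass at 0 may be subtracted from each term, which turns
   the discretized measure into a combination of the [dir]. *)
have w0 : \sum_(i < N.+2) w i = 0.
  have := push_mass (step_map N) nu; rewrite -/s nu0 sE; last exact: bmeas_cst.
  by under eq_bigr do rewrite mulr1.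
have LLn : dual (iter n0 L \o hconv rho) _ :=
  dual_comp (dual_iter n0 LLt) (dual_hconv rho).
rewrite (_ : 2^-1 = 4^-1 + 4^-1 :> R); last by field.
apply: tv_le => t bt t1.
have -> : cint (iter n0 L (hconv rho nu)) t =
    cint (iter n0 L (hconv rho (bs_sub nu s))) t +
    cint (iter n0 L (hconv rho s)) t.
  by have := dual_cintB LLn nu s bt; rewrite /= => ->; rewrite subrK.
rewrite mulrDl lerD//.
  rewrite (le_trans (ler_norm _))// (le_trans (cint_le _ bt t1))// mul1r.
  rewrite (le_trans (tv_iter _ _ _))//; first by move=> ?; exact: tv_transfer.
  have [h _ _] := HC (bs_sub nu s); rewrite (le_trans h)//.
  rewrite (@le_trans _ _ (C * (N.+1%:R^-1 * tv nu)))//.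
    by rewrite ler_wpM2l// wn_step.
  by rewrite mulrA ler_pM ?tv_ge0// mulr_ge0.
have [] := LLn t bt; set G := (X in bmeas X) => bG eLt; rewrite /= in eLt.
rewrite eLt (sE _ bG).
have -> : \sum_(i < N.+2) w i * G (i%:R / N.+1%:R) =
    \sum_(i < N.+2) w i * cint (iter n0 L (hconv rho (dir (i%:R / N.+1%:R)))) t.
  transitivity (\sum_(i < N.+2) w i * (G (i%:R / N.+1%:R) - G 0)).
    under [RHS]eq_bigr do rewrite mulrBr.
    by rewrite sumrB -[X in _ = _ - X]mulr_suml w0 mul0r subr0.
  apply: eq_bigr => i _; rewrite eLt cint_dir//.
  by rewrite in_itv/= divr_ge0//= ler_pdivrMr// mul1r ler_nat -ltnS.
rewrite (@le_trans _ _ (4^-1 * tv nu)) ?ler_wpM2l ?invr_ge0//.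
rewrite (le_trans (ler_norm _))// (le_trans (ler_norm_sum _ _ _))//.
(* Bounding each weight by [tv nu] is enough, because [hn0] controls the sum over all grid
   points. *)
apply: le_trans (ler_wpM2r (tv_ge0 _) hn0); rewrite mulr_suml.
apply: ler_sum => i _; rewrite normrM mulrC ler_pM//.
by rewrite -[leRHS]mul1r cint_le.
Qed.

End uniform_mixing.
End mixing.

(** * The resolvent *)

Section bs_series.
Context {R : realType}.
Local Notation RM := (measurableTypeR R).
Implicit Types (g : RM -> R).

Lemma cvgn_eq (u v : nat -> R) (l : R) :
  u @ \oo --> l -> v =1 u -> v @ \oo --> l.
Proof. by move=> ul /funext ->. Qed.

Lemma limn_eq (u v : nat -> R) : u =1 v -> limn u = limn v.
Proof. by move=> /funext ->. Qed.

(** Bounded total masses make the series of measures finite; its restriction to [D] is then a finite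
    measure carried by [D], as a [bs] requires. *)
Lemma finite_measure_series (m_ : nat -> {finite_measure set RM -> \bar R})
    (D : set RM) (B : R) : measurable D ->
  (forall n, \sum_(k < n) fine (m_ k setT) <= B) ->
  exists m : {finite_measure set RM -> \bar R},
    (forall A, m A = m (A `&` D)) /\
    forall A, measurable A ->
      (\sum_(k < n) fine (m_ k (A `&` D))) @[n --> \oo] --> fine (m A).
Proof.
move=> mD mB; pose m0 : {measure set RM -> \bar R} := mseries m_ 0.
have partE n A : measurable A ->
    (\sum_(0 <= k < n) m_ k A)%E = (\sum_(k < n) fine (m_ k A))%:E.
  move=> mA; rewrite big_mkord -sumEFin; apply: eq_bigr => k _.
  by rewrite fineK// fin_num_measure.
have cv A : measurable A ->
    ((\sum_(k < n) fine (m_ k A))%:E @[n --> \oo] --> m0 A)%E.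
  move=> mA; under eq_fun do rewrite -partE//.
  exact: (@is_cvg_nneseries R (fun k => m_ k A) xpredT 0%N (fun k _ _ => measure_ge0 _ _)).
have leD A : measurable A -> (m0 A <= B%:E)%E.
  move=> mA; rewrite -(cvg_lim _ (cv A mA))//.
  apply: lime_le; first by apply/cvg_ex; eexists; exact: cv.
  apply: nearW => n /=; rewrite lee_fin (le_trans _ (mB n))//.
  apply: ler_sum => k _; rewrite fine_le ?fin_num_measure//.
  by rewrite le_measure ?inE.
have foo : (m0 D < +oo)%E by rewrite (le_lt_trans (leD _ mD))// ltry.
exists (mfrestr mD foo); split=> [A|A mA].
  by rewrite /= /mfrestr /mrestr -setIA setIid.
have mAD : measurable (A `&` D) by exact: measurableI.
have : ((\sum_(k < n) fine (m_ k (A `&` D)))%:E @[n --> \oo] --> m0 (A `&` D))%E.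
  exact: cv.
rewrite -(@fineK _ (m0 _)); last first.
  by rewrite ge0_fin_numE// (le_lt_trans (leD _ mAD))// ltry.
by move/fine_cvg.
Qed.

(** Summability in total variation lets the positive and the negative parts be summed separately as
    measures; [cint_functional] then passes from sets to bounded functions. *)
Lemma bs_series (F : nat -> bs R) (B : R) :
  (forall n, \sum_(k < n) tv (F k) <= B) ->
  exists S : bs R, forall g, bmeas g ->
    (\sum_(k < n) cint (F k) g) @[n --> \oo] --> cint S g.
Proof.
move=> FB.
have [|P [PI Pcv]] := @finite_measure_series (fun k => pos_part (F k)) I01 B (@measurable_I01 R).
  move=> n; rewrite (le_trans _ (FB n))//; apply: ler_sum => k _.
  by rewrite /tv lerDl fine_ge0.
have [|N [NI Ncv]] := @finite_measure_series (fun k => neg_part (F k)) I01 B (@measurable_I01 R).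
  move=> n; rewrite (le_trans _ (FB n))//; apply: ler_sum => k _.
  by rewrite /tv lerDr fine_ge0.
pose S0 : {charge set RM -> \bar R} := 
  cadd (charge_of_finite_measure P) (copp (charge_of_finite_measure N)).
have S0E A : S0 A = (P A - N A)%E by [].
have S0I A : measurable A -> S0 A = S0 (A `&` I01).
  by move=> mA; rewrite !S0E PI NI.
exists (Bs S0I).
have cvF g : bmeas g -> cvgn (fun n => \sum_(k < n) cint (F k) g).
  move=> bg; have [_ [K gK]] := bg.
  under eq_fun do rewrite -(big_mkord xpredT (fun k => cint (F k) g)).
  apply: (@normed_cvg R R (fun k => cint (F k) g)).
  apply: nondecreasing_is_cvgn.
    apply/nondecreasing_seqP => n.
    rewrite -[leLHS]/(series (fun k => `|cint (F k) g|) n).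
    by rewrite -[leRHS]/(series (fun k => `|cint (F k) g|) n.+1) seriesSr lerDl.
  exists (K * B) => _ [n _ <-].
  rewrite -[leLHS]/(series (fun k => `|cint (F k) g|) n) /series/= big_mkord.
  have K0 : 0 <= K by rewrite (le_trans _ (gK 0)).
  rewrite (@le_trans _ _ (K * \sum_(k < n) tv (F k)))//; last by rewrite ler_wpM2l.
  by rewrite mulr_sumr; apply: ler_sum => k _; exact: cint_le.
move=> g bg; suff -> : cint S0 g = limn (fun n => \sum_(k < n) cint (F k) g) by exact: cvF.
move: g bg; apply: (@cint_functional _ _ _ _
   (fun g => limn (fun n => \sum_(k < n) cint (F k) g)) B).
- move=> g h bg bh; rewrite -(limD (cvF _ bg) (cvF _ bh)).
  apply: limn_eq => n /=.
  transitivity (\sum_(k < n) cint (F k) g + \sum_(k < n) cint (F k) h) => //.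
  by rewrite -big_split/=; apply: eq_bigr => k _; rewrite cintD.
- move=> a g bg; rewrite -[RHS](limZl_tmp a (cvF _ bg)).
  apply: limn_eq => n /=.
  transitivity (a * \sum_(k < n) cint (F k) g) => //.
  by rewrite mulr_sumr; apply: eq_bigr => k _; rewrite cintZ.
- move=> g K bg gK; have K0 : 0 <= K by rewrite (le_trans _ (gK 0)).
  rewrite -(lim_norm (cvF _ bg)).
  apply: limr_le; first exact: is_cvg_norm (cvF _ bg).
  apply: nearW => n; rewrite (le_trans (ler_norm_sum _ _ _))//.
  rewrite (@le_trans _ _ (K * \sum_(k < n) tv (F k)))//.
    by rewrite mulr_sumr; apply: ler_sum => k _; exact: cint_le.
  by rewrite mulrC ler_wpM2r.
- move=> A mA; rewrite S0E.
  have mAI : measurable (A `&` I01) by exact: measurableI.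
  have : (\sum_(k < n) cint (F k) (\1_A)) @[n --> \oo] --> fine (P A) - fine (N A).
    apply: cvgn_eq (cvgB (Pcv A mA) (Ncv A mA)) _ => n /=.
    transitivity (\sum_(k < n) fine (pos_part (F k) (A `&` I01)) -
      \sum_(k < n) fine (neg_part (F k) (A `&` I01))) => //.
    rewrite -sumrB; apply: eq_bigr => k _.
    rewrite -fineB ?fin_num_measure//.
    by rewrite -charge_parts// -bs_supp// -cint_indic.
  move/cvg_lim => ->//.
  by rewrite EFinB !fineK ?fin_num_measure.
Qed.

End bs_series.

Section resolvent.
Context {R : realType}.
Local Notation RM := (measurableTypeR R).
Implicit Types (g : RM -> R) (mu nu : bs R).

(** The first [n0.+1] terms contribute at most [n0.+1] and the rest is half of a shorter sum of the
    same kind; [2 * n0.+1] is the fixed point of this recursion. *)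
Lemma geo_div_sum n0 n : \sum_(k < n) (2^-1 : R) ^+ (k %/ n0.+1) <= 2 * n0.+1%:R.
Proof.
have [m] := ubnP n; elim: m n => // m ih n; rewrite ltnS => nm.
have h1 k : (2^-1 : R) ^+ k <= 1 by rewrite exprn_ile1// ?invr_ge0// invf_le1// ler1n.
have [nn|nn] := leqP n n0.+1.
  rewrite (@le_trans _ _ (\sum_(k < n) 1))//; first exact: ler_sum.
  rewrite sumr_const card_ord; have : n%:R <= n0.+1%:R :> R by rewrite ler_nat.
  by have := ler0n R n0.+1; lra.
rewrite -(subnKC (ltnW nn)) big_split_ord/=.
have : \sum_(k < n0.+1) (2^-1 : R) ^+ (k %/ n0.+1) <= n0.+1%:R.
  rewrite (@le_trans _ _ (\sum_(k < n0.+1) 1))//; first exact: ler_sum.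
  by rewrite sumr_const card_ord.
have : \sum_(k < n - n0.+1) (2^-1 : R) ^+ ((n0.+1 + k) %/ n0.+1) <= n0.+1%:R.
  rewrite (eq_bigr (fun k : 'I__ => 2^-1 * (2^-1 : R) ^+ (k %/ n0.+1))); last first.
    by move=> k _; rewrite divnDl// divnn/= add1n exprS.
  rewrite -mulr_sumr; have := ih (n - n0.+1)%N.
  have -> : (n - n0.+1 < m)%N by rewrite (leq_trans _ nm)// ltn_subrL/= (leq_trans _ nn).
  by move=> /(_ isT); lra.
lra.
Qed.

Lemma geo_div_cvg n0 (c : R) :
  c * (2^-1 : R) ^+ (n %/ n0.+1) @[n --> \oo] --> (0 : R).
Proof.
rewrite -[X in _ --> X](mulr0 c); apply: cvgMl_tmp.
apply/cvgrPdist_le => e e0.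
have /cvgrPdist_le/(_ _ e0)[N _ HN] : ((2^-1 : R) ^+ n) @[n --> \oo] --> (0 : R).
  by apply: cvg_expr; rewrite ger0_norm ?invr_ge0// invf_lt1// ltr1n.
exists (N * n0.+1)%N => // n /= Nn; apply: HN => /=.
by rewrite leq_divRL.
Qed.

Section abstract.
Variables (L : bs R -> bs R) (Lt : (RM -> R) -> RM -> R) (n0 : nat).
Hypotheses (LLt : dual L Lt) (L_tv : forall mu, tv (L mu) <= tv mu).
Hypothesis L_mass : forall mu, cint (L mu) (fun=> 1) = cint mu (fun=> 1).
Hypothesis L_half : forall mu : bs R, mu I01 = 0%E ->
  tv (iter n0.+1 L mu) <= 2^-1 * tv mu.
Hypothesis L_L1 : forall mu, is_L1 (L mu).

Let mass0 mu : mu I01 = 0%E -> L mu I01 = 0%E.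
Proof. by move/mass0P => h; apply/mass0P; rewrite L_mass. Qed.

Let mass0_iter mu n : mu I01 = 0%E -> iter n L mu I01 = 0%E.
Proof. by move=> h; elim: n => //= n ih; exact: mass0. Qed.

(** Each full block of [n0.+1] iterates halves the total variation, and the remaining iterates do
    not increase it. *)
Lemma tv_iter_decay mu n : mu I01 = 0%E ->
  tv (iter n L mu) <= (2^-1) ^+ (n %/ n0.+1) * tv mu.
Proof.
move=> mu0; rewrite [in X in iter X](divn_eq n n0.+1) addnC iterD.
rewrite (le_trans (tv_iter _ _ L_tv))//.
elim: (n %/ n0.+1)%N => [|k ih]; first by rewrite mul0n/= expr0 mul1r.
rewrite mulSn iterD (le_trans (L_half (mass0_iter _ mu0)))//.
by rewrite exprS -mulrA ler_wpM2l// invr_ge0.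
Qed.

Let is_sum mu (S : bs R) := forall g, bmeas g ->
  (\sum_(k < n) cint (iter k L mu) g) @[n --> \oo] --> cint S g.

(** The sum is chosen through its integrals, hence determined only up to [bs_eq]. The default zero
    is never taken at mass zero, see [neumannP]. *)
Definition neumann mu : bs R :=
  if pselect (exists S, is_sum mu S) is left h then projT1 (cid h) else bs_zero.

Let c0 : R := 2 * n0.+1%:R.

Let sum_tv mu n : mu I01 = 0%E -> \sum_(k < n) tv (iter k L mu) <= c0 * tv mu.
Proof.
move=> mu0; rewrite (@le_trans _ _ (\sum_(k < n) (2^-1) ^+ (k %/ n0.+1) * tv mu))//.
  by apply: ler_sum => k _; exact: tv_iter_decay.
by rewrite -mulr_suml ler_wpM2r ?tv_ge0// geo_div_sum.
Qed.

Lemma neumannP mu g : mu I01 = 0%E -> bmeas g ->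
  (\sum_(k < n) cint (iter k L mu) g) @[n --> \oo] --> cint (neumann mu) g.
Proof.
move=> mu0; rewrite /neumann; case: pselect => [h|[]].
  exact: (projT2 (cid h)).
by apply: (bs_series (B := c0 * tv mu)) => n; exact: sum_tv.
Qed.

Lemma tv_neumann mu : mu I01 = 0%E -> tv (neumann mu) <= c0 * tv mu.
Proof.
move=> mu0; apply: tv_le => s bs s1; rewrite -(cvg_lim _ (neumannP mu0 bs))//.
apply: limr_le; first by apply/cvg_ex; eexists; exact: neumannP.
apply: nearW => n; rewrite (le_trans _ (sum_tv n mu0))//; apply: ler_sum => k _.
by rewrite (le_trans (ler_norm _))// -[leRHS]mul1r cint_le.
Qed.

(** Limits of real sequences are unique, so identities between sums of the series reduce to
    identities between partial sums. *)
Lemma neumann_unique mu nu : mu I01 = 0%E ->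
  (forall g, bmeas g ->
    (\sum_(k < n) cint (iter k L mu) g) @[n --> \oo] --> cint nu g) ->
  bs_eq (neumann mu) nu.
Proof.
move=> mu0 h; apply/bs_eqP => g bg.
by rewrite -(cvg_lim _ (neumannP mu0 bg))// -(cvg_lim _ (h g bg)).
Qed.

Lemma neumann_mass mu : mu I01 = 0%E -> neumann mu I01 = 0%E.
Proof.
move=> mu0; apply/mass0P; rewrite -(cvg_lim _ (neumannP mu0 (bmeas_cst 1)))//.
rewrite (@limn_eq _ _ (fun=> 0)) ?lim_cst// => n; rewrite big1// => k _.
by rewrite iter_mass//; exact/mass0P.
Qed.

Lemma neumann_L1 mu : is_L1 mu -> mu I01 = 0%E -> is_L1 (neumann mu).
Proof.
move=> L1 mu0; apply/is_L1P => A mA A0; rewrite -cint_indic//.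
rewrite -(cvg_lim _ (neumannP mu0 (bmeas_indic R mA)))//.
congr (_%:E); rewrite (@limn_eq _ _ (fun=> 0)) ?lim_cst// => n.
rewrite big1// => k _; apply: EFin_inj; rewrite cint_indic//.
have /is_L1P : is_L1 (iter k L mu) by case: k => [[|k] kn] /=; [|exact: L_L1].
exact.
Qed.

Lemma neumann_eq mu nu : mu I01 = 0%E -> bs_eq mu nu ->
  bs_eq (neumann mu) (neumann nu).
Proof.
move=> mu0 mn; have nu0 : nu I01 = 0%E by rewrite -mn.
apply: neumann_unique => // g bg; apply: cvgn_eq (neumannP nu0 bg) _ => n; apply: eq_bigr => k _.
by have /bs_eqP := dual_eq (dual_iter k LLt) mn; exact.
Qed.

Lemma mass0_lin a mu nu : mu I01 = 0%E -> nu I01 = 0%E ->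
  bs_add (bs_scale a mu) nu I01 = 0%E.
Proof. by move=> h1 h2; rewrite /= /cadd/= /cscale/= h1 h2 mule0 adde0. Qed.

Lemma neumann_lin a mu nu : mu I01 = 0%E -> nu I01 = 0%E ->
  bs_eq (neumann (bs_add (bs_scale a mu) nu))
        (bs_add (bs_scale a (neumann mu)) (neumann nu)).
Proof.
move=> mu0 nu0; apply: neumann_unique; first exact: mass0_lin.
move=> g bg; rewrite cint_bs_add// cint_bs_scale//.
apply: cvgn_eq (cvgD (cvgZl_tmp (k := a) (neumannP mu0 bg)) (neumannP nu0 bg)) _ => n /=.
transitivity (a * \sum_(k < n) cint (iter k L mu) g +
  \sum_(k < n) cint (iter k L nu) g) => //.
rewrite mulr_sumr -big_split/=; apply: eq_bigr => k _.
by rewrite (dual_cintD (dual_iter k LLt))// (dual_cintZ (dual_iter k LLt)).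
Qed.

Lemma neumann_shift mu : mu I01 = 0%E ->
  bs_eq (neumann mu) (bs_add mu (neumann (L mu))).
Proof.
move=> mu0; apply: neumann_unique => // g bg.
rewrite cint_bs_add// -cvg_shiftS /=.
apply: cvgn_eq (cvgD (cvg_cst (cint mu g)) (neumannP (mass0 mu0) bg)) _ => n /=.
by rewrite big_ord_recl/=; congr (_ + _); apply: eq_bigr => k _; rewrite -iterSr.
Qed.

(** Testing [L] of the sum against [g] is testing the sum against the adjoint [Lt g], which is
    bounded and measurable too. *)
Lemma neumann_comm mu : mu I01 = 0%E -> bs_eq (neumann (L mu)) (L (neumann mu)).
Proof.
move=> mu0; apply: neumann_unique; first exact: mass0.
move=> g bg; have [bLg eL] := LLt bg; rewrite eL.
apply: cvgn_eq (neumannP mu0 bLg) _ => n /=; apply: eq_bigr => k _.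
by rewrite -iterSr/= eL.
Qed.

(** Writing the remainder as the whole sum applied to [iter n L mu] lets the decay of the iterates
    give convergence in operator norm. *)
Lemma neumann_tail mu n : mu I01 = 0%E ->
  bs_eq (bs_sub (neumann mu) (bs_sum (fun k => iter k L mu) n))
        (neumann (iter n L mu)).
Proof.
move=> mu0; elim: n => [|n ih].
  apply/bs_eqP => g bg; rewrite cint_bs_sub// (cint_bs_sum _ 0 bg) big_ord0.
  by rewrite subr0.
have mn := mass0_iter n mu0.
have /bs_eqP h := neumann_shift mn; have /bs_eqP {}ih := ih.
apply/bs_eqP => g bg; have := ih g bg; rewrite h// !cint_bs_sub// cint_bs_add//.
by rewrite !cint_bs_sum// big_ord_recr/= => e; rewrite opprD addrA e; ring.
Qed.

Lemma neumann_inv mu : mu I01 = 0%E ->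
  bs_eq (bs_sub (neumann mu) (L (neumann mu))) mu /\
  bs_eq (neumann (bs_sub mu (L mu))) mu.
Proof.
move=> mu0.
have /bs_eqP h1 := neumann_shift mu0; have /bs_eqP h2 := neumann_comm mu0.
split; apply/bs_eqP => g bg.
  by rewrite cint_bs_sub// -h2// h1// cint_bs_add//; ring.
have sub0 : bs_sub mu (L mu) I01 = 0%E.
  by apply/mass0P; rewrite cint_bs_sub ?L_mass ?subrr//; exact: bmeas_cst.
have e : bs_eq (bs_sub mu (L mu)) (bs_add (bs_scale (-1) (L mu)) mu).
  by apply/bs_eqP => f bf; rewrite cint_bs_sub// cint_bs_add// cint_bs_scale//; ring.
have /bs_eqP -> // := neumann_eq sub0 e.
have /bs_eqP -> // := neumann_lin (-1) (mass0 mu0) mu0.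
by rewrite cint_bs_add// cint_bs_scale// h1// cint_bs_add//; ring.
Qed.

Lemma squeeze_ereal0 (T : Type) (F : set_system T) (FF : Filter F)
  (u : T -> \bar R) (v : T -> R) :
  (\forall t \near F, (0 <= u t <= (v t)%:E)%E) -> v @ F --> (0 : R) -> u @ F --> 0%E.
Proof.
move=> uv v0; apply: (@squeeze_cvge _ _ _ _ (fun=> 0%E) _ (EFin \o v)) => //.
  exact: cvg_cst.
by apply: cvg_EFin => //; exact: nearW.
Qed.

Lemma op_norm_le (V : set (bs R)) N A (c : R) :
  (forall mu, V mu -> (N mu <= 1)%E -> (N (A mu) <= c%:E)%E) ->
  (op_norm V N A <= c%:E)%E.
Proof. by move=> h; apply: ub_ereal_sup => _ [mu [Vmu Nmu] <-]; exact: h. Qed.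

Lemma op_norm_ge0 (V : set (bs R)) N A : V bs_zero -> (N bs_zero <= 1)%E ->
  (0 <= N (A bs_zero))%E -> (0 <= op_norm V N A)%E.
Proof.
move=> V0 N0 /le_trans; apply; apply: ereal_sup_ubound.
by exists bs_zero.
Qed.

Lemma tv_bs_zero : tv (@bs_zero R) = 0.
Proof.
apply/eqP; rewrite eq_le tv_ge0 andbT.
by apply: tv_le => s bs _; rewrite cint_bs_zero.
Qed.

Lemma neumann_resolvent_L1 : is_resolvent V_space norm1 L neumann.
Proof.
have z0 : V_space (@bs_zero R) by split=> //; exact: is_L1_zero.
have nz : (norm1 (@bs_zero R) <= 1)%E.
  by rewrite norm1E ?tv_bs_zero ?lee01//; exact: is_L1_zero.
have c0_ge0 : 0 <= c0 by rewrite mulr_ge0.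
split.
- by move=> mu [L1 mu0]; split; [exact: neumann_L1|exact: neumann_mass].
- by move=> a mu nu [_ mu0] [_ nu0]; exact: neumann_lin.
- apply: (@le_lt_trans _ _ c0%:E); last exact: ltry.
  apply: op_norm_le => mu [L1 mu0]; rewrite norm1E// lee_fin => tv1.
  rewrite norm1E; last exact: neumann_L1.
  by rewrite lee_fin (le_trans (tv_neumann mu0))// -[leRHS]mulr1 ler_wpM2l.
- apply: (@squeeze_ereal0 _ _ _ _ (fun n => c0 * (2^-1) ^+ (n %/ n0.+1))); last first.
    exact: geo_div_cvg.
  have L1s mu n : V_space mu ->
      is_L1 (bs_sub (neumann mu) (bs_sum (fun k => iter k L mu) n)).
    move=> [L1 mu0]; apply: is_L1_sub; first exact: neumann_L1.
    by apply: is_L1_sum => -[|k] //=; exact: L_L1.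
  apply: nearW => n; apply/andP; split.
    by apply: op_norm_ge0 => //; rewrite norm1E ?lee_fin ?tv_ge0//; exact: L1s.
  apply: op_norm_le => mu Vmu; have [L1 mu0] := Vmu.
  rewrite norm1E// lee_fin => tv1; rewrite norm1E; last exact: L1s.
  rewrite lee_fin (tv_bs_eq (neumann_tail n mu0)).
  rewrite (le_trans (tv_neumann (mass0_iter n mu0)))// ler_wpM2l//.
  rewrite (le_trans (tv_iter_decay n mu0))// -[leRHS]mulr1.
  by apply: ler_wpM2l => //; rewrite exprn_ge0// invr_ge0.
- by move=> mu [_ mu0]; exact: neumann_inv.
Qed.

(** The Wasserstein norm does not bound the total variation, so one [L] is spent to pass from the
    former to the latter: the norm is estimated on mu + N (L mu), where only the second term has to
    be summed. *)
Lemma neumann_resolvent_W (C : R) : (forall mu, tv (L mu) <= C * wn mu) ->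
  is_resolvent VW_space wnorm L neumann.
Proof.
move=> LC.
have z0 : VW_space (@bs_zero R) by [].
have c0_ge0 : 0 <= c0 by rewrite mulr_ge0.
have wz : wn (@bs_zero R) <= 1 by rewrite (le_trans (wn_le_tv _))// tv_bs_zero.
have tvL mu : wn mu <= 1 -> tv (L mu) <= `|C|.
  move=> w1; rewrite (le_trans (LC mu))// (@le_trans _ _ (`|C| * wn mu))//.
    by rewrite ler_wpM2r ?wn_ge0// ler_norm.
  by rewrite -[leRHS]mulr1 ler_wpM2l.
split.
- by move=> mu; exact: neumann_mass.
- by move=> a mu nu; exact: neumann_lin.
- apply: (@le_lt_trans _ _ (1 + c0 * `|C|)%:E); last exact: ltry.
  apply: op_norm_le => mu mu0; rewrite wnormE lee_fin => w1.
  rewrite wnormE lee_fin (wn_bs_eq (neumann_shift mu0)).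
  rewrite (le_trans (wn_bs_add _ _))// lerD// (le_trans (wn_le_tv _))//.
  by rewrite (le_trans (tv_neumann (mass0 mu0)))// ler_wpM2l// tvL.
(* Starting at index 1 guarantees that at least one [L] has acted on the remainder. *)
- rewrite -cvg_shiftS /=.
  apply: (@squeeze_ereal0 _ _ _ _ (fun n => (c0 * `|C|) * (2^-1) ^+ (n %/ n0.+1))); last first.
    exact: geo_div_cvg.
  apply: nearW => n; apply/andP; split.
    by apply: op_norm_ge0; rewrite ?wnormE ?lee_fin ?wn_ge0.
  apply: op_norm_le => mu mu0; rewrite wnormE lee_fin => w1.
  rewrite wnormE lee_fin (wn_bs_eq (neumann_tail n.+1 mu0)) (le_trans (wn_le_tv _))//.
  rewrite (le_trans (tv_neumann (mass0_iter n.+1 mu0)))// -mulrA ler_wpM2l//.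
  rewrite iterSr (le_trans (tv_iter_decay n (mass0 mu0)))// (mulrC `|C|).
  by apply: ler_wpM2l; [rewrite exprn_ge0// invr_ge0|exact: tvL].
- by move=> mu mu0; exact: neumann_inv.
Qed.

(* The properties of [neumann] are bundled so that clients handle an opaque
   variable instead of the constant. *)
Record neumann_spec (B : R) (N : bs R -> bs R) : Prop := NeumannSpec {
  spec_eq : forall mu nu, mu I01 = 0%E -> bs_eq mu nu -> bs_eq (N mu) (N nu) ;
  spec_lin : forall a mu nu, mu I01 = 0%E -> nu I01 = 0%E ->
    bs_eq (N (bs_add (bs_scale a mu) nu)) (bs_add (bs_scale a (N mu)) (N nu)) ;
  spec_tv : forall mu, mu I01 = 0%E -> tv (N mu) <= B * tv mu ;
  spec_shift : forall mu, mu I01 = 0%E -> bs_eq (N mu) (bs_add mu (N (L mu))) ;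
  spec_inv : forall mu, mu I01 = 0%E -> bs_eq (N (bs_sub mu (L mu))) mu ;
  spec_L1 : forall mu, is_L1 mu -> mu I01 = 0%E -> is_L1 (N mu) ;
  spec_resolvent_L1 : is_resolvent V_space norm1 L N ;
  spec_resolvent_W : forall C : R, (forall mu, tv (L mu) <= C * wn mu) ->
    is_resolvent VW_space wnorm L N }.

Lemma neumann_exists : exists N, neumann_spec c0 N.
Proof.
exists neumann; split.
- exact: neumann_eq.
- exact: neumann_lin.
- exact: tv_neumann.
- exact: neumann_shift.
- by move=> mu /neumann_inv[].
- exact: neumann_L1.
- exact: neumann_resolvent_L1.
- exact: neumann_resolvent_W.
Qed.

End abstract.
End resolvent.

(** * Perturbing the noise *)

Section perturbation.
Context {R : realType}.
Local Notation RM := (measurableTypeR R).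
Implicit Types (g : RM -> R) (mu nu eta h : bs R).
Variables (L : bs R -> bs R) (B : R) (N : bs R -> bs R).
Hypothesis L_mass : forall mu, cint (L mu) (fun=> 1) = cint mu (fun=> 1).
Hypotheses (B_ge0 : 0 <= B) (HN : neumann_spec L B N).

Lemma mass0_scale_sub a eta h : eta I01 = 0%E -> h I01 = 0%E ->
  bs_sub (bs_scale a eta) h I01 = 0%E.
Proof.
move=> /mass0P eta0 /mass0P h0; have b1 := @bmeas_cst _ RM R 1.
by apply/mass0P; rewrite cint_bs_sub// cint_bs_scale// eta0 h0 mulr0 subrr.
Qed.

(** The last hypothesis is (Id - L) mu = eta in tested form; [spec_inv] inverts it. *)
Lemma neumann_perturb mu eta : mu I01 = 0%E -> eta I01 = 0%E ->
  (forall g, bmeas g -> cint mu g = cint (L mu) g + cint eta g) ->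
  bs_eq mu (N eta).
Proof.
move=> mu0 eta0 h.
have sub0 : bs_sub mu (L mu) I01 = 0%E.
  by apply/mass0P; rewrite cint_bs_sub ?L_mass ?subrr//; exact: bmeas_cst.
apply: bs_eq_trans (bs_eq_sym (spec_inv HN mu0)) _.
apply: (spec_eq HN) => //.
by apply/bs_eqP => g bg; rewrite cint_bs_sub// (h g bg); ring.
Qed.

(** [spec_lin] only knows combinations of the form a mu + nu, so -h is encoded as (-1) h + 0, and
    the value of [N] at zero has to be computed first. *)
Lemma neumann_sub a eta h : eta I01 = 0%E -> h I01 = 0%E ->
  bs_eq (bs_sub (bs_scale a (N eta)) (N h)) (N (bs_sub (bs_scale a eta) h)).
Proof.
move=> eta0 h0; have H := spec_lin HN.
have z0 : @bs_zero R I01 = 0%E by [].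
have Nz g : bmeas g -> cint (N bs_zero) g = 0.
  move=> bg; have /bs_eqP/(_ g bg) := H 1 _ _ z0 z0.
  rewrite cint_bs_add// cint_bs_scale// mul1r.
  suff -> : cint (N (bs_add (bs_scale 1 bs_zero) bs_zero)) g =
            cint (N bs_zero) g by lra.
  have e : bs_eq (bs_add (bs_scale 1 bs_zero) bs_zero) (@bs_zero R).
    apply/bs_eqP => k bk; rewrite cint_bs_add// cint_bs_scale// cint_bs_zero//.
    by rewrite mulr0 addr0.
  by have /bs_eqP/(_ g bg) := spec_eq HN (mass0_lin 1 z0 z0) e.
pose h' := bs_add (bs_scale (-1) h) bs_zero.
have h'0 : h' I01 = 0%E by exact: mass0_lin.
have e : bs_eq (bs_add (bs_scale a eta) h') (bs_sub (bs_scale a eta) h).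
  apply/bs_eqP => g bg; rewrite cint_bs_sub// !cint_bs_add// !cint_bs_scale//.
  by rewrite cint_bs_zero//; ring.
have s0 : bs_add (bs_scale a eta) h' I01 = 0%E by exact: mass0_lin.
have /bs_eqP e1 := spec_eq HN s0 e.
have /bs_eqP e2 := H a _ _ eta0 h'0; have /bs_eqP e3 := H (-1) _ _ h0 z0.
apply/bs_eqP => g bg.
have aux (l x y r h1 z s : R) : l = x - y -> r = x + h1 -> h1 = s + z ->
    s = -1 * y -> z = 0 -> l = r.
  by move=> -> -> -> -> ->; ring.
apply: (aux _ _ _ _ _ _ _ (cint_bs_sub (bs_scale a (N eta)) (N h) bg)
  _ _ (cint_bs_scale (-1) (N h) bg) (Nz g bg)).
  rewrite -(e1 g bg) (e2 g bg).
  exact: (cint_bs_add (bs_scale a (N eta)) (N h') bg).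
rewrite (e3 g bg).
exact: (cint_bs_add (bs_scale (-1) (N h)) (N bs_zero) bg).
Qed.

Lemma neumann_perturb_sub a mu eta h : mu I01 = 0%E -> eta I01 = 0%E ->
  h I01 = 0%E ->
  (forall g, bmeas g -> cint mu g = cint (L mu) g + cint eta g) ->
  bs_eq (bs_sub (bs_scale a mu) (N h)) (N (bs_sub (bs_scale a eta) h)).
Proof.
move=> mu0 eta0 h0 muE; apply: bs_eq_trans (neumann_sub a eta0 h0).
have /bs_eqP mu_eq := neumann_perturb mu0 eta0 muE.
by apply/bs_eqP => g bg; rewrite !cint_bs_sub// !cint_bs_scale// (mu_eq g bg).
Qed.

(** In N mu = mu + N (L mu) the first term gives 1; in the second, [L] passes to total variation at
    cost [C] and [N] costs [B]. *)
Lemma wn_neumann (C : R) mu : 0 <= C -> (forall nu, tv (L nu) <= C * wn nu) ->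
  mu I01 = 0%E -> wn (N mu) <= (1 + B * C) * wn mu.
Proof.
move=> C0 LC mu0; rewrite (wn_bs_eq (spec_shift HN mu0)).
rewrite (le_trans (wn_bs_add _ _))// mulrDl mul1r lerD// (le_trans (wn_le_tv _))//.
have Lmu0 : L mu I01 = 0%E by apply/mass0P; rewrite L_mass; exact/mass0P.
by rewrite (le_trans (spec_tv HN Lmu0))// -[leRHS]mulrA ler_wpM2l.
Qed.

End perturbation.

Section response_noise.
Context {R : realType}.
Local Notation RM := (measurableTypeR R).
Implicit Types (g : RM -> R) (mu nu : bs R).
Variables (xibar : R) (rho : R -> bs R) (T0 : borel_selfmap R) (f0 : bs R).
Hypotheses (xibar_gt0 : 0 < xibar).
Hypothesis rho_density : forall xi : R, 0 <= xi < xibar ->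
  is_BV (rho xi) /\ is_probability (rho xi).
Hypothesis mixing : forall g : bs R, is_BV g -> g I01 = 0%E ->
  norm1 (iter n (transfer (rho 0) T0) g) @[n --> \oo] --> 0%E.
Hypotheses (f0_probability : is_probability f0)
  (f0_fixed : bs_eq (transfer (rho 0) T0 f0) f0).
Variables (C : R) (rhodot : bs R) (f : R -> bs R).
Hypothesis T0_lip : [lipschitz T0 x | x in I01].
Hypothesis rho_lip : forall xi : R, 0 <= xi < xibar ->
  (norm1 (bs_sub (rho xi) (rho 0%R)) <= (C * xi)%:E)%E.
Hypothesis rho_diff :
  wnorm (bs_sub (bs_scale xi^-1 (bs_sub (rho xi) (rho 0))) rhodot)
    @[xi --> 0^'+] --> 0%E.
Hypothesis f_fixed : forall xi : R, 0 <= xi < xibar ->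
  is_probability (f xi) /\ bs_eq (transfer (rho xi) T0 (f xi)) (f xi).

Let L := transfer (rho 0) T0.

Lemma BV_L1 mu : is_BV mu -> is_L1 mu.
Proof. by rewrite /is_BV /bvnorm; case: asboolP. Qed.

Let rho00 : is_BV (rho 0) /\ is_probability (rho 0).
Proof. by apply: rho_density; rewrite lexx. Qed.

Let near_xibar : \forall xi \near 0^'+, 0 < xi < xibar.
Proof.
near=> xi; apply/andP; split; first by near: xi; exact: nbhs_right_gt.
by near: xi; exact: nbhs_right_lt.
Unshelve. all: by end_near. Qed.

Let wn_diff : wn (bs_sub (bs_scale xi^-1 (bs_sub (rho xi) (rho 0))) rhodot)
  @[xi --> 0^'+] --> (0 : R).
Proof. exact: fine_cvg rho_diff. Qed.

(** The constant 1 is a Wasserstein test function and the difference quotients have mass zero, so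
    the mass of [rhodot] is bounded by a quantity tending to 0. *)
Lemma rhodot_mass : cint rhodot (fun=> 1) = 0.
Proof.
apply/eqP; rewrite -normr_le0.
have l1 : @lip1 R (fun=> 1) by split=> [x|x y]; rewrite ?normr1// subrr normr0.
have b1 : bmeas (fun=> 1 : R) := @bmeas_cst _ RM R 1.
apply: (cvgr_to_ge wn_diff).
near=> xi; have xiI : 0 < xi < xibar by near: xi; exact: near_xibar.
have /andP[xi0 xi1] := xiI.
have xiI' : 0 <= xi < xibar by rewrite (ltW xi0).
have [_ p1] := rho_density xiI'.
have [_ p0] := rho00.
have := cint_lip1 (bs_sub (bs_scale xi^-1 (bs_sub (rho xi) (rho 0))) rhodot) l1.
rewrite cint_bs_sub// cint_bs_scale// cint_bs_sub// (probability_mass p1) (probability_mass p0).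
by rewrite subrr mulr0 sub0r normrN.
Unshelve. all: by end_near. Qed.

Lemma response_noise : exists R1 : bs R -> bs R,
  [/\ is_resolvent VW_space wnorm (transfer (rho 0) T0) R1,
      VW_space (hconv rhodot (push T0 f0)) &
      wnorm (bs_sub (bs_scale xi^-1 (bs_sub (f xi) f0))
                    (R1 (hconv rhodot (push T0 f0))))
        @[xi --> 0^'+] --> 0%E].
Proof.
have [BV0 p0] := rho00.
have [Lt LLt] := dual_transfer (rho 0) T0.
have [n0 L_half] := uniform_mixing BV0 p0 mixing.
have L_tv nu : tv (L nu) <= tv nu by exact: tv_transfer.
have L_mass nu : cint (L nu) (fun=> 1) = cint nu (fun=> 1) by exact: transfer_mass.
have [C1 C1_ge0 HC] := noise_props BV0.
have L_L1 nu : is_L1 (L nu) by have [] := HC (push T0 nu).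
(* The Lipschitz hypothesis speaks of all constants above some [M], hence [M + 1]; the maximum with
   1 is for [wn_push]. *)
have [k k1 Tk] : exists2 k : R, 1 <= k & k.-lipschitz_I01 T0.
  have [M [_ HM]] := T0_lip; exists (Num.max 1 (M + 1)).
    by rewrite le_max lexx.
  by apply: HM; rewrite lt_max ltrDl ltr01 orbT.
have LC nu : tv (L nu) <= C1 * k * wn nu.
  have [h _ _] := HC (push T0 nu); apply: (le_trans h); rewrite -mulrA.
  by apply: (ler_wpM2l C1_ge0); exact: wn_push.
have C1k : 0 <= C1 * k by rewrite mulr_ge0// (le_trans ler01).
have W0 mu : hconv rhodot mu I01 = 0%E.
  by apply/mass0P; rewrite hconv_mass rhodot_mass mul0r.
have [N HN] := neumann_exists LLt L_tv L_mass L_half L_L1.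
set B := 2 * n0.+1%:R in HN; have B_ge0 : 0 <= B by rewrite mulr_ge0.
exists N; split.
- exact: (spec_resolvent_W HN LC).
- exact: W0.
set h := hconv rhodot (push T0 f0).
set Q := 1 + B * (C1 * k).
have Q0 : 0 <= Q by rewrite addr_ge0// mulr_ge0.
pose e xi := wn (bs_sub (bs_scale xi^-1 (bs_sub (rho xi) (rho 0))) rhodot).
(* [Q] bounds [N] in the Wasserstein norm, [e xi] is the error of the difference quotient of the
   noise, and the last term is the cost of replacing [f xi] by [f0]. *)
pose v xi := Q * (e xi + tv rhodot * (B * C * xi)).
apply: (@squeeze_ereal0 _ _ _ _ _ v); last first.
  rewrite -[X in _ --> X](_ : Q * (0 + tv rhodot * (B * C * 0)) = 0); last by ring.
  apply: cvgMl_tmp; apply: cvgD; first exact: wn_diff.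
  do 2 apply: cvgMl_tmp; apply: cvg_at_right_filter; exact: cvg_id.
near=> xi; have xiI : 0 < xi < xibar by near: xi; exact: near_xibar.
have /andP[xi0 xi1] := xiI; have xiI' : 0 <= xi < xibar by rewrite (ltW xi0).
rewrite wnorm_ge0/= wnormE lee_fin.
have [fp ff] := f_fixed xiI'; have [BVx px] := rho_density xiI'.
pose mu := bs_sub (f xi) f0; pose drho := bs_sub (rho xi) (rho 0).
pose eta := hconv drho (push T0 (f xi)).
have b1 := @bmeas_cst _ RM R 1.
have mu0 : mu I01 = 0%E.
  apply/mass0P; rewrite cint_bs_sub//.
  by rewrite (probability_mass fp) (probability_mass f0_probability) subrr.
have eta0 : eta I01 = 0%E.
  apply/mass0P; rewrite hconv_mass cint_bs_sub//.
  by rewrite (probability_mass px) (probability_mass p0) subrr mul0r.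
have cint_hconvB g r1 r2 nu : bmeas g -> cint (hconv (bs_sub r1 r2) nu) g =
    cint (hconv r1 nu) g - cint (hconv r2 nu) g.
  move=> bg; rewrite !cint_hconv12// cint_bs_sub//; exact: bmeas_hconv2.
have muE g : bmeas g -> cint mu g = cint (L mu) g + cint eta g.
  move=> bg.
  have e1 : cint (L mu) g = cint (L (f xi)) g - cint (L f0) g.
    exact: (dual_cintB LLt (f xi) f0 bg).
  have e2 : cint eta g =
      cint (transfer (rho xi) T0 (f xi)) g - cint (L (f xi)) g.
    exact: (cint_hconvB g (rho xi) (rho 0) (push T0 (f xi)) bg).
  have e3 : cint mu g = cint (f xi) g - cint f0 g by exact: cint_bs_sub.
  have /bs_eqP/(_ g bg) e4 := ff; have /bs_eqP/(_ g bg) e5 := f0_fixed.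
  have aux (m lm et x y lx ly z : R) : m = x - y -> lm = lx - ly ->
      et = z - lx -> z = x -> ly = y -> m = lm + et.
    by move=> -> -> -> -> ->; ring.
  exact: aux e3 e1 e2 e4 e5.
have mu_eq := neumann_perturb L_mass HN mu0 eta0 muE.
have tvp nu : is_probability nu -> tv (push T0 nu) <= 1.
  by move=> /is_probabilityP <-; exact: tv_push.
(* The a priori bound: the resolvent is applied to a forcing term of total variation at most
   [C * xi]. *)
have tv_mu : tv mu <= B * C * xi.
  rewrite (tv_bs_eq mu_eq) (le_trans (spec_tv HN eta0))//.
  rewrite -[leRHS]mulrA ler_wpM2l ?mulr_ge0//.
  rewrite (le_trans (tv_hconv _ _))//.
  rewrite (@le_trans _ _ (tv drho))//.
    by rewrite -[leRHS]mulr1 ler_wpM2l ?tv_ge0// tvp.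
  have Ld : is_L1 drho by apply: is_L1_sub; exact: BV_L1.
  by have := rho_lip xiI'; rewrite norm1E// lee_fin.
have h0 := W0 (push T0 f0); rewrite -/h in h0.
rewrite (wn_bs_eq (neumann_perturb_sub L_mass HN xi^-1 mu0 eta0 h0 muE)).
have arg0 := mass0_scale_sub xi^-1 eta0 h0.
rewrite (le_trans (wn_neumann L_mass B_ge0 HN C1k LC arg0))//.
rewrite /v ler_wpM2l//.
pose D := bs_sub (bs_scale xi^-1 drho) rhodot.
(* The first summand carries the error of the difference quotient with [f xi] kept; the second
   carries [f xi - f0] against the limit [rhodot]. *)
have -> : wn (bs_sub (bs_scale xi^-1 eta) h) =
    wn (bs_add (hconv D (push T0 (f xi))) (hconv rhodot (push T0 mu))).
  apply: wn_bs_eq; apply/bs_eqP => g bg.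
  have e1 := cint_bs_sub (bs_scale xi^-1 eta) h bg.
  have e2 := cint_bs_scale xi^-1 eta bg.
  have e3 := cint_bs_add (hconv D (push T0 (f xi))) (hconv rhodot (push T0 mu)) bg.
  have e4 : cint (hconv rhodot (push T0 mu)) g =
      cint (hconv rhodot (push T0 (f xi))) g - cint h g.
    exact: (dual_cintB (dual_comp (dual_hconv rhodot) (dual_push T0)) (f xi) f0 bg).
  have e5 := cint_hconvB g (bs_scale xi^-1 drho) rhodot (push T0 (f xi)) bg.
  have e6 : cint (hconv (bs_scale xi^-1 drho) (push T0 (f xi))) g =
     xi^-1 * cint eta g.
    rewrite !(cint_hconv12 _ _ bg).
    exact: (cint_bs_scale xi^-1 drho (bmeas_hconv2 (push T0 (f xi)) bg)).
  have aux (l el he s p q r : R) :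
      l = el - he -> s = p + q -> q = r - he -> p = el - r -> l = s.
    by move=> -> -> -> ->; ring.
  exact: (aux _ _ _ _ _ _ _ (etrans e1 (congr1 (fun z => z - cint h g) e2)) e3 e4
    (etrans e5 (congr1 (fun z => z - _) e6))).
rewrite (le_trans (wn_bs_add _ _))// lerD//.
  rewrite (le_trans (wn_hconv _ _))// -[leRHS]mulr1 ler_wpM2l ?wn_ge0// tvp//.
rewrite (le_trans (wn_le_tv _))// (le_trans (tv_hconv _ _))//.
by rewrite ler_wpM2l ?tv_ge0// (le_trans (tv_push _ _)).
Unshelve. all: by end_near. Qed.

End response_noise.

(** * Deforming a measure of bounded variation *)

Section step_functions.
Context {R : realType}.
Local Notation RM := (measurableTypeR R).
Implicit Types (g h w : RM -> R).

(** Written as a function of [y - x], so that joint measurability in both variables follows by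
    composition. *)
Definition lt01 (x y : R) : R := \1_(`]0, +oo[%classic : set RM) (y - x).

Lemma lt01E x y : lt01 x y = (x < y)%R%:R.
Proof.
rewrite /lt01 indicE; congr (nat_of_bool _)%:R.
by apply/idP/idP; rewrite inE/= in_itv/= andbT subr_gt0.
Qed.

Lemma bmeas_lt01 d (T : measurableType d) (f h : T -> RM) :
  measurable_fun setT f -> measurable_fun setT h ->
  bmeas (fun z => lt01 (f z) (h z)).
Proof.
move=> mf mh; apply: (@bmeas_comp _ _ _ _ _ (fun z => (h z : R) - f z : RM)).
  exact: measurable_funB.
by apply: bmeas_indic; exact: measurable_itv.
Qed.

Lemma bmeas_lt01l c : bmeas (fun x : RM => lt01 x c).
Proof. exact: bmeas_lt01. Qed.

Lemma bmeas_lt01r c : bmeas (fun x : RM => lt01 c x).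
Proof. exact: bmeas_lt01. Qed.

Lemma ib_0 c d g : bmeas g -> c <= d -> (forall x, c < x < d -> g x = 0) ->
  ib c d g = 0.
Proof.
move=> bg cd g0; rewrite (@ib_eq_oo _ _ _ _ (fun=> 0))//; last exact: bmeas_cst.
by rewrite ib_cst// mul0r.
Qed.

Lemma ib_upper c d e g h : bmeas g -> bmeas h -> c <= e -> e <= d ->
  (forall x, c < x < e -> h x = 0) -> (forall x, e < x < d -> h x = 1) ->
  ib c d (fun x => g x * h x) = ib e d g.
Proof.
move=> bg bh ce ed h0 h1; have bgh := bmeasM bg bh.
rewrite (ib_split bgh ce ed) ib_0// ?add0r; last by move=> x /h0 ->; rewrite mulr0.
by apply: ib_eq_oo => // x /h1 ->; rewrite mulr1.
Qed.

Lemma ib_lt01l c d e g : bmeas g -> c <= e -> e <= d ->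
  ib c d (fun x => g x * lt01 x e) = ib c e g.
Proof.
move=> bg ce ed; have bgh := bmeasM bg (bmeas_lt01l e).
rewrite (ib_split bgh ce ed) [X in _ + X]ib_0// ?addr0; last first.
  by move=> x /andP[ex _]; rewrite lt01E ltNge (ltW ex) mulr0.
by apply: ib_eq_oo => // x /andP[_ xe]; rewrite lt01E xe mulr1.
Qed.

End step_functions.

(** * Quantile functions and the layer-cake formula *)

Section quantile.
Context {R : realType}.
Local Notation RM := (measurableTypeR R).
Implicit Types (g w phi : RM -> R).
Variables (al : R -> R) (M : R).
Hypothesis nd_al : nd_bounded al M.

Let M_ge0 : 0 <= M.
Proof. by have [_ h] := nd_al; have /andP[h1 h2] := h 0; exact: le_trans h2. Qed.

(** The point 1 is added to keep the infimum in [0, 1] even for levels that [al] does not exceed on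
    [0, 1]. *)
Let level (t : R) := [set x : R | 0 <= x <= 1 /\ t < al x] `|` [set 1].

Definition quantile (t : R) : R := inf (level t).

Let level_lb t : has_inf (level t).
Proof.
split; first by exists 1; right.
by exists 0 => x [[/andP[]]//|->].
Qed.

Lemma quantile_in t : 0 <= quantile t <= 1.
Proof.
apply/andP; split.
  by apply: lb_le_inf; [exists 1; right|move=> x [[/andP[]]//|->]].
by apply: ge_inf; [exact: (level_lb t).2|right].
Qed.

Lemma quantile_gt t x : quantile t < x <= 1 -> t < al x.
Proof.
move=> /andP[qx x1]; have [y [[yI ty]|->] yx] := inf_lt (level_lb t).1 qx.
  by rewrite (lt_le_trans ty)// nd_al.1// ltW.
by move: (lt_le_trans yx x1); rewrite ltxx.
Qed.

Lemma quantile_lt t x : 0 <= x < quantile t -> al x <= t.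
Proof.
move=> /andP[x0 xq]; rewrite leNgt; apply/negP => tx.
have /andP[_ q1] := quantile_in t.
move: xq; apply/negP; rewrite -leNgt; have [x1|x1] := leP x 1.
  by apply: ge_inf; [exact: (level_lb t).2|left; rewrite /= x0].
exact: le_trans q1 (ltW x1).
Qed.

Lemma quantile_nd : {homo quantile : s t / s <= t}.
Proof.
move=> s t st; apply: lb_le_inf; first by exists 1; right.
move=> x lx; apply: ge_inf; first exact: (level_lb s).2.
by case: lx => [[xI tx]|->]; [left; split=> //; exact: le_lt_trans st tx|right].
Qed.

Lemma quantile_meas : measurable_fun setT (quantile : RM -> RM).
Proof. by apply: nondecreasing_measurable => //; exact: quantile_nd. Qed.

Lemma bmeas_quantile phi : bmeas phi -> bmeas (fun t : RM => phi (quantile t)).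
Proof. by apply: bmeas_comp; exact: quantile_meas. Qed.

(* Layer cake: [al x] is the Lebesgue measure of the [t] in [0, M] with
   [t < al x], that is with [quantile t < x] up to null sets. *)
Lemma ib_layer_cake phi w : bmeas phi -> bmeas w ->
  (forall c, 0 <= c <= 1 -> phi 1 - phi c = ib c 1 w) ->
  ib 0 1 (fun x => w x * al x) = ib 0 M (fun t : RM => phi 1 - phi (quantile t)).
Proof.
move=> bphi bw phiE; have bal := nd_bounded_bmeas nd_al.
have mal : measurable_fun setT (al : RM -> RM) by exact: bal.1.
pose F (z : RM * RM) := w z.1 * lt01 z.2 (al z.1).
have bF : bmeas F.
  apply: bmeasM; first exact: (bmeas_comp measurable_fst bw).
  by apply: bmeas_lt01 => //; exact: (measurableT_comp mal).
have blt x : bmeas (fun t : RM => lt01 t (al x)) by exact: bmeas_lt01l.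
transitivity (ib 0 1 (fun x => ib 0 M (fun t => F (x, t)))).
  apply: ib_eq; [exact: bmeasM|exact: (bmeas_fi2 (lebI 0 1) (lebI 0 M) bF)|].
  move=> x _; rewrite /F/= /ib fiZ//; congr (_ * _).
  have /andP[a0 aM] := nd_al.2 x.
  transitivity (ib 0 M (fun t : RM => 1 * lt01 t (al x))).
    rewrite (ib_lt01l (bmeas_cst 1))// ib_cst//; lra.
  by congr (fi _ _); apply/funext => t; rewrite mul1r.
rewrite /ib (fi_swap (lebI 0 1) (lebI 0 M) bF).
apply: ib_eq.
- exact: (bmeas_fi1 (lebI 0 1) (lebI 0 M) bF).
- by apply: bmeasB; [exact: bmeas_cst|exact: bmeas_quantile].
move=> t /andP[t0 tM]; have /andP[q0 q1] := quantile_in t.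
rewrite phiE ?q0// /F/=.
apply: (@ib_upper _ 0 1 (quantile t) w (fun x => lt01 t (al x))) => //.
- by apply: bmeas_lt01.
- move=> x /andP[x0 xq]; rewrite lt01E ltNge.
  by rewrite quantile_lt// ltW.
- by move=> x /andP[qx x1]; rewrite lt01E quantile_gt// qx ltW.
Qed.

Fact quantile_supp (A : set RM) : measurable A ->
  cpush (charge_of_finite_measure (lebI 0 M)) quantile_meas A =
  cpush (charge_of_finite_measure (lebI 0 M)) quantile_meas (A `&` I01).
Proof.
move=> mA; rewrite /= /pushforward; congr (_ _).
apply/seteqP; split => t /=; last by case.
by move=> At; split => //; rewrite /= in_itv/=; exact: quantile_in.
Qed.

(** The Stieltjes measure of [al] on [0, 1], with masses [al 0] at 0 and [M - al 1] at 1 added, so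
    that the total mass is [M]. *)
Definition quantile_bs : bs R := Bs quantile_supp.

Lemma cint_quantile_bs phi : bmeas phi ->
  cint quantile_bs phi = ib 0 M (fun t : RM => phi (quantile t)).
Proof.
move=> bphi; rewrite [LHS]cint_cpush//.
move: (bmeas_quantile bphi); set g := (fun t : RM => _); move: g => g.
apply: (@cint_functional _ _ _ _ (fun g => ib 0 M g) (fine (lebI 0 M setT))).
- by move=> g1 g2 b1 b2; exact: fiD.
- by move=> c g1 b1; exact: fiZ.
- by move=> g1 K b1 gK; rewrite mulrC; exact: fi_le.
- by move=> A mA; rewrite /ib fi_indic// fineK ?fin_num_measure.
Qed.

End quantile.

(** * Moving averages of Lipschitz functions *)

Section mollifier.
Context {R : realType}.
Local Notation RM := (measurableTypeR R).
Variables (g : R -> R) (e : R).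
Hypotheses (lg : lip1 g) (e_gt0 : 0 < e).

Let bg : bmeas (g : RM -> R) := lip1_bmeas lg.

(** A moving average has the explicit derivative [moll'], bounded by the Lipschitz constant of [g];
    differentiability of Lipschitz functions is thereby avoided. *)
Definition moll (y : R) : R := e^-1 * ib y (y + e) g.
Definition moll' (y : R) : R := e^-1 * (g (y + e) - g y).

Lemma mollE y : moll y = e^-1 * ib 0 e (fun t : RM => g ((t : R) + y)).
Proof. by rewrite /moll ib_shift// add0r addrC. Qed.

Lemma moll'_le y : `|moll' y| <= 1.
Proof.
rewrite /moll' normrM gtr0_norm ?invr_gt0// ler_pdivrMl// mulr1.
by rewrite (le_trans (lg.2 _ _))// addrAC subrr add0r gtr0_norm.
Qed.

Lemma bmeas_moll' : bmeas (moll' : RM -> R).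
Proof. by apply: bmeasZ; apply: bmeasB => //; exact: (bmeas_shift e bg). Qed.

Lemma moll_lip1 : lip1 moll.
Proof.
have bs y : bmeas (fun t : RM => g ((t : R) + y)) by exact: (bmeas_shift y bg).
have e0 := ltW e_gt0.
split=> [y|y z]; rewrite !mollE.
  rewrite normrM gtr0_norm ?invr_gt0// ler_pdivrMl// mulr1.
  have := @ib_le _ 0 e _ 1 (bs y) e0; rewrite subr0 mul1r; apply => t _.
  exact: lg.1.
rewrite -mulrBr normrM gtr0_norm ?invr_gt0// ler_pdivrMl//.
rewrite /ib -(fiB _ (bs y) (bs z)) -/(ib _ _ _).
have := @ib_le _ 0 e _ `|y - z| (bmeasB (bs y) (bs z)) e0.
rewrite subr0 mulrC; apply => t _.
by rewrite (le_trans (lg.2 _ _))// opprD addrACA subrr add0r.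
Qed.

Lemma moll_close y : `|moll y - g y| <= e.
Proof.
have e0 := ltW e_gt0.
have bs z : bmeas (fun t : RM => g ((t : R) + z)) by exact: (bmeas_shift z bg).
have -> : moll y - g y = e^-1 * ib 0 e (fun t : RM => g ((t : R) + y) - g y).
  rewrite mollE /ib (fiB _ (bs y) (bmeas_cst (g y))) -!/(ib _ _ _) ib_cst//.
  by rewrite subr0 mulrBr (mulrC (g y)) mulKf// gt_eqF.
rewrite normrM gtr0_norm ?invr_gt0// ler_pdivrMl//.
have := @ib_le _ 0 e _ e (bmeasB (bs y) (bmeas_cst (g y))) e0.
rewrite subr0; apply => t /andP[t0 te].
by rewrite (le_trans (lg.2 _ _))// addrK ger0_norm.
Qed.

(** The integral of [g] over [c, d + e] is cut at [d] and at [c + e]; comparing the two ways needs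
    only additivity and translation. *)
Lemma moll_diff c d : c <= d -> moll d - moll c = ib c d moll'.
Proof.
move=> cd; have e0 := ltW e_gt0.
have h1 : ib c (d + e) g = ib c d g + ib d (d + e) g by apply: ib_split => //; lra.
have h2 : ib c (d + e) g = ib c (c + e) g + ib (c + e) (d + e) g.
  by apply: ib_split => //; lra.
have b1 : bmeas (fun y : RM => g ((y : R) + e)) := bmeas_shift e bg.
have b2 : bmeas (fun y : RM => g ((y : R) + e) - g y) := bmeasB b1 bg.
have h3 : ib c d moll' = e^-1 * ib c d (fun y : RM => g ((y : R) + e) - g y).
  exact: (fiZ _ _ b2).
have h4 : ib c d (fun y : RM => g ((y : R) + e) - g y) =
    ib (c + e) (d + e) g - ib c d g.
  by rewrite -(ib_shift c d e bg); exact: (fiB _ b1 bg).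
by rewrite h3 h4 /moll -mulrBr; congr (_ * _); lra.
Qed.

End mollifier.

(** * The derivative of a deformed density as a measure *)

Section linear_response.
Context {R : realType}.
Local Notation RM := (measurableTypeR R).
Variables (a b : R -> R) (M : R) (S : R -> R).
Hypotheses (nda : nd_bounded a M) (ndb : nd_bounded b M).
Hypothesis S_lip : forall x y, `|S x - S y| <= `|x - y|.
Hypothesis S0 : S 0 = 0.

Let M_ge0 : 0 <= M.
Proof. by have [_ h] := nda; have /andP[h1 h2] := h 0; exact: le_trans h2. Qed.

Let ba : bmeas (a : RM -> R) := nd_bounded_bmeas nda.
Let bb : bmeas (b : RM -> R) := nd_bounded_bmeas ndb.
Let S_le x : 0 <= x <= 1 -> `|S x| <= 1.
Proof.
move=> /andP[x0 x1]; have := S_lip x 0; rewrite S0 !subr0 => /le_trans; apply.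
by rewrite ger0_norm.
Qed.

(* [(a - b) S = al - be] with [al] and [be] nondecreasing, since [S + id] is. *)
Definition resp_al (x : R) : R := let c := clamp01 x in a c * (S c + c) + b c * c.
Definition resp_be (x : R) : R := let c := clamp01 x in a c * c + b c * (S c + c).

(** As [S] is 1-Lipschitz with [S 0 = 0], the function [S c + c] is nondecreasing with values in
    [0, 2]. Products of nonnegative nondecreasing functions are nondecreasing, and the bound is
    [2 * M + M]. *)
Lemma nd_resp (p q : R -> R) : nd_bounded p M -> nd_bounded q M ->
  nd_bounded (fun x => let c := clamp01 x in p c * (S c + c) + q c * c) (3 * M).
Proof.
move=> ndp ndq; have cI (x : R) : 0 <= clamp01 x <= 1.
  by have := clamp01_in x; rewrite in_itv.
have SI c : 0 <= c <= 1 -> 0 <= S c + c <= 2.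
  move=> /andP[c0 c1]; have := S_lip c 0; rewrite S0 !subr0 (ger0_norm c0) ler_norml.
  by move=> /andP[h1 h2]; apply/andP; split; lra.
split=> [x y xy|x] /=.
  have cxy := clamp01_mono xy; have := S_lip (clamp01 x) (clamp01 y).
  rewrite distrC [X in _ <= X]distrC (ger0_norm (_ : 0 <= clamp01 y - clamp01 x)) ?subr_ge0//.
  rewrite ler_norml => /andP[h1 h2].
  have /andP[p0 _] := ndp.2 (clamp01 x); have /andP[q0 _] := ndq.2 (clamp01 x).
  have /andP[s0 _] := SI _ (cI x); have /andP[c0 _] := cI x.
  by rewrite lerD// ler_pM ?ndp.1 ?ndq.1//; lra.
have /andP[p0 p1] := ndp.2 (clamp01 x); have /andP[q0 q1] := ndq.2 (clamp01 x).
have /andP[s0 s2] := SI _ (cI x); have /andP[c0 c1] := cI x.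
rewrite addr_ge0 ?mulr_ge0//=.
have h1 : p (clamp01 x) * (S (clamp01 x) + clamp01 x) <= M * 2 by rewrite ler_pM.
have h2 : q (clamp01 x) * clamp01 x <= M * 1 by rewrite ler_pM.
lra.
Qed.

Lemma nd_resp_al : nd_bounded resp_al (3 * M).
Proof. exact: nd_resp nda ndb. Qed.

Lemma nd_resp_be : nd_bounded resp_be (3 * M).
Proof.
have := nd_resp ndb nda; congr (nd_bounded _ _); apply/funext => x.
by rewrite /resp_be/= addrC.
Qed.

(** The order of the two terms gives the minus sign in -(p S)'. The endpoint masses of the two
    measures combine to those created by extending the function by zero. *)
Definition response : bs R :=
  bs_sub (quantile_bs resp_be (3 * M)) (quantile_bs resp_al (3 * M)).

Let bS : bmeas (fun x : RM => S (clamp01 x)).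
Proof.
apply: (@lip_bmeas _ _ 1 1) => [x|x y].
  by apply: S_le; have := clamp01_in x; rewrite in_itv.
by rewrite mul1r (le_trans (S_lip _ _))// clamp01_lip.
Qed.

Let bu : bmeas (fun x : RM => (a x - b x) * S (clamp01 x)).
Proof. by apply: bmeasM => //; exact: bmeasB. Qed.

(** Integration by parts: the layer-cake formula is applied to both monotone parts, and the terms
    with [phi 1] cancel since both use the same bound [3 * M]. *)
Lemma cint_response (phi w : RM -> R) : bmeas phi -> bmeas w ->
  (forall c, 0 <= c <= 1 -> phi 1 - phi c = ib c 1 w) ->
  cint response phi = ib 0 1 (fun x => w x * ((a x - b x) * S (clamp01 x))).
Proof.
move=> bphi bw phiE.
have bal := nd_bounded_bmeas nd_resp_al; have bbe := nd_bounded_bmeas nd_resp_be.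
have -> : ib 0 1 (fun x => w x * ((a x - b x) * S (clamp01 x))) =
    ib 0 1 (fun x => w x * resp_al x) - ib 0 1 (fun x => w x * resp_be x).
  rewrite /ib -(fiB _ (bmeasM bw bal) (bmeasM bw bbe)); apply: ib_eq.
  - exact: bmeasM.
  - by apply: bmeasB; exact: bmeasM.
  move=> x x01; rewrite /resp_al /resp_be/= clamp01_id; last by rewrite in_itv.
  by ring.
rewrite (ib_layer_cake nd_resp_al bphi bw phiE) (ib_layer_cake nd_resp_be bphi bw phiE).
have b1 al : bmeas (fun t : RM => phi (quantile al t)) := bmeas_quantile al bphi.
rewrite /ib !(fiB _ (bmeas_cst (phi 1)) (b1 _)).
by rewrite cint_bs_sub// !cint_quantile_bs// /ib; ring.
Qed.

Lemma response_mass : response I01 = 0%E.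
Proof.
apply/mass0P; rewrite (@cint_response _ (fun=> 0)); try exact: bmeas_cst.
  rewrite ib_0//; first by apply: bmeasM => //; exact: bmeas_cst.
  by move=> x _; rewrite mul0r.
by move=> c /andP[c0 c1]; rewrite subrr ib_cst// mul0r.
Qed.

Section estimate.
Variables (D : RM -> RM) (dl : R) (phi w : RM -> R).
Hypotheses (dl0 : 0 < dl) (dl1 : dl < 1).
Hypothesis mD : measurable_fun setT D.
Hypothesis DE : forall x, 0 <= x <= 1 -> D x = x + dl * S x.
Hypothesis D_in : forall x, 0 <= x <= 1 -> 0 <= (D x : R) <= 1.
Hypothesis D_onto : forall y : R, 0 <= y <= 1 -> exists2 x : R, 0 <= x <= 1 & D x = y.
Hypotheses (bphi : bmeas phi) (bw : bmeas w) (w_le : forall x, `|w x| <= 1).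
Hypothesis phiE : forall c, 0 <= c <= 1 -> phi 1 - phi c = ib c 1 w.

(** Signed indicator that [D] moves [x] across [y]: 1 if x < y <= D x, -1 if D x < y <= x, and 0
    otherwise. *)
Let k (x y : R) : R := lt01 x y - lt01 (D x) y.

Let bk : bmeas (fun z : RM * RM => k z.1 z.2).
Proof.
apply: bmeasB; apply: bmeas_lt01 => //.
exact: (measurableT_comp mD).
Qed.

Let bg : bmeas (fun x : RM => a x - b x).
Proof. exact: bmeasB. Qed.

Let phi_diff x : 0 <= x <= 1 ->
  phi (D x) - phi x = ib 0 1 (fun y => w y * k x y).
Proof.
move=> xI; have DxI := D_in xI.
have H c : 0 <= c <= 1 -> ib 0 1 (fun y : RM => w y * lt01 c y) = phi 1 - phi c.
  move=> cI; rewrite phiE//; have /andP[c0 c1] := cI.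
  apply: ib_upper => //; first exact: bmeas_lt01r.
  - by move=> y /andP[_ yc]; rewrite lt01E ltNge (ltW yc).
  - by move=> y /andP[cy _]; rewrite lt01E cy.
have -> : phi (D x) - phi x = (phi 1 - phi x) - (phi 1 - phi (D x)) by ring.
rewrite -(H _ xI) -(H _ DxI) /ib -fiB; last 2 first.
- exact: bmeasM bw (bmeas_lt01r x).
- exact: bmeasM bw (bmeas_lt01r (D x)).
by congr (fi _ _); apply/funext => y; rewrite /k mulrBr.
Qed.

(** The net mass of [a - b] that the deformation carries across [y] from left to right. *)
Let kap (y : R) : R := ib 0 1 (fun x => (a x - b x) * k x y).

Let bkap : bmeas (kap : RM -> R).
Proof.
have bF : bmeas (fun z : RM * RM => (a z.1 - b z.1) * k z.1 z.2).
  by apply: bmeasM => //; exact: (bmeas_comp measurable_fst bg).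
exact: (bmeas_fi1 (lebI 0 1) (lebI 0 1) bF).
Qed.

Lemma ib_deform :
  ib 0 1 (fun x => (phi (D x) - phi x) * (a x - b x)) = ib 0 1 (fun y => w y * kap y).
Proof.
pose F (z : RM * RM) := (a z.1 - b z.1) * (w z.2 * k z.1 z.2).
have bF : bmeas F.
  apply: bmeasM; first exact: (bmeas_comp measurable_fst bg).
  by apply: bmeasM => //; exact: (bmeas_comp measurable_snd bw).
have bwk x : bmeas (fun y : RM => w y * k x y).
  by apply: bmeasM => //; exact: (bmeas_pair1 x bk).
have bgk y : bmeas (fun x : RM => (a x - b x) * k x y).
  by apply: bmeasM => //; exact: (bmeas_pair2 y bk).
have bphiD : bmeas (fun x => phi (D x)) by exact: (bmeas_comp mD bphi).
transitivity (ib 0 1 (fun x => ib 0 1 (fun y => F (x, y)))).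
  apply: ib_eq.
  - by apply: bmeasM => //; exact: bmeasB.
  - exact: (bmeas_fi2 (lebI 0 1) (lebI 0 1) bF).
  - by move=> x xI; rewrite phi_diff// mulrC /ib /F/= (fiZ _ _ (bwk x)).
rewrite /ib (fi_swap (lebI 0 1) (lebI 0 1) bF) /F/=.
apply: ib_eq.
- exact: (bmeas_fi1 (lebI 0 1) (lebI 0 1) bF).
- exact: bmeasM.
move=> y _; rewrite /kap /ib -(fiZ _ _ (bgk y)); congr (fi _ _).
by apply/funext => x; ring.
Qed.

Let osc (y : R) : R := (a (y + dl) - a (y + - dl)) + (b (y + dl) - b (y + - dl)).

Let bosc : bmeas (osc : RM -> R).
Proof.
by apply: bmeasD; apply: bmeasB;
  [exact: (bmeas_shift dl ba)|exact: (bmeas_shift (- dl) ba)|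
   exact: (bmeas_shift dl bb)|exact: (bmeas_shift (- dl) bb)].
Qed.

(** Since [dl < 1], [D] is strictly increasing; if [D y' = y], the mass carried across [y] is the
    integral of [a - b] from [y'] to [y], an interval of signed length [dl * S y']. Freezing [a - b]
    at [y] costs [dl * osc y], and replacing [S y'] by [S y] costs [dl * (M * dl)]. *)
Lemma kap_close y : 0 <= y <= 1 ->
  `|kap y - dl * ((a y - b y) * S y)| <= dl * (osc y + M * dl).
Proof.
move=> yI; have [y' y'I Dy'] := D_onto yI.
have /andP[y0 y1] := yI; have /andP[y'0 y'1] := y'I.
have yE : y - y' = dl * S y' by rewrite -Dy' DE// addrAC subrr add0r.
have yd : `|y - y'| <= dl.
  by rewrite yE normrM gtr0_norm// -[leRHS]mulr1 ler_wpM2l ?(ltW dl0)// S_le.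
have D_mono x z : 0 <= x <= 1 -> 0 <= z <= 1 -> x < z -> (D x : R) < D z.
  move=> xI zI xz; rewrite !DE//; have := S_lip z x.
  rewrite (gtr0_norm (_ : 0 < z - x)) ?subr_gt0// ler_norml => /andP[h _].
  have : dl * (S x - S z) <= dl * (z - x) by rewrite ler_wpM2l ?(ltW dl0)//; lra.
  have : dl * (z - x) < 1 * (z - x) by rewrite ltr_pM2r// subr_gt0.
  by lra.
have kE x : 0 <= x <= 1 -> k x y = lt01 x y - lt01 x y'.
  move=> xI; rewrite /k !lt01E -Dy'; congr (_ - (nat_of_bool _)%:R).
  have [xy|yx|->] := ltgtP x y'; last by rewrite ltxx.
    by rewrite D_mono.
  by apply/negbTE; rewrite -leNgt ltW// D_mono.
have bd : bmeas (fun x : RM => lt01 x y - lt01 x y').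
  by apply: bmeasB; exact: bmeas_lt01l.
have ib1 z : 0 <= z <= 1 -> ib 0 1 (fun x : RM => lt01 x z) = z.
  move=> /andP[z0 z1]; rewrite -[RHS]subr0 -[RHS]mul1r -(ib_cst 1 z0).
  rewrite -(ib_lt01l (bmeas_cst 1) z0 z1); congr (fi _ _).
  by apply/funext => x; rewrite mul1r.
have ibk : ib 0 1 (fun x : RM => lt01 x y - lt01 x y') = y - y'.
  by rewrite /ib (fiB _ (bmeas_lt01l y) (bmeas_lt01l y')) -!/(ib _ _ _) !ib1.
have ibk_abs : ib 0 1 (fun x : RM => `|lt01 x y - lt01 x y'|) = `|y - y'|.
  have [yy|/ltW yy] := leP y' y.
    rewrite ger0_norm ?subr_ge0// -ibk; congr (fi _ _); apply/funext => x.
    rewrite ger0_norm// subr_ge0 !lt01E ler_nat.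
    by case: (ltP x y') => // xy'; rewrite (lt_le_trans xy' yy).
  rewrite distrC ger0_norm ?subr_ge0//.
  have -> : y' - y = -1 * (y - y') by ring.
  rewrite -ibk /ib -(fiZ _ _ bd); congr (fi _ _); apply/funext => x.
  rewrite mulN1r ler0_norm// subr_le0 !lt01E ler_nat.
  by case: (ltP x y) => // xy; rewrite (lt_le_trans xy yy).
have kapE : kap y = ib 0 1 (fun x : RM => (a x - b x) * (lt01 x y - lt01 x y')).
  apply: ib_eq; [|exact: bmeasM|by move=> x xI; rewrite kE].
  by apply: bmeasM => //; exact: (bmeas_pair2 y bk).
have osc_le x : `|x - y| <= dl -> `|(a x - b x) - (a y - b y)| <= osc y.
  rewrite ler_norml => /andP[h1 h2]; rewrite /osc.
  have A1 : a x <= a (y + dl) by apply: nda.1; lra.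
  have A2 : a (y + - dl) <= a x by apply: nda.1; lra.
  have A3 : a y <= a (y + dl) by apply: nda.1; lra.
  have A4 : a (y + - dl) <= a y by apply: nda.1; lra.
  have B1 : b x <= b (y + dl) by apply: ndb.1; lra.
  have B2 : b (y + - dl) <= b x by apply: ndb.1; lra.
  have B3 : b y <= b (y + dl) by apply: ndb.1; lra.
  have B4 : b (y + - dl) <= b y by apply: ndb.1; lra.
  by rewrite ler_norml; apply/andP; split; lra.
have osc0 : 0 <= osc y.
  by apply: (le_trans _ (osc_le y _)) => //; rewrite subrr normr0 ltW.
have step1 : `|kap y - (a y - b y) * (y - y')| <= dl * osc y.
  rewrite kapE -ibk /ib -(fiZ _ _ bd) -(fiB _ (bmeasM bg bd) (bmeasZ _ bd)).
  have bdiff : bmeas (fun x : RM => (a x - b x) * (lt01 x y - lt01 x y') -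
      (a y - b y) * (lt01 x y - lt01 x y')).
    by apply: bmeasB; [exact: bmeasM|exact: bmeasZ].
  rewrite (le_trans (fi_normr _ bdiff))//.
  rewrite (@le_trans _ _ (osc y * `|y - y'|))//; last by rewrite mulrC ler_wpM2r.
  rewrite -ibk_abs /ib -(fiZ _ _ (bmeas_norm bd)).
  apply: le_fi; [exact: bmeas_norm|exact/bmeasZ/bmeas_norm|].
  move=> x; rewrite -mulrBl normrM.
  have [e|ne] := eqVneq (lt01 x y) (lt01 x y'); first by rewrite e subrr normr0 !mulr0.
  rewrite ler_wpM2r// osc_le//; apply: le_trans yd.
  move: ne; rewrite !lt01E; case: (ltP x y) => xy; case: (ltP x y') => xy'; rewrite ?eqxx// => _.
    by rewrite distrC !ger0_norm ?subr_ge0 ?(ltW xy)//; lra.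
  by rewrite [leRHS]distrC !ger0_norm ?subr_ge0 ?xy//; lra.
have step2 : `|(a y - b y) * (y - y') - dl * ((a y - b y) * S y)| <= dl * (M * dl).
  have -> : (a y - b y) * (y - y') - dl * ((a y - b y) * S y) =
     dl * ((a y - b y) * (S y' - S y)) by rewrite yE; ring.
  rewrite normrM gtr0_norm// ler_wpM2l ?(ltW dl0)// normrM ler_pM//.
    have /andP[? ?] := nda.2 y; have /andP[? ?] := ndb.2 y.
    by rewrite ler_norml; apply/andP; split; lra.
  by rewrite (le_trans (S_lip _ _))// distrC.
rewrite -(subrK ((a y - b y) * (y - y')) (kap y)) -addrA.
by apply: (le_trans (ler_normD _ _)); rewrite [leRHS]mulrDr; exact: lerD.
Qed.

(** The oscillations of [a] and of [b] over a window of length [2 * dl] have integral at most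
    [2 * M * dl] each, by [ib_nd_shift]; the remaining [M * dl] comes from the variation of [S]. *)
Lemma response_estimate :
  `|dl^-1 * ib 0 1 (fun x => (phi (D x) - phi x) * (a x - b x)) -
    cint response phi| <= 5 * M * dl.
Proof.
rewrite (cint_response bphi bw phiE) ib_deform.
have bwk : bmeas (fun y : RM => w y * kap y) by exact: bmeasM.
have bwu : bmeas (fun x : RM => w x * ((a x - b x) * S (clamp01 x))) by exact: bmeasM.
rewrite /ib -(fiZ _ _ bwk) -(fiB _ (bmeasZ _ bwk) bwu).
have bdiff := bmeasB (bmeasZ dl^-1 bwk) bwu.
rewrite (le_trans (fi_normr _ bdiff))//.
have bo : bmeas (fun y : RM => osc y + M * dl).
  by apply: bmeasD => //; exact: bmeas_cst.
rewrite (@le_trans _ _ (ib 0 1 (fun y : RM => osc y + M * dl)))//.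
  apply: le_ib => //; first exact: bmeas_norm.
  move=> y yI; have := kap_close yI; rewrite clamp01_id; last by rewrite in_itv.
  set u := (a y - b y) * S y => H.
  have -> : dl^-1 * (w y * kap y) - w y * u = w y * (dl^-1 * (kap y - dl * u)).
    by field; rewrite gt_eqF.
  rewrite normrM (@le_trans _ _ `|dl^-1 * (kap y - dl * u)|)//.
    by rewrite ler_piMl.
  by rewrite normrM gtr0_norm ?invr_gt0// ler_pdivrMl.
have nb (p : R -> R) : nd_bounded p M ->
    ib 0 1 (fun x : RM => p ((x : R) + dl) - p ((x : R) + - dl)) <= 2 * (M * dl).
  move=> [h1 h2]; have -> : 2 * (M * dl) = M * (dl - - dl) by ring.
  apply: (ib_nd_shift h1 h2); first exact: ler01.
  by rewrite (le_trans _ (ltW dl0))// oppr_le0 ltW.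
have b1 (p : R -> R) : nd_bounded p M ->
    bmeas (fun x : RM => p ((x : R) + dl) - p ((x : R) + - dl)).
  move=> /nd_bounded_bmeas bp; apply: bmeasB.
    exact: (bmeas_shift dl bp).
  exact: (bmeas_shift (- dl) bp).
rewrite /ib (fiD _ bosc (bmeas_cst _)) /osc (fiD _ (b1 _ nda) (b1 _ ndb)).
have h3 : fi (lebI 0 1) (fun=> M * dl) = M * dl.
  by rewrite -/(ib _ _ _) ib_cst// subr0 mulr1.
rewrite h3 -(mulrA 5).
by apply: le_trans (lerD (lerD (nb _ nda) (nb _ ndb)) (lexx _)) _; lra.
Qed.

End estimate.
End linear_response.

(** * Perturbing the map *)

Section test_functions.
Context {R : realType}.
Local Notation RM := (measurableTypeR R).

Lemma continuous_clamp_bmeas (f : R -> R) : continuous f ->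
  bmeas (fun x : RM => f (clamp01 x)).
Proof.
move=> cf; split.
  apply: continuous_measurable_fun => x; apply: continuous_comp; last exact: cf.
  by apply: (@lip_continuous _ _ 1) => y z; rewrite mul1r clamp01_lip.
have cn : {within `[0, 1], continuous (fun x => `|f x|)}.
  apply: continuous_subspaceT => x.
  by apply: continuous_comp; [exact: cf|exact: norm_continuous].
have [c _ fc] := EVT_max ler01 cn.
by exists `|f c| => x; apply: fc; exact: clamp01_in.
Qed.

(** Brings smooth test functions into the form that [cint_response] expects; clamping makes phi and
    its derivative bounded without changing them on [0, 1]. *)
Lemma test_function_C1 (phi : R -> R) : test_function phi ->
  [/\ bmeas (fun x : RM => phi (clamp01 x)),
      bmeas (fun x : RM => derive1 phi (clamp01 x)) &
      forall c, 0 <= c <= 1 -> phi (clamp01 1) - phi (clamp01 c) =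
        ib c 1 (fun x : RM => derive1 phi (clamp01 x))].
Proof.
move=> [dphi _].
have d0 x : derivable phi x 1 := dphi 0%N x.
have d1 x : derivable (derive1 phi) x 1 := dphi 1%N x.
have c0 : continuous phi.
  by move=> x; apply/differentiable_continuous/derivable1_diffP.
have c1 : continuous (derive1 phi).
  by move=> x; apply/differentiable_continuous/derivable1_diffP.
have b1 := continuous_clamp_bmeas c1.
split=> //; first exact: continuous_clamp_bmeas.
move=> c /andP[cc0]; rewrite le_eqVlt => /predU1P[->|cc1].
  by rewrite subrr ib_0 // => x /andP[h1 h2]; move: (lt_trans h1 h2); rewrite ltxx.
have ci : c \in `[0, 1] by rewrite in_itv/= cc0 ltW.
have i1 : (1 : R) \in `[0, 1] by rewrite in_itv/= lexx ler01.
rewrite !clamp01_id// ib_RintegralE//.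
have FTC : (\int[lebesgue_measure]_(x in `[c, 1%R]) (derive1 phi x)%:E =
    (phi 1)%:E - (phi c)%:E)%E.
  apply: continuous_FTC2; [exact: cc1|exact: continuous_subspaceT| |by []].
  by split=> [x _||]; [exact: d0|exact/cvg_at_right_filter/c0|exact/cvg_at_left_filter/c0].
have -> : phi 1 - phi c = fine ((phi 1)%:E - (phi c)%:E)%E by [].
rewrite /Rintegral -FTC; congr fine.
apply: eq_integral => x; rewrite inE/= in_itv/= => /andP[cx x1].
by rewrite clamp01_id// in_itv/= x1 (le_trans cc0).
Qed.

End test_functions.

Section response_map.
Context {R : realType}.
Local Notation RM := (measurableTypeR R).
Local Notation leb := (@lebesgue_measure R).
Implicit Types (g : RM -> R) (mu nu : bs R).
Variables (rho : bs R) (T0 : borel_selfmap R) (f0 : bs R).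
Hypothesis T0_nonsingular : nonsingular T0.
Hypotheses (rho_BV : is_BV rho) (rho_prob : is_probability rho).
Hypothesis mixing : forall g : bs R, is_BV g -> g I01 = 0%E ->
  norm1 (iter n (transfer rho T0) g) @[n --> \oo] --> 0%E.
Hypotheses (f0_probability : is_probability f0)
  (f0_fixed : bs_eq (transfer rho T0 f0) f0).
Variables (deltabar : R) (S : R -> R) (D : R -> borel_selfmap R) (K : R)
  (f : R -> bs R).
Hypotheses (deltabar_gt0 : 0 < deltabar) (S_lip : 1.-lipschitz_I01 S).
Hypothesis S0 : S 0 = 0.
Hypothesis D_def : forall delta : R, 0 <= delta < deltabar ->
  (forall x : R, x \in `[0, 1] -> D delta x = x + delta * S x) /\
  bilipschitz_homeo (D delta).
Hypothesis K_bound : forall g : bs R, is_BV g ->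
  (bvnorm_fun (fun x => (\1_(support01 S) x * density (push T0 g) x)%R)
   <= K%:E * bvnorm g)%E.
Hypothesis f_fixed : forall delta : R, 0 <= delta < deltabar ->
  is_probability (f delta) /\
  bs_eq (transfer rho (selfmap_comp (D delta) T0) (f delta)) (f delta).

Let L := transfer rho T0.

Let f0_L1 : is_L1 f0.
Proof.
have [C C0 HC] := noise_props rho_BV.
by have [_ h _] := HC (push T0 f0); exact: is_L1_ext f0_fixed h.
Qed.

Lemma ae_eq_density mu nu : is_L1 mu -> bs_eq mu nu ->
  ae_eq leb I01 (density mu) (density nu).
Proof.
move=> L1 mn; have L2 := is_L1_ext mn L1.
suff : ae_eq leb I01 ('d mu '/d leb) ('d nu '/d leb).
  by apply: filterS => x /= h xI; rewrite /density h.
apply: integral_ae_eq => //.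
- exact: integrableS (Radon_Nikodym_integrable L1).
- by apply: measurable_funTS; exact: measurable_int (Radon_Nikodym_integrable L2).
- by move=> E _ mE; rewrite -!Radon_Nikodym_integral//; exact: mn.
Qed.

(** The Radon-Nikodym densities of measures that agree on Borel sets may still differ on a null set;
    the infimum in [var01] absorbs the difference. *)
Lemma is_BV_ext mu nu : bs_eq mu nu -> is_BV mu -> is_BV nu.
Proof.
move=> mn BV; have L1 := BV_L1 BV; have L2 := is_L1_ext mn L1.
have n1 : norm1_fun (density nu) = (tv nu)%:E.
  by rewrite -norm1E// /norm1 asboolT.
rewrite /is_BV /bvnorm asboolT// /bvnorm_fun n1.
apply: lte_add_pinfty; first exact: ltry.
have : (var01 (density mu) < +oo)%E.
  move: BV; rewrite /is_BV /bvnorm asboolT// /bvnorm_fun; apply: le_lt_trans.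
  by rewrite leeDr// integral_ge0.
apply: le_lt_trans; apply: le_ereal_inf => _ [h hm <-]; exists h => //=.
have := ae_eq_density L1 mn; move: hm => /=; apply: filterS2 => x /= h1 h2 xI.
by rewrite h1// h2.
Qed.

(** A fixed measure is a convolution with [rho]. This makes [K_bound] applicable to [f0]. *)
Let f0_BV : is_BV f0.
Proof.
have [C C0 HC] := noise_props rho_BV.
by have [_ _ h] := HC (push T0 f0); exact: is_BV_ext f0_fixed h.
Qed.

Let p0 := push T0 f0.
Let p0_L1 : is_L1 p0 := T0_nonsingular f0_L1.

Let Sc (x : R) := S (clamp01 x).

Let Sc_id x : x \in `[0, 1] -> Sc x = S x.
Proof. by move=> xI; rewrite /Sc clamp01_id. Qed.

Let Sc_lip x y : `|Sc x - Sc y| <= `|x - y|.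
Proof.
move/klip_I01P: S_lip => h.
by rewrite (le_trans (h _ _ (clamp01_in _) (clamp01_in _)))// mul1r clamp01_lip.
Qed.

Let Sc0 : Sc 0 = 0.
Proof. by rewrite Sc_id// in_itv/= lexx ler01. Qed.

Let Sc_le x : `|Sc x| <= 1.
Proof.
have /andP[c0 c1] : 0 <= clamp01 x <= 1 by have := clamp01_in x; rewrite in_itv.
have -> : Sc x = Sc (clamp01 x) - Sc 0.
  by rewrite Sc0 subr0 /Sc (clamp01_id (clamp01_in x)).
by rewrite (le_trans (Sc_lip _ _))// subr0 ger0_norm.
Qed.

Let bSc : bmeas (Sc : RM -> R).
Proof. by apply: (lip_bmeas Sc_le (k := 1)) => x y; rewrite mul1r; exact: Sc_lip. Qed.

(** [K_bound] controls the variation of the density of [p0] only after truncation to the support of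
    [S]. That suffices, as only [p0 * S] and the points moved by [D] enter below. *)
Lemma density_support : exists a b M, [/\ nd_bounded a M, nd_bounded b M &
  ae_eq leb I01 (fun x => a x - b x)
    (fun x => \1_(support01 S) x * density p0 x)].
Proof.
apply: var01_decomp.
have := K_bound f0_BV; rewrite /bvnorm_fun => h.
have h2 : (K%:E * bvnorm f0 < +oo)%E.
  have B0 : (0 <= bvnorm f0)%E.
    rewrite /bvnorm asboolT// /bvnorm_fun adde_ge0 ?integral_ge0//.
    apply: le_ereal_inf_tmp => _ [g _ <-]; exact: total_variation_ge0.
  by rewrite -(@fineK _ (bvnorm f0)) ?ge0_fin_numE// -EFinM ltry.
apply: le_lt_trans h2; apply: le_trans h.
by rewrite leeDr// integral_ge0.
Qed.

Lemma response_map : exists (R1 : bs R -> bs R) (dfS : bs R),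
  [/\ is_resolvent V_space norm1 (transfer rho T0) R1,
      is_distr_derivative (fun x => - (density (push T0 f0) x * S x)) dfS,
      V_space (hconv rho dfS) &
      norm1 (bs_sub (bs_scale delta^-1 (bs_sub (f delta) f0))
                    (R1 (hconv rho dfS)))
        @[delta --> 0^'+] --> 0%E].
Proof.
have [Lt LLt] := dual_transfer rho T0.
have [n0 L_half] := uniform_mixing rho_BV rho_prob mixing.
have L_tv nu : tv (L nu) <= tv nu by exact: tv_transfer.
have L_mass nu : cint (L nu) (fun=> 1) = cint nu (fun=> 1) by exact: transfer_mass.
have [C1 C1_ge0 HC] := noise_props rho_BV.
have L_L1 nu : is_L1 (L nu) by have [] := HC (push T0 nu).
have [N HN] := neumann_exists LLt L_tv L_mass L_half L_L1.
set B := 2 * n0.+1%:R in HN; have B_ge0 : 0 <= B by rewrite mulr_ge0.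
have [a [b [M [nda ndb abE]]]] := density_support.
have M_ge0 : 0 <= M by have /andP[h1 h2] := nda.2 0; exact: le_trans h2.
have ba := nd_bounded_bmeas nda; have bb := nd_bounded_bmeas ndb.
have bab : bmeas (fun x : RM => a x - b x) by exact: bmeasB.
(* The truncation to the support is invisible after multiplication by [S]. *)
have ae_supp : ae_eq leb I01 (fun x => (a x - b x) * Sc x)
    (fun x => density p0 x * S x).
  apply: filterS abE => x /= h xI; rewrite h// (Sc_id xI).
  have [S_0|/eqP S_n0] := pselect (S x = 0); first by rewrite S_0 !mulr0.
  rewrite indicE mem_set ?mul1r//; apply: subset_closure; split=> //.
pose dfS := response a b M Sc.
exists N, dfS.
have h_L1 : is_L1 (hconv rho dfS) by have [] := HC dfS.
have b1 := @bmeas_cst _ RM R 1.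
have dfS0 : cint dfS (fun=> 1) = 0.
  by apply/mass0P; exact: (response_mass nda ndb Sc_lip Sc0).
have h0 : hconv rho dfS I01 = 0%E.
  by apply/mass0P; rewrite hconv_mass dfS0 mulr0.
split.
- exact: (spec_resolvent_L1 HN).
- move=> phi tphi; have [bphi bw phiE] := test_function_C1 tphi.
  rewrite (@bs_integral_ext _ _ _ (fun x => phi (clamp01 x))); last first.
    by move=> x xI; rewrite clamp01_id.
  rewrite bs_integralE// (cint_response nda ndb Sc_lip Sc0 bphi bw phiE).
  have bu : bmeas (fun x : RM => derive1 phi (clamp01 x) *
      ((a x - b x) * Sc (clamp01 x))).
    apply: bmeasM => //; apply: bmeasM => //.
    by apply: continuous_clamp_bmeas; apply: (@lip_continuous _ _ 1) => x y; rewrite mul1r.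
  rewrite ib_RintegralE// /Rintegral fineK; last first.
    by apply: integrable_fin_num => //; exact: bmeas_leb_integrable.
  have -> : (\int[leb]_(x in I01)
      (derive1 phi x * - (density (push T0 f0) x * S x))%:E =
      \int[leb]_(x in I01)
      (- (derive1 phi (clamp01 x) * (density p0 x * Sc x))%:E))%E.
    apply: eq_integral => x; rewrite inE => xI.
    by rewrite clamp01_id// Sc_id// mulrN EFinN.
  have mp0 : measurable_fun setT (density p0 : RM -> R).
    by apply/measurable_EFinP; exact: measurable_int (density_integrable p0_L1).
  have mprod : measurable_fun (I01 : set RM)
      (fun x : RM => derive1 phi (clamp01 x) * (density p0 x * Sc x) : R).
    apply: measurable_funTS; apply: measurable_funM; first exact: bw.1.
    by apply: measurable_funM => //; exact: bSc.1.
  have -> : (\int[leb]_(x in I01)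
      (- (derive1 phi (clamp01 x) * (density p0 x * Sc x))%:E) =
      \int[leb]_(x in I01)
      (- (derive1 phi (clamp01 x) * ((a x - b x) * Sc (clamp01 x)))%:E))%E.
    apply: ae_eq_integral => //.
    + by apply: measurableT_comp => //; exact/measurable_EFinP.
    + apply: measurableT_comp => //.
      by apply/measurable_EFinP/measurable_funTS; exact: bu.1.
    + apply: filterS ae_supp => x /= h xI.
      by rewrite (clamp01_id xI) h// Sc_id.
  rewrite integralN/= ?oppeK//.
  by apply: integrable_add_def => //; exact: bmeas_leb_integrable bu.
- by split.
(* [B * C1] is the cost of the noise followed by the resolvent. In the second factor, [B * C1] comes
   from replacing [f delta] by [f0], and [5 * M] from [response_estimate]. *)
pose v (delta : R) := B * C1 * (B * C1 + 5 * M) * delta.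
apply: (@squeeze_ereal0 _ _ _ _ _ v); last first.
  rewrite -[X in _ --> X](mulr0 (B * C1 * (B * C1 + 5 * M))).
  by apply: cvgMl_tmp; apply: cvg_at_right_filter; exact: cvg_id.
near=> dl.
have dl0 : 0 < dl by near: dl; exact: nbhs_right_gt.
have dl1 : dl < 1 by near: dl; exact: nbhs_right_lt.
have dlb : 0 <= dl < deltabar.
  by rewrite (ltW dl0)/=; near: dl; exact: nbhs_right_lt.
have [fp ff] := f_fixed dlb; have [DE [Dbij _]] := D_def dlb.
pose Dx := selfmap_ext (D dl).
have DxE x : 0 <= x <= 1 -> Dx x = x + dl * Sc x.
  move=> xI; have xI' : x \in `[0, 1] by rewrite in_itv.
  by rewrite /Dx selfmap_extE// DE// Sc_id.
have Dx_in x : 0 <= x <= 1 -> 0 <= (Dx x : R) <= 1.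
  move=> xI; have xI' : x \in `[0, 1] by rewrite in_itv.
  by rewrite /Dx selfmap_extE//; have := selfmap_in (D dl) xI'; rewrite in_itv.
have Dx_onto y : 0 <= y <= 1 -> exists2 x : R, 0 <= x <= 1 & Dx x = y.
  move=> yI; have yI' : y \in `[0, 1] by rewrite in_itv.
  case: Dbij => _ _ surj; have [x xI xy] := surj y yI'.
  exists x; first by move: xI; rewrite /= in_itv.
  by rewrite /Dx selfmap_extE.
have mDx : measurable_fun setT Dx by exact: selfmap_ext_meas.
pose pd := push T0 (f dl); pose zeta := bs_sub (push (D dl) pd) pd.
pose mu := bs_sub (f dl) f0; pose eta := hconv rho zeta.
have fd_L1 : is_L1 (f dl).
  have [_ h _] := HC (push (selfmap_comp (D dl) T0) (f dl)).
  exact: is_L1_ext ff h.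
have mu0 : mu I01 = 0%E.
  apply/mass0P; rewrite cint_bs_sub//.
  by rewrite (probability_mass fp) (probability_mass f0_probability) subrr.
have eta0 : eta I01 = 0%E.
  by apply/mass0P; rewrite hconv_mass cint_bs_sub// push_mass subrr mulr0.
have pd1 : tv pd <= 1 by rewrite -(is_probabilityP fp); exact: tv_push.
have cint_zeta nu g : bmeas g -> cint (bs_sub (push (D dl) nu) nu) g =
    cint nu (fun x => g (Dx x) - g x).
  move=> bg; rewrite (cint_bs_sub _ _ bg) (cint_push _ _ bg) cintB//.
  exact: bmeas_push.
have lip_diff g : lip1 g -> forall x, x \in `[0, 1] -> `|g (Dx x) - g x| <= dl.
  move=> lg x; rewrite in_itv/= => xI; rewrite (le_trans (lg.2 _ _))//.
  rewrite DxE// addrAC subrr add0r normrM gtr0_norm//.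
  by rewrite -[leRHS]mulr1 ler_wpM2l ?(ltW dl0).
have bdiff g : bmeas g -> bmeas (fun x => g (Dx x) - g x).
  by move=> bg; apply: bmeasB => //; exact: bmeas_push.
have wn_zeta : wn zeta <= dl.
  apply: wn_le => g lg; have bg := lip1_bmeas lg.
  rewrite (cint_zeta _ _ bg) (le_trans (ler_norm _))//.
  rewrite (@le_trans _ _ (dl * tv pd))//; last by rewrite -[leRHS]mulr1 ler_wpM2l ?(ltW dl0).
  by apply: cint_le_I01; [exact: bdiff|exact: ltW|exact: lip_diff].
have muE g : bmeas g -> cint mu g = cint (L mu) g + cint eta g.
  move=> bg.
  have e1 : cint (L mu) g = cint (L (f dl)) g - cint (L f0) g.
    exact: (dual_cintB LLt (f dl) f0 bg).
  have e2 : cint eta g = cint (hconv rho (push (D dl) pd)) g - cint (L (f dl)) g.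
    exact: (dual_cintB (dual_hconv rho) (push (D dl) pd) pd bg).
  have e3 : cint mu g = cint (f dl) g - cint f0 g by exact: cint_bs_sub.
  have e6 : cint (hconv rho (push (D dl) pd)) g =
      cint (transfer rho (selfmap_comp (D dl) T0) (f dl)) g.
    rewrite (cint_hconv21 rho (push (D dl) pd) bg).
    rewrite (cint_hconv21 rho (push (selfmap_comp (D dl) T0) (f dl)) bg).
    have bH := bmeas_hconv1 rho bg; set H := (X in bmeas X) in bH *.
    rewrite (cint_push _ _ bH) (cint_push _ _ (bmeas_push (D dl) bH)) (cint_push _ _ bH).
    apply: cint_eq_I01; [exact: (bmeas_push T0 (bmeas_push (D dl) bH))|exact: bmeas_push|].
    move=> x xI; rewrite !selfmap_extE//=; exact: selfmap_in.
  have /bs_eqP/(_ g bg) e4 := ff; have /bs_eqP/(_ g bg) e5 := f0_fixed.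
  have aux (m lm et x y lx ly z : R) : m = x - y -> lm = lx - ly ->
      et = z - lx -> z = x -> ly = y -> m = lm + et.
    by move=> -> -> -> -> ->; ring.
  exact: aux e3 e1 e2 (etrans e6 e4) e5.
have mu_eq := neumann_perturb L_mass HN mu0 eta0 muE.
(* The a priori bound: [D dl] moves points by at most [dl], and the noise turns this Wasserstein
   estimate into one in total variation. *)
have tv_mu : tv mu <= B * C1 * dl.
  rewrite (tv_bs_eq mu_eq) (le_trans (spec_tv HN eta0))//.
  rewrite -[leRHS]mulrA ler_wpM2l//.
  by have [h _ _] := HC zeta; rewrite (le_trans h)// ler_wpM2l.
set h := hconv rho dfS in h_L1 h0 *.
rewrite norm1E; last first.
  apply: is_L1_sub; last exact: (spec_L1 HN).
  by apply: is_L1_scale; exact: is_L1_sub.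
rewrite !lee_fin tv_ge0/=.
rewrite (tv_bs_eq (neumann_perturb_sub L_mass HN dl^-1 mu0 eta0 h0 muE)).
have arg0 := mass0_scale_sub dl^-1 eta0 h0.
have -> : v dl = B * (C1 * ((B * C1 + 5 * M) * dl)) by rewrite /v; ring.
rewrite (le_trans (spec_tv HN arg0))// ler_wpM2l//.
pose xi := bs_sub (bs_scale dl^-1 zeta) dfS.
have -> : tv (bs_sub (bs_scale dl^-1 eta) h) = tv (hconv rho xi).
  apply: tv_bs_eq; apply/bs_eqP => g bg.
  have e1 := cint_bs_sub (bs_scale dl^-1 eta) h bg.
  have e2 := cint_bs_scale dl^-1 eta bg.
  have e3 := dual_cintB (dual_hconv rho) (bs_scale dl^-1 zeta) dfS bg.
  have e4 := dual_cintZ (dual_hconv rho) dl^-1 zeta bg.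
  exact: (etrans (etrans e1 (congr1 (fun z => z - cint h g) e2))
    (esym (etrans e3 (congr1 (fun z => z - cint h g) e4)))).
have [hx _ _] := HC xi; rewrite (le_trans hx)// ler_wpM2l//.
apply: wn_le => g lg; have bg := lip1_bmeas lg.
(* The first term carries [f dl - f0]; the second, in parentheses, compares the deformation of the
   fixed measure [p0] with its derivative. *)
have xiE (k : RM -> R) : bmeas k -> cint xi k =
    dl^-1 * cint (push T0 mu) (fun x => k (Dx x) - k x) +
    (dl^-1 * cint p0 (fun x => k (Dx x) - k x) - cint dfS k).
  move=> bk; rewrite (cint_bs_sub _ _ bk) (cint_bs_scale _ _ bk) (cint_zeta _ _ bk).
  have := dual_cintB (dual_push T0) (f dl) f0 (bdiff _ bk).
  by rewrite -/pd -/p0 -/mu => ->; ring.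
(* In the first term the test function changes by at most [dl], which cancels [dl^-1] and leaves
   [tv mu]. *)
rewrite (xiE _ bg) mulrDl lerD//.
  rewrite ler_pdivrMl// (mulrC dl) (le_trans (ler_norm _))//.
  rewrite mulrC (@le_trans _ _ (dl * tv (push T0 mu)))//.
    by apply: cint_le_I01; [exact: bdiff|exact: ltW|exact: lip_diff].
  by rewrite ler_wpM2l ?(ltW dl0)// (le_trans (tv_push _ _)).
pose c := 2 / dl * tv p0 + tv dfS.
have c_ge0 : 0 <= c by rewrite addr_ge0 ?tv_ge0// mulr_ge0 ?tv_ge0// divr_ge0// ltW.
(* [dl] is fixed here, so the mollification error [e * c] may be sent to 0 although [c] contains
   [2 / dl]. *)
suff main e : 0 < e -> dl^-1 * cint p0 (fun x => g (Dx x) - g x) - cint dfS g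
    <= 5 * M * dl + e * c.
  apply/ler_addgt0Pr => r r0; have rc : 0 < r / (c + 1) by rewrite divr_gt0// ltr_wpDl.
  rewrite (le_trans (main _ rc))// lerD2l mulrAC ler_pdivrMr ?ltr_wpDl//.
  by rewrite ler_wpM2l ?(ltW r0)// lerDl.
move=> e0.
have lm := moll_lip1 lg e0; have bm := lip1_bmeas lm.
have est := response_estimate nda ndb Sc_lip Sc0 dl0 dl1 mDx DxE Dx_in Dx_onto
  bm (bmeas_moll' e lg) (moll'_le lg e0) (fun c cI => moll_diff lg e0 (proj2 (andP cI))).
(* Where [S] vanishes, [Dx] is the identity and the integrand is zero; elsewhere the truncated
   density [a - b] agrees almost everywhere with that of [p0]. *)
have p0E k : bmeas k -> cint p0 (fun x => k (Dx x) - k x) =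
    ib 0 1 (fun x => (k (Dx x) - k x) * (a x - b x)).
  move=> bk; have bd := bdiff _ bk.
  rewrite (cint_density p0_L1 bd) (ib_RintegralE _ _ (bmeasM bd bab)) /Rintegral.
  congr fine; apply: ae_eq_integral => //.
  - exact: measurable_int (density_bmeasM p0_L1 bd).
  - by apply/measurable_EFinP/measurable_funTS; exact: (bmeasM bd bab).1.
  - apply: filterS abE => x /= hx' xI; rewrite hx'//.
    have [S_0|/eqP S_n0] := pselect (S x = 0).
      by rewrite DxE ?(Sc_id xI) ?S_0 ?mulr0 ?addr0 ?subrr ?mul0r//; move: xI; rewrite in_itv.
    by rewrite indicE mem_set ?mul1r//; apply: subset_closure.
have bgm : bmeas (fun x : RM => g x - moll g e x) by exact: bmeasB.
have gm x : `|g x - moll g e x| <= e by rewrite distrC; exact: moll_close.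
have gE : dl^-1 * cint p0 (fun x => g (Dx x) - g x) - cint dfS g =
    (dl^-1 * cint p0 (fun x => moll g e (Dx x) - moll g e x) - cint dfS (moll g e)) +
    (dl^-1 * cint p0 (fun x => (g (Dx x) - moll g e (Dx x)) - (g x - moll g e x))
      - cint dfS (fun x => g x - moll g e x)).
  have -> : cint p0 (fun x => (g (Dx x) - moll g e (Dx x)) - (g x - moll g e x)) =
     cint p0 (fun x => g (Dx x) - g x) - cint p0 (fun x => moll g e (Dx x) - moll g e x).
    rewrite -(cintB _ (bdiff _ bg) (bdiff _ bm)); congr (cint _ _).
    by apply/funext => x; ring.
  by rewrite (cintB _ bg bm); ring.
rewrite gE lerD//.
  by rewrite (p0E _ bm) (le_trans (ler_norm _)).
rewrite (le_trans (ler_norm _))// (le_trans (ler_normB _ _))// /c [leRHS]mulrDr lerD//.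
  rewrite normrM gtr0_norm ?invr_gt0//.
  have -> : e * (2 / dl * tv p0) = dl^-1 * ((2 * e) * tv p0) by ring.
  rewrite ler_wpM2l ?invr_ge0 ?(ltW dl0)//; apply: cint_le.
    exact: (bdiff _ bgm).
  move=> x; rewrite (_ : 2 * e = e + e); last by ring.
  exact: le_trans (ler_normB _ _) (lerD (gm _) (gm _)).
exact: cint_le.
Unshelve. all: by end_near. Qed.

End response_map.

Theorem corollary15 (R : realType) (xibar : R) (rho : R -> bs R)
    (T0 : borel_selfmap R) (f0 : bs R)
    (xibar_gt0 : 0 < xibar)
    (T0_nonsingular : nonsingular T0)
    (rho_density : forall xi : R, 0 <= xi < xibar ->
       is_BV (rho xi) /\ is_probability (rho xi))
    (mixing : forall g : bs R, is_BV g -> g I01 = 0%E ->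
       norm1 (iter n (transfer (rho 0) T0) g) @[n --> \oo] --> 0%E)
    (f0_probability : is_probability f0)
    (f0_fixed : bs_eq (transfer (rho 0) T0 f0) f0) :
  (forall (deltabar : R) (S : R -> R) (D : R -> borel_selfmap R) (K : R)
      (f : R -> bs R),
    0 < deltabar ->
    1.-lipschitz_I01 S -> S 0 = 0 -> S 1 = 0 ->
    (forall delta : R, 0 <= delta < deltabar ->
       (forall x : R, x \in `[0, 1] -> D delta x = x + delta * S x) /\
       bilipschitz_homeo (D delta)) ->
    finite_union_of_intervals (support01 S) ->
    0 <= K ->
    (forall g : bs R, is_BV g ->
       (bvnorm_fun (fun x => (\1_(support01 S) x * density (push T0 g) x)%R)
        <= K%:E * bvnorm g)%E) ->
    (forall delta : R, 0 <= delta < deltabar ->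
       is_probability (f delta) /\
       bs_eq (transfer (rho 0) (selfmap_comp (D delta) T0) (f delta))
             (f delta)) ->
    exists (R1 : bs R -> bs R) (dfS : bs R),
      [/\ is_resolvent V_space norm1 (transfer (rho 0) T0) R1,
          is_distr_derivative (fun x => - (density (push T0 f0) x * S x)) dfS,
          V_space (hconv (rho 0) dfS) &
          norm1 (bs_sub (bs_scale delta^-1 (bs_sub (f delta) f0))
                        (R1 (hconv (rho 0) dfS)))
            @[delta --> 0^'+] --> 0%E])
  /\
  (forall (C : R) (rhodot : bs R) (f : R -> bs R),
    [lipschitz T0 x | x in I01] ->
    (forall xi : R, 0 <= xi < xibar ->
       (norm1 (bs_sub (rho xi) (rho 0%R)) <= (C * xi)%:E)%E) ->
    wnorm (bs_sub (bs_scale xi^-1 (bs_sub (rho xi) (rho 0))) rhodot)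
      @[xi --> 0^'+] --> 0%E ->
    (forall xi : R, 0 <= xi < xibar ->
       is_probability (f xi) /\ bs_eq (transfer (rho xi) T0 (f xi)) (f xi)) ->
    exists R1 : bs R -> bs R,
      [/\ is_resolvent VW_space wnorm (transfer (rho 0) T0) R1,
          VW_space (hconv rhodot (push T0 f0)) &
          wnorm (bs_sub (bs_scale xi^-1 (bs_sub (f xi) f0))
                        (R1 (hconv rhodot (push T0 f0))))
            @[xi --> 0^'+] --> 0%E]).
Proof.
have [BV0 p0] := rho_density 0 (introT andP (conj (lexx 0) xibar_gt0)).
split.
- move=> deltabar S D K f db S_lip S0 S1 D_def _ _ K_bound f_fixed.
  exact: (response_map T0_nonsingular BV0 p0 mixing f0_probability f0_fixed
    db S_lip S0 D_def K_bound f_fixed).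
- move=> C rhodot f T0_lip rho_lip rho_diff f_fixed.
  exact: (response_noise xibar_gt0 rho_density mixing f0_probability f0_fixed
    T0_lip rho_lip rho_diff f_fixed).
Qed.
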